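(* Let $N>1$ and let $T=\{T_\omega\}_{\omega\in\Omega}$ be a random Saussol map on a compact set $C\subset\mathbb{R}^N$ over $\sigma:\Omega\to\Omega$, with constants $\alpha\in(0,1]$, $S>0$ and parameter $\varepsilon_0>0$ small enough, with transfer operators $\mathcal{L}_\omega$ on $V_\alpha$, and assume $\int_\Omega\log^+\|\mathcal{L}_\omega\|_\alpha\,d\mathbb{P}(\omega)<\infty$. Assume that $m(C)\ge1$. Then the number $r$ of ergodic skew product ACIPs of $T$ satisfies $$r\le\frac{m(C)}{\gamma_N}\operatorname*{ess\,inf}_{\omega\in\Omega}\left(\Theta(\omega)^{N/\alpha}\right),$$ where $\gamma_N$ is the volume of the $N$-dimensional unit ball and $$\Theta(\omega)=\tilde D\,m(C)\left(1+\frac{\theta(\omega)}{1-\xi}\right),$$ with $\tilde D$, $\xi$ and $\theta(\omega)$ the Lasota–Yorke data of $T$ specified in the context.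
   Context: **Notation.** $N>1$ throughout; $m$ is Lebesgue measure on $\mathbb{R}^N$, $d$ the Euclidean metric, $B_\varepsilon(x)$ the open ball of radius $\varepsilon$ about $x$, and $B_\varepsilon(K)=\{x: d(x,K)<\varepsilon\}$ for a set $K$. **Space of bounded oscillation.** For a Borel set $K\subset\mathbb{R}^N$ and $f\in L^1(\mathbb{R}^N)$, $\mathrm{osc}(f,K)=\operatorname{ess\,sup}_K f-\operatorname{ess\,inf}_K f$. For $0<\alpha\le1$ and $\tilde\varepsilon_0>0$, $|f|_\alpha=\sup_{0<\varepsilon\le\tilde\varepsilon_0}\varepsilon^{-\alpha}\int_{\mathbb{R}^N}\mathrm{osc}(f,B_\varepsilon(x))\,dx$. For $C\subset\mathbb{R}^N$ Borel, $f\in L^1(C)$ is identified with its extension by zero to $\mathbb{R}^N$; $V_\alpha$ is the set of $f\in L^1(C)$ with $|f|_\alpha<\infty$, with norm $\|f\|_\alpha=\|f\|_{L^1}+|f|_\alpha$. Here $\tilde\varepsilon_0=S\varepsilon_0$. $V_\alpha$ is a Banach space compactly embedded in $L^1(C)$. **Random Saussol map.** Let $(\Omega,\mathcal{F},\mathbb{P})$ be a probability space ($\Omega$ a topological space and $\mathbb{P}$ Borel), and $\sigma:\Omega\to\Omega$ invertible, ergodic and $\mathbb{P}$-preserving. Let $C\subset\mathbb{R}^N$ be compact with $\mathrm{clos}(\mathrm{int}(C))\ne\emptyset$. A random Saussol map $T$ over $\sigma$ is a family of maps $T_\omega:C\to C$ ($\omega\in\Omega$) such that there are an at most countable family (possibly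 depending on $\omega$) of disjoint open sets $U_i\subset C$ and open sets $V_i\supset\mathrm{clos}(U_i)$, $i\in\mathcal{I}$, and maps $T_{\omega,i}:V_i\to\mathbb{R}^N$ satisfying, for some $0<\alpha\le1$ and all small enough $\varepsilon_0>0$: (PE1) There is $S>0$ such that for $\mathbb{P}$-a.e. $\omega$ one has $0<s(\omega)<S$ and, for all $i\in\mathcal{I}$ and $u,v\in T_{\omega,i}V_i$ with $d(u,v)\le\varepsilon_0$, $d(T_{\omega,i}^{-1}u,T_{\omega,i}^{-1}v)\le s(\omega)d(u,v)$; moreover $\int_\Omega\log(s(\omega))\,d\mathbb{P}(\omega)<0$. (PE2) For $\mathbb{P}$-a.e. $\omega$ and all $i$: $T_\omega|_{U_i}=T_{\omega,i}|_{U_i}$ and $T_{\omega,i}(V_i)\supset B_{\varepsilon_0}(T_{\omega,i}(U_i))$. (PE3) For $\mathbb{P}$-a.e. $\omega$ and all $i$: $T_{\omega,i}\in C^1(V_i)$ is injective and $T_{\omega,i}^{-1}\in C^1(T_{\omega,i}V_i)$; moreover there is $c>0$ such that for $\mathbb{P}$-a.e. $\omega$, all $i$, $\varepsilon\le\varepsilon_0$, $z\in T_{\omega,i}V_i$ and $x,y\in B_\varepsilon(z)\cap T_{\omega,i}V_i$, $|\det DT_{\omega,i}^{-1}x-\det DT_{\omega,i}^{-1}y|\le c\,|\det DT_{\omega,i}^{-1}z|\,\varepsilon^\alpha$. (PE4) For $\mathbb{P}$-a.e. $\omega$, $m(C\setminus\bigcup_{i\in\mathcal{I}}U_i)=0$.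 (PE5) Let $G_{\omega,\varepsilon_0}(\varepsilon)=\sup_{x\in C}\sum_{i\in\mathcal{I}}\dfrac{m\big(T_{\omega,i}^{-1}B_\varepsilon(\partial T_\omega U_i)\cap B_{(S-s(\omega))\varepsilon_0}(x)\big)}{m(B_{(S-s(\omega))\varepsilon_0}(x))}$ and $\zeta_{\varepsilon_0}(\omega)=s(\omega)^\alpha+2\sup_{0<\varepsilon\le\varepsilon_0}\dfrac{G_{\omega,\varepsilon_0}(\varepsilon)}{\varepsilon^\alpha}(S\varepsilon_0)^\alpha$. Then $\int_\Omega\log(\zeta_{\varepsilon_0}(\omega))\,d\mathbb{P}(\omega)<0$. The transfer operator is $\mathcal{L}_\omega f=\sum_{i\in\mathcal{I}}\big((g_\omega f)\circ T_{\omega,i}^{-1}\big)1_{T_\omega U_i}$ with $g_\omega=1/|\det DT_\omega|$. It is also assumed that $\omega\mapsto\mathcal{L}_\omega$ (into the bounded operators on $V_\alpha$) is $\mathbb{P}$-continuous: $\Omega$ is a countable union of Borel sets on each of which the restriction of the map is continuous. **Lasota–Yorke data and $\Theta$.** For $\varepsilon_0$ small enough there are a measurable $\eta:\Omega\to\mathbb{R}^+$ with $\int_\Omega\log(\eta(\omega))\,d\mathbb{P}(\omega)<0$ and a constant $\tilde D>0$ with $\|\mathcal{L}_\omega f\|_\alpha\le\eta(\omega)\|f\|_\alpha+\tilde D\|f\|_{L^1}$ for $\mathbb{P}$-a.e. $\omega$ and all $f\in V_\alpha$. Fix such $\eta,\tilde D$. Write $\log\hat\xi=\int_\Omega\log(\eta(\omega))\,d\mathbb{P}(\omega)$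 and choose $\xi$ with $\hat\xi<\xi<1$ and $\xi>\frac12$; $\tilde D$ is taken large enough that also $\tilde D\ge\xi\tilde\varepsilon_0^{-\alpha}$. Put $\eta^{(j)}(\sigma^{-j}\omega)=\eta(\sigma^{-1}\omega)\eta(\sigma^{-2}\omega)\cdots\eta(\sigma^{-j}\omega)$. For $\mathbb{P}$-a.e. $\omega$ let $j_0(\omega)$ be such that $\eta^{(j)}(\sigma^{-j}\omega)<\xi^j$ for all $j\ge j_0(\omega)$ (it exists by Birkhoff's theorem), and set $\theta(\omega)=\max_{1\le j\le j_0(\omega)}\max\big(\eta^{(j)}(\sigma^{-j}\omega)/\xi^j,\,1\big)$. **Skew product ACIPs.** The skew product is $F(\omega,x)=(\sigma\omega,T_\omega(x))$ on $\Omega\times C$ (taken to be measurable). A skew product ACIP is an $F$-invariant probability measure of the form $\mu(A)=\int_\Omega\mu_\omega(A_\omega)\,d\mathbb{P}(\omega)$, with $A_\omega=\{x:(\omega,x)\in A\}$ and $\mu_\omega$ probability measures on $C$ absolutely continuous with respect to $m$ (equivalently, $\mu$ is absolutely continuous with respect to $\mathbb{P}\times m$); it is ergodic if it is ergodic for $F$. *)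

(* Defs.v *)
From HB Require Import structures.
From mathcomp Require Import all_boot all_order all_algebra.
From mathcomp Require Import all_classical all_reals all_analysis measurable_realfun ess_sup_inf.
Set Implicit Arguments. Unset Strict Implicit. Unset Printing Implicit Defensive.
Import Order.TTheory GRing.Theory Num.Theory.
Import numFieldNormedType.Exports.
Local Open Scope classical_set_scope.
Local Open Scope ring_scope.

Section euclidean_space.
Context {R : realType}.

(* Borel sigma-algebra of R^n; the topology of 'rV[R]_n is the Euclidean one. *)
HB.instance Definition _ (n : nat) :=
  @isMeasurable.Build (sigma_display (@open 'rV[R]_n)) 'rV[R]_n
  <<s @open 'rV[R]_n >>
  (@sigma_algebra0 _ setT _) (@sigma_algebraC _ _)
  (@sigma_algebra_bigcup _ setT _).

Lemma measurable_rV_coord n (i : 'I_n) :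
  measurable_fun [set: 'rV[R]_n] (fun v => v ord0 i).
Proof.
apply: (measurability _ (RGenOpens.measurableE R)) => // _ [_ [a [b ->]] <-].
rewrite setTI; apply: sub_sigma_algebra.
apply: open_comp (@interval_open _ _ _ _ _) => // v _; exact: coord_continuous.
Qed.

Lemma measurable_fun_rV d (T : measurableType d) n (f : T -> 'rV[R]_n) :
  (forall i, measurable_fun setT (fun x => f x ord0 i)) ->
  measurable_fun setT f.
Proof.
move=> mf; apply: (measurability (@open 'rV[R]_n)) => // _ [W oW <-].
pose c (p : 'rV[rat]_n * nat) i : R := ratr (p.1 ord0 i).
pose B p := [set v : 'rV[R]_n | forall i, `|c p i - v ord0 i| < p.2.+1%:R^-1].
have fB p : f @^-1` B p =
    \bigcap_(i in [set: 'I_n]) ((fun x => f x ord0 i) @^-1` ball (c p i) p.2.+1%:R^-1).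
  by apply/seteqP; split=> x /= Bx i => [_|]; exact: Bx.
rewrite setTI (_ : f @^-1` W = \bigcup_(p in [set p | B p `<=` W]) (f @^-1` B p)).
  rewrite bigcup_mkcond; apply: countable_bigcupT_measurable => // p.
  case: ifPn => // _; rewrite fB; apply: fin_bigcap_measurable => // i _.
  rewrite -[X in measurable X]setTI; apply: mf => //.
  by apply: open_measurable; exact: ball_open.
apply/seteqP; split=> [x /= Wx|x [p /= pW /pW //]].
have /nbhs_ballP[e /= e0 eW] : nbhs (f x) W by exact: open_nbhs_nbhs.
have e20 : 0 < e / 2 by rewrite divr_gt0.
have [k ke] : exists k, k.+1%:R^-1 < e / 2.
  have [k _ kP] := near_infty_natSinv_lt (PosNum e20).
  by exists k; apply: kP => /=.
have k0 : 0 < k.+1%:R^-1 :> R by rewrite invr_gt0.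
have qP i : exists q : rat, `|ratr q - f x ord0 i| < k.+1%:R^-1.
  have [q] := @rat_in_itvoo R _ (f x ord0 i + k.+1%:R^-1) (ltr_pwDr k0 (lexx _)).
  by rewrite in_itv /= => /andP[q1 q2]; exists q; rewrite gtr0_norm ?subr_gt0// ltrBlDl.
pose q := \row_i sval (cid (qP i)).
have qE i : `|c (q, k) i - f x ord0 i| < k.+1%:R^-1.
  by rewrite /c /= mxE; case: cid.
exists (q, k) => //= v Bv; apply: eW; split=> // i j; rewrite ord1.
rewrite /ball /= -(subrK (c (q, k) j) (f x ord0 j)) -addrA.
rewrite (le_lt_trans (ler_normD _ _))// distrC (splitr e) ltrD//.
  exact: lt_trans (qE j) ke.
exact: lt_trans (Bv j) ke.
Qed.

Definition consrV n (p : 'rV[R]_n * R) : 'rV[R]_(1 + n) := row_mx p.2%:M p.1.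

Lemma measurable_consrV n : measurable_fun setT (@consrV n).
Proof.
apply: measurable_fun_rV => i; rewrite /consrV; case: (@split_ordP 1 n i) => j ->.
  rewrite (_ : (fun _ => _) = snd) ?measurable_snd//.
  by apply/funext => p; rewrite row_mxEl (ord1 j) mxE eqxx mulr1n.
rewrite (_ : (fun _ => _) = (fun v : 'rV[R]_n => v ord0 j) \o fst).
  by apply: measurableT_comp => //; exact: measurable_rV_coord.
by apply/funext => p; rewrite row_mxEr.
Qed.

Section lebesgue_consrV.
Variables (n : nat) (m : {measure set 'rV[R]_n -> \bar R}).

Let map := pushforward (m \x lebesgue_measure)%E (@consrV n).
Let mf := @measurable_consrV n.

Let map0 : map set0 = 0%E. Proof. exact: measure0. Qed.

Let map_ge0 A : (0 <= map A)%E. Proof. exact: measure_ge0. Qed.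

Let map_sigma_additive : semi_sigma_additive map.
Proof. exact: measure_semi_sigma_additive. Qed.

HB.instance Definition _ := isMeasure.Build _ _ _ map
  map0 map_ge0 map_sigma_additive.

Definition lebesgue_consrV : {measure set 'rV[R]_n.+1 -> \bar R} := map.
End lebesgue_consrV.

(* N-dimensional Lebesgue measure, as an iterated product measure. *)
Fixpoint lebesgue_rV n : {measure set 'rV[R]_n -> \bar R} :=
  if n is n'.+1 then lebesgue_consrV (lebesgue_rV n') else dirac (0 : 'rV[R]_0).

Lemma measurable_box n (A : 'I_n -> set R) :
  (forall i, measurable (A i)) ->
  measurable [set v : 'rV[R]_n | forall i, A i (v ord0 i)].
Proof.
move=> mA.
rewrite (_ : mkset _ = \bigcap_(i in [set: 'I_n]) ((fun v : 'rV[R]_n => v ord0 i) @^-1` A i)).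
  apply: fin_bigcap_measurable => // i _.
  by rewrite -[X in measurable X]setTI; exact: measurable_rV_coord.
by apply/seteqP; split=> v /= vA i => [_|]; exact: vA.
Qed.

(* Boxes have the expected volume, which characterizes Lebesgue measure. *)
Lemma lebesgue_rV_box n (A : 'I_n -> set R) :
  (forall i, measurable (A i)) ->
  lebesgue_rV n [set v : 'rV[R]_n | forall i, A i (v ord0 i)] =
  (\prod_(i < n) lebesgue_measure (A i))%E.
Proof.
elim: n A => [|n IH] A mA /=.
  by rewrite big_ord0 diracE mem_set//= => -[].
rewrite big_ord_recl -(IH (fun i => A (lift ord0 i)))//.
have mB := @measurable_box n _ (fun i => mA (lift ord0 i)).
rewrite muleC -product_measure1E//.
rewrite /lebesgue_consrV /= /pushforward; congr (_ _).
have e1 p i : consrV p ord0 (lift ord0 i : 'I_(1 + n)) = p.1 ord0 i :> R.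
  by rewrite (_ : lift _ _ = rshift 1 i) ?row_mxEr//; apply/val_inj.
have e0 p : consrV p ord0 (ord0 : 'I_(1 + n)) = p.2 :> R.
  have -> : ord0 = lshift n (0 : 'I_1) :> 'I_(1 + n) by apply: val_inj.
  by rewrite ?row_mxEl ?mxE ?eqxx ?mulr1n.
apply/seteqP; split=> [p /= pA|p /= [pA p0] i].
  by split=> [i|]; [rewrite -e1|rewrite -e0]; exact: pA.
case: (unliftP ord0 i) => [j|] ->.
  by move: (pA j); rewrite -e1.
by move: p0; rewrite -e0.
exact: mA.
Qed.

(* MathComp-Analysis norms 'rV[R]_n by the sup norm, hence an explicit Euclidean
   distance. *)
Definition eucl_dist n (x y : 'rV[R]_n) : R :=
  Num.sqrt (\sum_(i < n) (x ord0 i - y ord0 i) ^+ 2).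

Definition eucl_ball n (x : 'rV[R]_n) (e : R) : set 'rV[R]_n :=
  [set y | eucl_dist x y < e].

Definition eucl_dist_set n (x : 'rV[R]_n) (K : set 'rV[R]_n) : \bar R :=
  ereal_inf [set (eucl_dist x y)%:E | y in K].

Definition eucl_nbhd n (K : set 'rV[R]_n) (e : R) : set 'rV[R]_n :=
  [set x | eucl_dist_set x K < e%:E]%E.

Definition boundary n (A : set 'rV[R]_n) : set 'rV[R]_n :=
  closure A `\` interior A.

(* C^1 regularity on A presupposes that A is open. *)
Definition C1_on n (A : set 'rV[R]_n) (f : 'rV[R]_n -> 'rV[R]_n) : Prop :=
  open A /\ forall x, A x -> differentiable f x /\
                             {for x, continuous (fun y => 'J f y)}.

End euclidean_space.

Section quasi_holder.
Context {R : realType} {n : nat}.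
Local Notation m := (@lebesgue_rV R n).
Local Open Scope ereal_scope.
Implicit Types (f : 'rV[R]_n -> R) (K C : set 'rV[R]_n).

(* Essential supremum minus essential infimum of f over K, for m restricted
   to K. *)
Definition osc f K : \bar R :=
  ereal_inf [set y | \forall x \ae m, K x -> (f x)%:E <= y] -
  ereal_sup [set y | \forall x \ae m, K x -> y <= (f x)%:E].

Definition L1norm f : \bar R := \int[m]_x `|(f x)%:E|.

(* L^1(C), each function being extended by zero outside of C. *)
Definition L1_on C f : Prop :=
  m.-integrable setT (EFin \o f) /\ forall x, ~ C x -> f x = 0%R.

Variables (C : set 'rV[R]_n) (alpha te0 : R).

Definition var_seminorm f : \bar R :=
  ereal_sup [set (e `^ (- alpha))%:E * \int[m]_x osc f (eucl_ball x e)
            | e in [set e | 0 < e <= te0]%R].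

Definition Valpha f : Prop := L1_on C f /\ var_seminorm f < +oo.

Definition Vnorm f : \bar R := L1norm f + var_seminorm f.

Definition opnorm (A : ('rV[R]_n -> R) -> ('rV[R]_n -> R)) : \bar R :=
  ereal_sup [set Vnorm (A f) | f in [set f | Valpha f /\ Vnorm f <= 1]].

Definition bounded_op (A : ('rV[R]_n -> R) -> ('rV[R]_n -> R)) : Prop :=
  (forall f, Valpha f -> Valpha (A f)) /\ opnorm A < +oo.

End quasi_holder.

Definition borel (T : ptopologicalType) : measurableType _ :=
  g_sigma_algebraType (@open T).

Section ergodic_theory.
Context {d} {T : measurableType d} {R : realType}.
Implicit Types (mu : set T -> \bar R) (D : set T) (f : T -> T).
Local Open Scope ereal_scope.

(* f is viewed as a self-map of D, and mu as a measure carried by D. *)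
Definition preserves mu D f : Prop :=
  forall A, measurable A -> mu (D `&` f @^-1` A) = mu A.

Definition ergodic mu D f : Prop :=
  forall A, measurable A -> A `<=` D -> D `&` f @^-1` A = A ->
    mu A = 0 \/ mu A = 1.

Definition invertible_ergodic mu (sigma sigmaV : T -> T) : Prop :=
  [/\ cancel sigma sigmaV /\ cancel sigmaV sigma,
      measurable_fun setT sigma /\ measurable_fun setT sigmaV,
      preserves mu setT sigma & ergodic mu setT sigma].

(* "The integral of h exists in [-oo, +oo[ and is negative"; without the
   condition on the positive part the library's +oo - +oo = -oo would count. *)
Definition negative_mean mu (h : T -> \bar R) : Prop :=
  [/\ measurable_fun setT h, \int[mu]_w h^\+ w < +oo & \int[mu]_w h w < 0].

End ergodic_theory.

(* A family of maps T_w of C together with its branches T_(w, i), which are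
   indexed by i \in I w, a set of natural numbers, and its constants.  All maps
   are total functions: T_w matters on C only, and T_(w, i) on V_(w, i) only. *)
Record saussol_data (R : realType) (N : nat) (Omega : Type) := SaussolData {
  sC : set 'rV[R]_N ;
  sT : Omega -> 'rV[R]_N -> 'rV[R]_N ;
  sI : Omega -> set nat ;
  sU : Omega -> nat -> set 'rV[R]_N ;
  sV : Omega -> nat -> set 'rV[R]_N ;
  sbranch : Omega -> nat -> 'rV[R]_N -> 'rV[R]_N ;
  srate : Omega -> R ;
  salpha : R ;
  sS : R
}.

Section random_saussol_map.
Context {R : realType} {N : nat} {Omega : ptopologicalType}.
Variables (P : probability (borel Omega) R) (X : saussol_data R N Omega).
Local Notation m := (@lebesgue_rV R N).
Local Notation C := (sC X).
Local Notation T := (sT X).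
Local Notation I := (sI X).
Local Notation U := (sU X).
Local Notation V := (sV X).
Local Notation branch := (sbranch X).
Local Notation s := (srate X).
Local Notation alpha := (salpha X).
Local Notation S := (sS X).

(* The inverse of T_(w, i) : V_(w, i) -> T_(w, i) V_(w, i). *)
Definition branch_inv (w : Omega) (i : nat) : 'rV[R]_N -> 'rV[R]_N :=
  'pinv_(fun=> 0) (V w i) (branch w i).

Definition saussol_partition : Prop :=
  [/\ compact C, closure (interior C) !=set0,
      forall w x, C x -> C (T w x),
      forall w, trivIset (I w) (U w) &
      forall w i, I w i ->
        [/\ open (U w i), U w i `<=` C, open (V w i) &
            closure (U w i) `<=` V w i]].

Definition PE1 (e0 : R) : Prop :=
  (\forall w \ae P, 0 < s w < S /\
     forall i, I w i -> forall u v,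
       (branch w i @` V w i) u -> (branch w i @` V w i) v ->
       eucl_dist u v <= e0 ->
       eucl_dist (branch_inv w i u) (branch_inv w i v) <= s w * eucl_dist u v) /\
  negative_mean P (fun w => (ln (s w))%:E).

Definition PE2 (e0 : R) : Prop :=
  \forall w \ae P, forall i, I w i ->
    {in U w i, T w =1 branch w i} /\
    eucl_nbhd (branch w i @` U w i) e0 `<=` branch w i @` V w i.

Definition PE3 (e0 : R) : Prop :=
  (\forall w \ae P, forall i, I w i ->
     [/\ C1_on (V w i) (branch w i), {in V w i &, injective (branch w i)} &
         C1_on (branch w i @` V w i) (branch_inv w i)]) /\
  exists2 c : R, 0 < c &
    \forall w \ae P, forall i, I w i -> forall e, 0 < e <= e0 ->
      forall z x y, (branch w i @` V w i) z ->
        (eucl_ball z e `&` branch w i @` V w i) x ->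
        (eucl_ball z e `&` branch w i @` V w i) y ->
        `|\det ('J (branch_inv w i) x) - \det ('J (branch_inv w i) y)| <=
          c * `|\det ('J (branch_inv w i) z)| * e `^ alpha.

Definition PE4 : Prop :=
  \forall w \ae P, m (C `\` \bigcup_(i in I w) U w i) = 0%E.

Definition saussol_G (e0 : R) (w : Omega) (e : R) : \bar R :=
  let rho := (S - s w) * e0 in
  ereal_sup [set \esum_(i in I w)
      (m ((V w i `&` branch w i @^-1` eucl_nbhd (boundary (T w @` U w i)) e)
            `&` eucl_ball x rho) / m (eucl_ball x rho))%E | x in C].

Definition saussol_zeta (e0 : R) (w : Omega) : \bar R :=
  ((s w `^ alpha)%:E + 2%:E *
   ereal_sup [set saussol_G e0 w e / (e `^ alpha)%:E
             | e in [set e | (0 < e <= e0)%R]] *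
   ((S * e0) `^ alpha)%:E)%E.

Definition PE5 (e0 : R) : Prop :=
  negative_mean P (fun w => lne (saussol_zeta e0 w)).

Definition random_saussol_map : Prop :=
  [/\ saussol_partition, 0 < alpha <= 1, 0 < S &
      \forall e0 \near 0^'+, [/\ PE1 e0, PE2 e0, PE3 e0, PE4 & PE5 e0]].

Definition transfer (w : Omega) (f : 'rV[R]_N -> R) (y : 'rV[R]_N) : R :=
  fine (\sum_(0 <= i <oo | i \in I w)
    (let x := branch_inv w i y in
     `|\det ('J (T w) x)|^-1 * f x * \1_(T w @` U w i) y)%:E)%E.

Definition Pcontinuous_transfer (e0 : R) : Prop :=
  let te0 := S * e0 in
  (forall w, bounded_op C alpha te0 (transfer w)) /\
  exists B : nat -> set Omega,
    [/\ forall k, measurable (B k : set (borel Omega)),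
        \bigcup_k B k = setT &
        forall k w, B k w -> forall e : R, 0 < e ->
          \forall w' \near within (B k) (nbhs w),
            (opnorm C alpha te0 (fun f => transfer w' f \- transfer w f)%R
               <= e%:E)%E].

Definition log_integrable_transfer (e0 : R) : Prop :=
  (\int[P]_w maxe (lne (opnorm C alpha (S * e0) (transfer w))) 0 < +oo)%E.

Variables sigma sigmaV : Omega -> Omega.

Definition iter_eta (eta : Omega -> R) (j : nat) (w : Omega) : R :=
  \prod_(1 <= k < j.+1) eta (iter k sigmaV w).

Record lasota_yorke_data (e0 : R) (eta : Omega -> R) (D xi : R)
    (j0 : Omega -> nat) : Prop := LasotaYorkeData {
  LY_measurable : measurable_fun [set: borel Omega] eta ;
  LY_eta_gt0 : forall w, 0 < eta w ;
  LY_negative : negative_mean P (fun w => (ln (eta w))%:E) ;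
  LY_D_gt0 : 0 < D ;
  LY_ineq : \forall w \ae P, forall f, Valpha C alpha (S * e0) f ->
    (Vnorm alpha (S * e0) (transfer w f) <=
      (eta w)%:E * Vnorm alpha (S * e0) f + D%:E * L1norm f)%E ;
  LY_xi_gt : (expeR (\int[P]_w (ln (eta w))%:E) < xi%:E)%E ;
  LY_xi_lt1 : xi < 1 ;
  LY_xi_gt_half : 2^-1 < xi ;
  LY_D_large : xi * (S * e0) `^ (- alpha) <= D ;
  LY_j0 : \forall w \ae P, forall j, (j0 w <= j)%N ->
    iter_eta eta j w < xi ^+ j
}.

Definition LY_theta (eta : Omega -> R) (xi : R) (j0 : Omega -> nat)
    (w : Omega) : R :=
  \big[Num.max/1]_(1 <= j < (j0 w).+1) Num.max (iter_eta eta j w / xi ^+ j) 1.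

Definition LY_Theta (eta : Omega -> R) (D xi : R) (j0 : Omega -> nat)
    (w : Omega) : R :=
  D * fine (m C) * (1 + LY_theta eta xi j0 w / (1 - xi)).

Definition skew_product (p : borel Omega * 'rV[R]_N) : borel Omega * 'rV[R]_N :=
  (sigma p.1, T p.1 p.2).

Local Notation phase := ([set: borel Omega] `*` C).

Definition skew_acip (mu : probability (borel Omega * 'rV[R]_N)%type R) : Prop :=
  preserves mu phase skew_product /\
  exists k : R.-pker borel Omega ~> 'rV[R]_N,
    [/\ forall w, k w C = 1%E, forall w, k w `<< m &
        forall A, measurable A -> mu A = (\int[P]_w k w (xsection A w))%E].

Definition ergodic_skew_acip (mu : probability (borel Omega * 'rV[R]_N)%type R) :=
  skew_acip mu /\ ergodic mu phase skew_product.

(* Two measures are the same when they agree on measurable sets (a library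
   measure also has unspecified values on the other sets). *)
Definition number_of_ergodic_acips (r : nat) : Prop :=
  exists mu : 'I_r -> probability (borel Omega * 'rV[R]_N)%type R,
    [/\ forall i, ergodic_skew_acip (mu i),
        forall i j, {in measurable, mu i =1 mu j} -> i = j &
        forall nu, ergodic_skew_acip nu ->
          exists i, {in measurable, nu =1 mu i}].

End random_saussol_map.

(* Main.v *)
Require Import Defs.
From HB Require Import structures.
From mathcomp Require Import all_boot all_order all_algebra.
From mathcomp Require Import all_classical all_reals all_analysis.
From mathcomp Require Import measurable_realfun ess_sup_inf.
From mathcomp Require Import perm ring lra.
Set Implicit Arguments. Unset Strict Implicit. Unset Printing Implicit Defensive.
Import Order.TTheory GRing.Theory Num.Theory.
Import numFieldNormedType.Exports.
Local Open Scope classical_set_scope.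
Local Open Scope ring_scope.

(** Let H_w be the fiber densities of an ergodic skew product ACIP, so that the transfer
operators satisfy L_w H_w = H_(sigma w).  Approximate H in L^1(P x m) by functions whose
fibers f are uniformly Lipschitz and supported in C, hence uniformly bounded in V_alpha.
Pushing f forward from the fiber of sigma^-j w to that of w does not increase its L^1
distance to the densities, while the iterated Lasota-Yorke inequality forgets the norm of f:
for large j the result g has |g|_alpha at most about D theta(w) / (1 - xi), with integral
almost 1.  At scale e = Theta(w)^(-1/alpha) the mean oscillation of g over e-balls is then
below a constant smaller than 1, so g is bounded below on some e-ball.  In the L^1 limit,
m {H_w > 0} >= gamma_N e^N.  Distinct ergodic ACIPs have densities with disjoint supports up
to null sets, so r gamma_N Theta(w)^(-N/alpha) <= m(C) for almost every w.

L_w H_w = H_(sigma w) rests on the change of variables formula, which is obtained by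
comparing both sides on small boxes around a point and bisecting. *)

(** * Boxes and uniqueness of Lebesgue measure *)

(** Oscillations see the extension by zero, so an approximant has to reach zero continuously at the
    boundary of [C]. This is possible because every invariant density vanishes off one open subset
    of [C]: the branch domains of a single good fiber already have full measure in [C], and they
    serve all the other fibers.

    The Lipschitz constant is uniform over the fibers because the approximant used for [w] lives
    over sigma^-j w, where [j] depends on its norm.

    Theta is a scale in disguise: for [e = Theta^(-1/alpha)] the seminorm bound gets divided by
    Theta. With [A = theta / (1 - xi)] this leaves at most [A / (1 + A)], which is below 1 however
    large theta is; the gap [1 / (1 + A)] absorbs the errors of approximation.

    Finiteness of the number of ergodic measures is part of the claim, so the estimate is made for
    an arbitrary finite family of distinct measures.

    Lebesgue measure is an iterated product here, so its behavior under linear maps is not visible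
    from its definition. The existence of a scaling factor comes from uniqueness of translation
    invariant measures, and its value from Gaussian elimination. *)

Lemma measurable_lt_set d (T : measurableType d) (R : realType) (u v : T -> R) :
  measurable_fun setT u -> measurable_fun setT v -> measurable [set x | u x < v x].
Proof.
move=> mu mv; rewrite (_ : [set x | _] = ~` (setT `&` [set x | v x <= u x])).
  by apply: measurableC; exact: measurable_fun_le.
apply/seteqP; split => x /=; first by rewrite ltNge => /negP h [_].
by move=> h; rewrite ltNge; apply/negP => h'; apply: h.
Qed.

Section boxes.
Context {R : realType}.

(** Half-open, so that cutting a box in one coordinate gives two disjoint boxes of the same kind.
    The closed [cbox] is what contains the limit point of nested boxes. *)
Definition box n (a b : 'rV[R]_n) : set 'rV[R]_n :=
  [set v | forall i, a ord0 i <= v ord0 i < b ord0 i].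

Definition cbox n (a b : 'rV[R]_n) : set 'rV[R]_n :=
  [set v | forall i, a ord0 i <= v ord0 i <= b ord0 i].

(** Rational corners leave countably many boxes, still closed under intersection: a countable
    pi-system generating the Borel sets. *)
Definition rbox n (p : 'rV[rat]_n * 'rV[rat]_n) : set 'rV[R]_n :=
  box (map_mx ratr p.1) (map_mx ratr p.2).

Lemma boxE n (a b : 'rV[R]_n) :
  box a b = [set v | forall i, [set` `[a ord0 i, b ord0 i[%R] (v ord0 i)].
Proof. by apply/seteqP; split => v /= vab i; have := vab i; rewrite in_itv. Qed.

Lemma measurable_rV_box n (a b : 'rV[R]_n) : measurable (box a b).
Proof.
rewrite boxE; apply: (@measurable_box _ _ (fun i => `[a ord0 i, b ord0 i[%classic)) => i.
exact: measurable_itv.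
Qed.

Lemma box_set0 n (a b : 'rV[R]_n) i : b ord0 i < a ord0 i -> box a b = set0.
Proof.
move=> ba; apply/seteqP; split => // v /(_ i) /andP[av vb].
by have := lt_trans (le_lt_trans av vb) ba; rewrite ltxx.
Qed.

Lemma lebesgue_rV_boxE n (a b : 'rV[R]_n) : (forall i, a ord0 i <= b ord0 i) ->
  lebesgue_rV n (box a b) = (\prod_i (b ord0 i - a ord0 i))%:E.
Proof.
move=> ab; rewrite boxE.
rewrite (@lebesgue_rV_box _ _ (fun i => `[a ord0 i, b ord0 i[%classic)); last first.
  by move=> i; exact: measurable_itv.
rewrite -prodEFin; apply: eq_bigr => i _.
rewrite lebesgue_measure_itv /= lte_fin; have := ab i.
rewrite le_eqVlt => /orP[/eqP->|->]; last by rewrite EFinB.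
by rewrite ltxx subrr.
Qed.

Lemma lebesgue_rV_box_lty n (a b : 'rV[R]_n) : (lebesgue_rV n (box a b) < +oo)%E.
Proof.
have [ab|/existsNP[i /negP]] := pselect (forall i, a ord0 i <= b ord0 i).
  by rewrite lebesgue_rV_boxE// ltry.
by rewrite -ltNge => /box_set0 ->; rewrite measure0 ltry.
Qed.

Lemma rbox_setI n (p q : 'rV[rat]_n * 'rV[rat]_n) :
  rbox p `&` rbox q =
  rbox (\row_i Num.max (p.1 ord0 i) (q.1 ord0 i),
        \row_i Num.min (p.2 ord0 i) (q.2 ord0 i)).
Proof.
have mono : {homo (@ratr R) : x y / x <= y} by move=> x y; rewrite ler_rat.
apply/seteqP; split => v /=.
- move=> [pv qv] i; have /andP[p1 p2] := pv i; have /andP[q1 q2] := qv i.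
  move: p1 p2 q1 q2; rewrite !mxE => p1 p2 q1 q2.
  by apply/andP; split; [rewrite /Num.max|rewrite /Num.min]; case: ifP.
- move=> pqv; split => i; have := pqv i; rewrite !mxE => /andP[h1 h2];
  apply/andP; split.
  + by apply: le_trans h1; rewrite ler_rat le_max lexx.
  + by apply: lt_le_trans h2 _; rewrite ler_rat ge_min lexx.
  + by apply: le_trans h1; rewrite ler_rat le_max lexx orbT.
  + by apply: lt_le_trans h2 _; rewrite ler_rat ge_min lexx orbT.
Qed.

Lemma cbox_nbhs n (x : 'rV[R]_n) (W : set 'rV[R]_n) : nbhs x W ->
  exists2 p, rbox p x & cbox (map_mx ratr p.1) (map_mx ratr p.2) `<=` W.
Proof.
move=> /nbhs_ballP[e /= e0 eW].
have lo i : exists q : rat, x ord0 i - e < ratr q < x ord0 i.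
  have [q] := @rat_in_itvoo R (x ord0 i - e) (x ord0 i) (ltac:(by rewrite ltrBlDr ltrDl)).
  by rewrite in_itv /= => h; exists q.
have hi i : exists q : rat, x ord0 i < ratr q < x ord0 i + e.
  have [q] := @rat_in_itvoo R (x ord0 i) (x ord0 i + e) (ltac:(by rewrite ltrDl)).
  by rewrite in_itv /= => h; exists q.
exists (\row_i sval (cid (lo i)), \row_i sval (cid (hi i))).
  move=> i; rewrite !mxE /=; case: cid => q /= /andP[_ /ltW ->].
  by case: cid => r /= /andP[-> _].
move=> v vpq; apply: eW; split => // i j; rewrite ord1 /ball /=.
have := vpq j; rewrite !mxE /=; case: cid => q /= /andP[h1 h2].
case: cid => r /= /andP[h3 h4] /andP[h5 h6].
by rewrite ltr_norml; apply/andP; split; lra.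
Qed.

Lemma rbox_nbhs n (x : 'rV[R]_n) (W : set 'rV[R]_n) : nbhs x W ->
  exists2 p, rbox p x & rbox p `<=` W.
Proof.
move=> /cbox_nbhs[p px pW]; exists p => // v vp; apply: pW => i.
by have /andP[-> /ltW ->] := vp i.
Qed.

(** An open set is the union of the rational boxes that it contains, of which there are countably
    many. *)
Lemma rV_measurableE n :
  @measurable _ 'rV[R]_n = <<s range (@rbox n) >>.
Proof.
apply/seteqP; split.
- apply: smallest_sub; first exact: smallest_sigma_algebra.
  move=> W oW.
  rewrite (_ : W = \bigcup_(p in [set p | rbox p `<=` W]) rbox p); last first.
    apply/seteqP; split => [x Wx|x [p /= pW /pW //]].
    have [p px pW] := rbox_nbhs (open_nbhs_nbhs (conj oW Wx)).
    by exists p.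
  rewrite bigcup_mkcond.
  apply: (@countable_bigcupT_measurable _ (g_sigma_algebraType (range (@rbox n)))) => // p.
  by case: ifPn => // _; apply: sub_sigma_algebra; exists p.
- apply: smallest_sub; first exact: sigma_algebra_measurable.
  by move=> _ [p _ <-]; exact: measurable_rV_box.
Qed.

Lemma rbox_setI_closed n : setI_closed (range (@rbox n)).
Proof. by move=> _ _ [p _ <-] [q _ <-]; rewrite rbox_setI; eexists. Qed.

Lemma box_cover n :
  \bigcup_k rbox (const_mx (- k%:R), const_mx k%:R) = [set: 'rV[R]_n].
Proof.
apply/seteqP; split => // v _.
pose M := \sum_i `|v ord0 i| + 1.
have M0 : 0 <= M by rewrite addr_ge0// sumr_ge0.
exists (Num.truncn M).+1 => // i; rewrite !mxE rmorphN /= !ratr_nat.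
have vM : `|v ord0 i| < (Num.truncn M).+1%:R.
  apply: le_lt_trans (truncnS_gt _).
  rewrite /M (bigD1 i)//= -addrA lerDl addr_ge0// sumr_ge0//.
by move: vM; rewrite ltr_norml => /andP[/ltW -> ->].
Qed.

Lemma measure_rV_unique n (m1 m2 : {measure set 'rV[R]_n -> \bar R}) :
  (forall p, m1 (rbox p) = m2 (rbox p)) -> (forall p, (m1 (rbox p) < +oo)%E) ->
  forall A, measurable A -> m1 A = m2 A.
Proof.
move=> m12 m1oo; apply: (@measure_unique _ _ _ (range (@rbox n))
  (fun k => rbox (const_mx (- k%:R), const_mx k%:R))).
- exact: rV_measurableE.
- exact: rbox_setI_closed.
- by move=> i; eexists.
- exact: box_cover.
- by move=> _ [p _ <-]; exact: m12.
- by move=> k; exact: m1oo.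
Qed.

Lemma lebesgue_rV_sigma_finite n : sigma_finite setT (@lebesgue_rV R n).
Proof.
exists (fun k => rbox (const_mx (- k%:R), const_mx k%:R)).
  by rewrite box_cover.
by move=> k; split; [exact: measurable_rV_box|exact: lebesgue_rV_box_lty].
Qed.

(* The same measure, packed so that the product-measure theory applies. *)
Definition leb (n : nat) : set 'rV[R]_n -> \bar R := lebesgue_rV n.

Arguments leb : clear implicits.

HB.instance Definition _ n := isMeasure.Build _ _ _ (leb n)
  (@measure0 _ _ _ (lebesgue_rV n)) (@measure_ge0 _ _ _ (lebesgue_rV n))
  (@measure_semi_sigma_additive _ _ _ (lebesgue_rV n)).

HB.instance Definition _ n := Measure_isSigmaFinite.Build _ _ _ (leb n)
  (@lebesgue_rV_sigma_finite n).

Lemma lebE n : leb n = lebesgue_rV n. Proof. by []. Qed.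

End boxes.

Arguments lebesgue_rV : simpl never.
Arguments leb {R} n _ : simpl never.

Section mpush.
Local Open Scope ereal_scope.
Context d d' (T1 : measurableType d) (T2 : measurableType d') (R : realType).
Variables (m : {measure set T1 -> \bar R}) (f : T1 -> T2).
Hypothesis mf : measurable_fun setT f.

Definition mpush : {measure set T2 -> \bar R} :=
  measure_function_pushforward__canonical__measure_function_Measure m mf.

Lemma mpushE A : mpush A = m (f @^-1` A). Proof. by []. Qed.
End mpush.

Section sfinite_pack.
Context d (T : measurableType d) (R : realType).
Variables (nu : {measure set T -> \bar R}) (nu_fin : sigma_finite setT nu).

(** Takes the proof of sigma-finiteness as an argument, so that a measure only later shown to be
    sigma-finite can carry the structure that Tonelli and Radon-Nikodym ask for. *)
Definition sfpack of sigma_finite setT nu : set T -> \bar R := nu.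

HB.instance Definition _ := isMeasure.Build _ _ _ (sfpack nu_fin)
  (@measure0 _ _ _ nu) (@measure_ge0 _ _ _ nu) (@measure_semi_sigma_additive _ _ _ nu).

HB.instance Definition _ := Measure_isSigmaFinite.Build _ _ _ (sfpack nu_fin) nu_fin.
End sfinite_pack.

(** * Translations, linear maps and the scaling factor of Lebesgue measure *)

Section linear_maps.
Context {R : realType}.

Lemma measurable_addrV n d (T : measurableType d) (f g : T -> 'rV[R]_n) :
  measurable_fun setT f -> measurable_fun setT g ->
  measurable_fun setT (fun x => f x + g x).
Proof.
move=> mf mg; apply: measurable_fun_rV => i.
under eq_fun do rewrite mxE.
by apply: measurable_funD; apply: (measurableT_comp (measurable_rV_coord i)).
Qed.

Lemma measurable_mulmx n p d (T : measurableType d) (f : T -> 'rV[R]_n) (L : 'M[R]_(n, p)) :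
  measurable_fun setT f -> measurable_fun setT (fun x => f x *m L).
Proof.
move=> mf; apply: measurable_fun_rV => i.
under eq_fun do rewrite mxE.
apply: measurable_sum => j; apply: measurable_funM => //.
by apply: (measurableT_comp (measurable_rV_coord j)).
Qed.

Lemma preimage_addr_box n (c a b : 'rV[R]_n) :
  (fun v => v + c) @^-1` box a b = box (a - c) (b - c).
Proof.
apply/seteqP; split => v /= h i; have := h i; rewrite !mxE => /andP[h1 h2];
  by apply/andP; split; lra.
Qed.

Lemma lebesgue_rV_shift n (c : 'rV[R]_n) (A : set 'rV[R]_n) : measurable A ->
  lebesgue_rV n ((fun v => v + c) @^-1` A) = lebesgue_rV n A.
Proof.
move=> mA.
have mc : measurable_fun setT (fun v : 'rV[R]_n => v + c).
  by apply: measurable_addrV => //; exact: measurable_cst.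
rewrite -[LHS](mpushE (lebesgue_rV n) mc).
apply/esym; apply: measure_rV_unique A mA => p; last exact: lebesgue_rV_box_lty.
rewrite [RHS](mpushE (lebesgue_rV n) mc) /rbox preimage_addr_box.
set a := map_mx _ _; set b := map_mx _ _.
have [ab|/existsNP[i /negP]] := pselect (forall i, a ord0 i <= b ord0 i).
  rewrite !lebesgue_rV_boxE//; last by move=> i; rewrite !mxE lerD2r; have := ab i; rewrite !mxE.
  by congr _%:E; apply: eq_bigr => i _; rewrite !mxE; ring.
rewrite -ltNge => ba.
rewrite (box_set0 ba) (@box_set0 _ _ _ _ i)//.
by rewrite mxE [ltRHS]mxE ltrD2r.
Qed.

Section haar.
Local Open Scope ereal_scope.
Variables (n : nat) (nu : {sigma_finite_measure set 'rV[R]_n -> \bar R}).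
Hypothesis nuT : forall (c : 'rV[R]_n) A, measurable A -> nu ((fun v => v + c)%R @^-1` A) = nu A.
Local Notation m := (@lebesgue_rV R n).

(* Tonelli applied to 1_A(x + y) 1_B(y), then again after the translation of y by x. *)
Lemma haar_mul A B : measurable A -> measurable B ->
  nu A * leb n B = nu [set - x | x in B]%R * leb n A.
Proof.
move=> mA mB.
pose S1 := [set p : 'rV[R]_n * 'rV[R]_n | A (p.1 + p.2)%R /\ B p.2].
pose S2 := [set p : 'rV[R]_n * 'rV[R]_n | A p.2 /\ B (p.2 - p.1)%R].
have mS1 : measurable S1.
  rewrite (_ : S1 = (fun p => p.1 + p.2)%R @^-1` A `&` snd @^-1` B)//.
  apply: measurableI; rewrite -[X in measurable X]setTI.
    exact: measurable_addrV.
  exact: measurable_snd.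
have mN : measurable_fun setT (fun x : 'rV[R]_n => - x)%R.
  rewrite (_ : (fun x => _) = (fun x => x *m (-1)%:M))%R; last first.
    by apply/funext => x; rewrite mul_mx_scalar scaleN1r.
  exact: measurable_mulmx.
have mS2 : measurable S2.
  rewrite (_ : S2 = snd @^-1` A `&` (fun p => p.2 - p.1)%R @^-1` B)//.
  apply: measurableI; rewrite -[X in measurable X]setTI.
    exact: measurable_snd.
  have mN1 : measurable_fun setT (fun p : 'rV[R]_n * 'rV[R]_n => - p.1)%R by exact: (measurableT_comp mN).
  have := measurable_addrV (@measurable_snd _ _ 'rV[R]_n 'rV[R]_n) mN1; exact.
have E1 : \int[nu]_x leb n (xsection S1 x) = nu A * leb n B.
  have E := @indic_fubini_tonelli _ _ _ _ _ nu (leb n) S1 mS1.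
  rewrite indic_fubini_tonelli_FE// indic_fubini_tonelli_GE// in E.
  rewrite [LHS]E.
  transitivity (\int[leb n]_(y in B) (nu A)); last by rewrite integral_cst.
  rewrite [RHS]integral_mkcond; apply: eq_integral => y _ /=.
  rewrite patchE; case: ifPn => [/set_mem By|/negP By].
    rewrite -(nuT y mA); congr (nu _); apply/seteqP; split => x; rewrite /ysection /= inE.
      by move=> [].
    by move=> Axy; split.
  rewrite (_ : ysection _ _ = set0) ?measure0//; apply/seteqP; split => x //.
  by rewrite /ysection /= inE => -[_ /mem_set].
have E2 : \int[nu]_x leb n (xsection S2 x) = nu [set - x | x in B]%R * leb n A.
  have E := @indic_fubini_tonelli _ _ _ _ _ nu (leb n) S2 mS2.
  rewrite indic_fubini_tonelli_FE// indic_fubini_tonelli_GE// in E.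
  rewrite [LHS]E.
  have -> : [set - x | x in B]%R = (fun x => - x)%R @^-1` B.
    apply/seteqP; split => [_ [x Bx <-]/=|x /= Bx]; first by rewrite opprK.
    by exists (- x)%R => //; rewrite opprK.
  have mNB : measurable ((fun x : 'rV[R]_n => - x)%R @^-1` B).
    by rewrite -[X in measurable X]setTI; exact: mN.
  transitivity (\int[leb n]_(y in A) (nu ((fun x => - x)%R @^-1` B))); last by rewrite integral_cst.
  rewrite [RHS]integral_mkcond; apply: eq_integral => y _ /=.
  rewrite patchE; case: ifPn => [/set_mem By|/negP By].
    rewrite -(nuT (- y)%R mNB); congr (nu _); apply/seteqP; split => x;
      rewrite /ysection /= inE /S2 /= opprD opprK addrC.
      by move=> [].
    by move=> Axy; split.
  rewrite (_ : ysection _ _ = set0) ?measure0//; apply/seteqP; split => x //.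
  by rewrite /ysection /= inE => -[/mem_set].
rewrite -E1 -E2; apply: eq_integral => x _.
have mxS2 : measurable (xsection S2 x) by exact: measurable_xsection.
rewrite lebE -(lebesgue_rV_shift x mxS2) -lebE; congr (leb n _).
apply/seteqP; split => y; rewrite /xsection /= !inE /S1 /S2 /= addrK addrC //.
Qed.

End haar.

(** Preimages are used because their measurability is immediate; the factor therefore turns out to
    be [|\det L|^-1]. Evaluating at the unit box shows that there is at most one. *)
Definition scales n (L : 'M[R]_n) (k : R) := 0 <= k /\ forall A, measurable A ->
  lebesgue_rV n ((fun v => v *m L) @^-1` A) = (k%:E * lebesgue_rV n A)%E.

Definition ubox n : set 'rV[R]_n := box 0 (const_mx 1).

Lemma lebesgue_ubox n : lebesgue_rV n (@ubox n) = 1%E.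
Proof.
rewrite lebesgue_rV_boxE; last by move=> i; rewrite !mxE.
by rewrite big1// => i _; rewrite !mxE subr0.
Qed.

Lemma scales_ubox n (L : 'M[R]_n) (k : R) :
  scales L k -> lebesgue_rV n ((fun v => v *m L) @^-1` (@ubox n)) = k%:E.
Proof.
by move=> [_ ->]; [rewrite lebesgue_ubox mule1|exact: measurable_rV_box].
Qed.

Lemma scales_inj n (L : 'M[R]_n) (k l : R) : scales L k -> scales L l -> k = l.
Proof. by move=> /scales_ubox h /scales_ubox; rewrite h => -[]. Qed.

Lemma scales1 n : scales (1%:M : 'M[R]_n) 1.
Proof.
split=> // A mA; rewrite mul1e; congr (lebesgue_rV n _).
by apply/seteqP; split => v /=; rewrite mulmx1.
Qed.

Lemma scalesM n (L M : 'M[R]_n) (k l : R) :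
  scales L k -> scales M l -> scales (L *m M) (k * l).
Proof.
move=> [k0 Lk] [l0 Ml]; split=> [|A mA]; first exact: mulr_ge0.
rewrite EFinM -muleA -Ml// -Lk; last first.
  by rewrite -[X in measurable X]setTI; exact: measurable_mulmx.
by congr (lebesgue_rV n _); apply/seteqP; split => v /=; rewrite mulmxA.
Qed.

Lemma bounded_sub_box n (A : set 'rV[R]_n) (M : R) :
  (forall v, A v -> forall i, `|v ord0 i| <= M) ->
  A `<=` box (const_mx (- M)) (const_mx (M + 1)).
Proof.
move=> AM v /AM vM i; rewrite !mxE; have := vM i.
by rewrite ler_norml => /andP[h1 h2]; apply/andP; split => //; lra.
Qed.

(** The pushforward of Lebesgue measure under [L] is again translation invariant, since a
    translation by [c] becomes one by [c *m invmx L], and it is finite on boxes; hence it is a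
    multiple of Lebesgue measure. *)
Lemma scales_ex n (L : 'M[R]_n) : L \in unitmx -> exists k, scales L k.
Proof.
move=> uL.
have mL : measurable_fun setT (fun v : 'rV[R]_n => v *m L) by exact: measurable_mulmx.
pose nu := mpush (lebesgue_rV n) mL.
have nuoo a b : (nu (box a b) < +oo)%E.
  (* Bounds every coordinate of [v] in terms of those of [v *m L], by means of the inverse
     matrix. *)
  pose M := \sum_j \sum_k (`|a ord0 k| + `|b ord0 k|) * `|invmx L k j|.
  have M0 i : 0 <= \sum_k (`|a ord0 k| + `|b ord0 k|) * `|invmx L k i|.
    by apply: sumr_ge0 => k _; rewrite mulr_ge0// addr_ge0.
  apply: le_lt_trans (@lebesgue_rV_box_lty _ _ (const_mx (- M)) (const_mx (M + 1))).
  apply: (@le_measure _ _ _ (lebesgue_rV n)); rewrite ?inE.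
  - rewrite -[X in measurable X]setTI; apply: measurable_mulmx => //; exact: measurable_rV_box.
  - exact: measurable_rV_box.
  apply: bounded_sub_box => v /= vab i.
  rewrite -(mulmxK uL v) mxE (le_trans (ler_norm_sum _ _ _))//.
  apply: (@le_trans _ _ (\sum_k (`|a ord0 k| + `|b ord0 k|) * `|invmx L k i|)); last first.
    by rewrite /M [leRHS](bigD1 i)//= lerDl sumr_ge0.
  apply: ler_sum => k _; rewrite normrM ler_wpM2r//.
  have /andP[h1 h2] := vab k.
  have [] := (ler_norm (- a ord0 k), ler_norm (b ord0 k)); rewrite normrN => h3 h4.
  have [] := (normr_ge0 (a ord0 k), normr_ge0 (b ord0 k)) => h5 h6.
  by rewrite ler_norml; apply/andP; split; lra.
have nus : sigma_finite setT nu.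
  exists (fun k => rbox (const_mx (- k%:R), const_mx k%:R)); first by rewrite box_cover.
  by move=> k; split; [exact: measurable_rV_box|exact: nuoo].
have nuT (c : 'rV[R]_n) A : measurable A -> sfpack nus ((fun v => v + c) @^-1` A) = sfpack nus A.
  move=> mA; rewrite /sfpack !(mpushE (lebesgue_rV n) mL).
  rewrite -[RHS](lebesgue_rV_shift (c *m invmx L)); last first.
    by rewrite -[X in measurable X]setTI; exact: measurable_mulmx.
  by congr (lebesgue_rV n _); apply/seteqP; split => v /=; rewrite mulmxDl mulmxKV.
(* The reflection comes from [haar_mul], in which the constant is the measure of the reflected
   second set. *)
pose B := [set - x | x in @ubox n].
have Boo : (nu B < +oo)%E.
  have mB : measurable B.
    rewrite (_ : B = (fun x => x *m (-1)%:M) @^-1` (@ubox n)).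
      rewrite -[X in measurable X]setTI; apply: measurable_mulmx => //.
      exact: measurable_rV_box.
    apply/seteqP; split => [_ [x Bx <-]/=|x /= Bx].
      by rewrite mul_mx_scalar scaleN1r opprK.
    by exists (x *m (-1)%:M) => //; rewrite mul_mx_scalar scaleN1r opprK.
  apply: le_lt_trans (nuoo (const_mx (-1)) (const_mx (1 + 1))).
  apply: (@le_measure _ _ _ nu); rewrite ?inE//; first exact: measurable_rV_box.
  apply: bounded_sub_box => _ [v vu <-] i; have := vu i; rewrite !mxE normrN => /andP[h1 h2].
  by rewrite ler_norml; apply/andP; split; lra.
have nuB : nu B \is a fin_num by rewrite ge0_fin_numE.
exists (fine (nu B)); split; first exact: fine_ge0.
move=> A mA; have := @haar_mul n (sfpack nus) nuT A (@ubox n) mA (measurable_rV_box _ _).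
by rewrite lebesgue_ubox mule1 fineK.
Qed.

End linear_maps.

(** * Linear images *)

Section det.
Context {R : realType}.
Local Notation scales := (@scales R _).

Lemma scales_unit_neq0 n (L : 'M[R]_n) k : L \in unitmx -> scales L k -> k != 0.
Proof.
move=> uL Lk; have [l Ll] := @scales_ex R n (invmx L) (ltac:(by rewrite unitmx_inv)).
have := scales_inj (scalesM Lk Ll); rewrite mulmxV// => /(_ _ (scales1 _)) kl.
by apply/eqP => k0; move: kl; rewrite k0 mul0r => /eqP; rewrite eq_sym oner_eq0.
Qed.

(* [S] is conjugate to its square, so its factor [k] satisfies [k = k ^+ 2]. *)
Lemma scales_conj1 n (S D : 'M[R]_n) : S \in unitmx -> D \in unitmx ->
  D *m S *m invmx D = S *m S -> scales S 1.
Proof.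
move=> uS uD DSD; have [k Sk] := scales_ex uS; have [d Dd] := scales_ex uD.
have [e De] := @scales_ex R n (invmx D) (ltac:(by rewrite unitmx_inv)).
have de : d * e = 1.
  by have := scales_inj (scalesM Dd De); rewrite mulmxV// => /(_ _ (scales1 _)).
have := scales_inj (scalesM (scalesM Dd Sk) De); rewrite DSD => /(_ _ (scalesM Sk Sk)) kk.
have k0 := scales_unit_neq0 uS Sk.
have : k * (1 - k) = 0 by rewrite mulrBr mulr1 -kk -[X in X - _]mulr1 -de; ring.
move=> /eqP; rewrite mulf_eq0 (negbTE k0)/= subr_eq0 => /eqP k1.
by rewrite {}k1.
Qed.

Lemma scales_sqr1 n (P : 'M[R]_n) : P *m P = 1%:M -> scales P 1.
Proof.
move=> PP; have uP : P \in unitmx by have [] := mulmx1_unit PP.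
have [k Pk] := scales_ex uP; have k0 := scales_unit_neq0 uP Pk.
have := scales_inj (scalesM Pk Pk); rewrite PP => /(_ _ (scales1 _)) /eqP.
rewrite -expr2 sqrp_eq1 ?(proj1 Pk)// => /eqP k1; by rewrite -k1.
Qed.

Lemma lebesgue_preimage_scale (a : R) : a != 0 ->
  lebesgue_measure [set x : R | 0 <= x * a < 1] = (`|a|^-1)%:E.
Proof.
move=> a0; have [an|ap] := ltP a 0.
  rewrite (_ : mkset _ = `]a^-1, 0]%classic).
    by rewrite lebesgue_measure_itv /= lte_fin invr_lt0 an -EFinB sub0r ltr0_norm// invrN.
  apply/seteqP; split => x /=; rewrite in_itv /= nmulr_lge0// -ltr_ndivrMr// mul1r andbC//.
have {}ap : 0 < a by rewrite lt_neqAle eq_sym a0.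
rewrite (_ : mkset _ = `[0, a^-1[%classic).
  by rewrite lebesgue_measure_itv /= lte_fin invr_gt0 ap -EFinB subr0 gtr0_norm.
by apply/seteqP; split => x /=; rewrite in_itv /= pmulr_lge0// -ltr_pdivlMr// mul1r.
Qed.

(** A factor exists, so it is enough to read it off from the unit box, whose preimage is a product
    of one set for each block. *)
Lemma scales_block_diag n (a : R) (M : 'M[R]_n) k : a != 0 -> (M \in unitmx) ->
  scales M k -> scales (block_mx a%:M 0 0 M : 'M[R]_(1 + n)) (`|a|^-1 * k).
Proof.
move=> a0 uM Mk.
have uB : (block_mx a%:M 0 0 M : 'M[R]_(1 + n)) \in unitmx.
  by rewrite unitmxE det_ublock det_scalar1 unitrM unitfE a0 -unitmxE.
have [l Bl] := scales_ex uB; suff <- : l = `|a|^-1 * k by [].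
have := scales_ubox Bl.
have -> : lebesgue_rV (1 + n) ((fun v => v *m (block_mx a%:M 0 0 M)) @^-1` (@ubox _ (1 + n))) =
    (leb n \x lebesgue_measure)%E
      (((fun v => v *m M) @^-1` (@ubox R n)) `*` [set x : R | 0 <= x * a < 1]).
  transitivity ((lebesgue_rV n \x lebesgue_measure)%E (@consrV R n @^-1`
    ((fun v => v *m (block_mx a%:M 0 0 M)) @^-1` (@ubox _ (1 + n))))); first by [].
  congr (product_measure1 _ _ _).
  apply/seteqP; split => [[v x] /= h|[v x] /= [h1 h2] i].
    split => [i|].
      have := h (rshift 1 i); rewrite /consrV /= mul_row_block !mulmx0 add0r addr0 row_mxEr.
      by rewrite !mxE.
    have := h (lshift n ord0); rewrite /consrV /= mul_row_block !mulmx0 addr0.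
    by rewrite row_mxEl -scalar_mxM !mxE eqxx mulr1n.
  rewrite /consrV /= mul_row_block !mulmx0 add0r addr0.
  case: (@split_ordP 1 n i) => j ->.
    by rewrite row_mxEl -scalar_mxM !mxE (ord1 j) eqxx mulr1n.
  by rewrite row_mxEr; have := h1 j; rewrite !mxE.
rewrite product_measure1E//; last 2 first.
- rewrite -[X in measurable X]setTI; apply: measurable_mulmx => //; exact: measurable_rV_box.
- rewrite (_ : [set x | _] = (fun x => x * a) @^-1` `[0, 1[%classic); last first.
    by apply/seteqP; split => x /=; rewrite in_itv.
  have ma : measurable_fun setT (fun x : R => x * a) by exact: measurable_funM.
  rewrite -[X in measurable X]setTI; apply: ma => //; exact: measurable_itv.
move=> h; have : (k%:E * (`|a|^-1)%:E = l%:E)%E.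
  by rewrite -h -(scales_ubox Mk) -(lebesgue_preimage_scale a0).
by rewrite -EFinM => -[<-]; exact: mulrC.
Qed.

Lemma det_tperm_norm n (i j : 'I_n) : `|\det (tperm_mx i j : 'M[R]_n)| = 1.
Proof. by rewrite det_perm normrX normrN1 expr1n. Qed.

Lemma tperm_mxK n (i j : 'I_n) : tperm_mx i j *m tperm_mx i j = 1%:M :> 'M[R]_n.
Proof. by rewrite -perm_mxM tperm2 perm_mx1. Qed.

(** Conjugation by the diagonal matrix with corner [2^-1] doubles [c], and so does squaring the
    shear. For upper shears the corner is 2. *)
Lemma scales_lshear n (c : 'cV[R]_n) : scales (block_mx 1%:M 0 c 1%:M : 'M[R]_(1 + n)) 1.
Proof.
have u1 : (2^-1%:M : 'M[R]_1) \in unitmx by rewrite unitmxE det_scalar1 unitfE invr_eq0 pnatr_eq0.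
have uS : (block_mx 1%:M 0 c 1%:M : 'M[R]_(1 + n)) \in unitmx.
  by rewrite unitmxE det_lblock !det1 mulr1 unitr1.
have uD : (block_mx 2^-1%:M 0 0 1%:M : 'M[R]_(1 + n)) \in unitmx.
  by rewrite unitmxE det_lblock det1 mulr1 -unitmxE.
apply: (scales_conj1 uS uD); rewrite -[RHS](mulmxK uD); congr (_ *m invmx _).
rewrite !mulmx_block; congr block_mx; rewrite ?mulmx0 ?mul0mx ?mulmx1 ?mul1mx ?addr0 ?add0r//.
  by rewrite mul1mx.
by rewrite mul_mx_scalar scalerDr -scalerDl (_ : 2^-1 + 2^-1 = 1 :> R) ?scale1r//; field.
Qed.

Lemma scales_ushear n (c : 'rV[R]_n) : scales (block_mx 1%:M c 0 1%:M : 'M[R]_(1 + n)) 1.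
Proof.
have u1 : (2%:M : 'M[R]_1) \in unitmx by rewrite unitmxE det_scalar1 unitfE pnatr_eq0.
have uS : (block_mx 1%:M c 0 1%:M : 'M[R]_(1 + n)) \in unitmx.
  by rewrite unitmxE det_ublock !det1 mulr1 unitr1.
have uD : (block_mx 2%:M 0 0 1%:M : 'M[R]_(1 + n)) \in unitmx.
  by rewrite unitmxE det_lblock det1 mulr1 -unitmxE.
apply: (scales_conj1 uS uD); rewrite -[RHS](mulmxK uD); congr (_ *m invmx _).
rewrite !mulmx_block; congr block_mx; rewrite ?mulmx0 ?mul0mx ?mulmx1 ?mul1mx ?addr0 ?add0r//.
- by rewrite mul1mx.
- by rewrite mul_scalar_mx scaler_nat mulr2n.
- by rewrite mul0mx.
Qed.

(** Gaussian elimination, by induction on the dimension. Transpositions bring a nonzero entry to the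
    corner; what remains is a lower shear, a block diagonal matrix and an upper shear. Shears and
    transpositions have factor 1. *)
Lemma scales_det n (L : 'M[R]_n) : L \in unitmx -> scales L `|\det L|^-1.
Proof.
elim: n L => [|n IH] L uL.
  rewrite det_mx00 normr1 invr1; split => // A mA; rewrite mul1e; congr (lebesgue_rV 0 _).
  by apply/seteqP; split => v /=; rewrite [v]thinmx0 mul0mx.
have [i [j Lij]] : exists i j, L i j != 0.
  apply/not_existsP => h; have L0 : L = 0.
    apply/matrixP => i j; rewrite mxE; apply/eqP; apply: contrapT => /negP Lij.
    by apply: (h i); exists j.
  by move: uL; rewrite L0 unitmxE det0 unitr0.
pose P1 : 'M[R]_(1 + n) := tperm_mx ord0 i; pose P2 : 'M[R]_(1 + n) := tperm_mx ord0 j.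
pose L' : 'M[R]_(1 + n) := P1 *m L *m P2.
have LE : L = P1 *m L' *m P2.
  by rewrite /L' !mulmxA tperm_mxK mul1mx -mulmxA tperm_mxK mulmx1.
have detP1 : `|\det P1| = 1 by exact: det_tperm_norm.
have detP2 : `|\det P2| = 1 by exact: det_tperm_norm.
have L'00 : L' ord0 ord0 = L i j.
  by rewrite /L' -xcolE -xrowE !mxE !tpermL.
clearbody L'; pose a := L' ord0 ord0; have a0 : a != 0 by rewrite /a L'00.
pose b := ursubmx L'; pose c := dlsubmx L'.
(* The Schur complement of the pivot [a]. *)
pose M := drsubmx L' - a^-1 *: (c *m b).
have L'E : L' = block_mx 1%:M 0 (a^-1 *: c) 1%:M *m block_mx a%:M 0 0 M *m
    block_mx 1%:M (a^-1 *: b) 0 1%:M.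
  rewrite !mulmx_block !(mulmx0, mul0mx, mulmx1, mul1mx, addr0, add0r).
  rewrite -[LHS]submxK; congr block_mx.
  - rewrite [LHS]mx11_scalar; congr (_%:M); rewrite !mxE /a; rewrite (_ : lshift n 0 = ord0 :> 'I_(1 + n))//; exact: val_inj.
  - by rewrite mul_scalar_mx scalerA mulfV// scale1r.
  - by rewrite mul_mx_scalar scalerA mulfV// scale1r.
  - rewrite mul_mx_scalar scalerA mulfV// scale1r -scalemxAr /M addrC.
    by rewrite subrK.
have detL' : \det L' = a * \det M.
  by rewrite L'E !det_mulmx !det_lblock det_ublock !det1 det_scalar1 !mulr1 !mul1r.
have detL : `|\det L| = `|a| * `|\det M|.
  by rewrite LE !det_mulmx !normrM detP1 detP2 mul1r mulr1 detL' normrM.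
have uM : M \in unitmx.
  rewrite unitmxE unitfE; apply/eqP => M0; move: uL.
  by rewrite unitmxE unitfE -normr_eq0 detL M0 normr0 mulr0 eqxx.
have -> : `|\det L|^-1 = 1 * (1 * (`|a|^-1 * `|\det M|^-1) * 1) * 1.
  by rewrite !mul1r !mulr1 detL invfM.
rewrite {1}LE L'E.
apply: scalesM; last by apply: scales_sqr1; exact: tperm_mxK.
apply: scalesM; first by apply: scales_sqr1; exact: tperm_mxK.
apply: scalesM; last exact: scales_ushear.
apply: scalesM; first exact: scales_lshear.
by apply: scales_block_diag => //; exact: IH.
Qed.

Lemma lebesgue_preimage_affine n (L : 'M[R]_n) (c : 'rV[R]_n) (A : set 'rV[R]_n) :
  L \in unitmx -> measurable A ->
  lebesgue_rV n ((fun v => (v - c) *m L) @^-1` A) =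
  ((`|\det L|^-1)%:E * lebesgue_rV n A)%E.
Proof.
move=> uL mA; have [_ <-//] := scales_det uL.
rewrite -[RHS](lebesgue_rV_shift (- c))//.
by rewrite -[X in measurable X]setTI; exact: measurable_mulmx.
Qed.

End det.

(** * Change of variables *)

Section bisection.
Context {R : realType} {n : nat}.
Implicit Types (a b c w y : 'rV[R]_n).

(** The first [k] coordinates are halved: bisecting one coordinate at a time makes every step a cut
    into just two boxes. *)
Definition halve (k : nat) w : 'rV[R]_n :=
  \row_i (if (i < k)%N then w ord0 i / 2 else w ord0 i).

Lemma row_set_update c (i : 'I_n) (r : R) :
  exists c', c' ord0 i = r /\ forall j, j != i -> c' ord0 j = c ord0 j.
Proof.
exists (\row_j (if j == i then r else c ord0 j)); split=> [|j /negbTE ji]; rewrite mxE ?eqxx//.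
by rewrite ji.
Qed.

Lemma box_split a b (i : 'I_n) (r : R) a' b' :
  a ord0 i <= r <= b ord0 i ->
  a' ord0 i = r -> (forall j, j != i -> a' ord0 j = a ord0 j) ->
  b' ord0 i = r -> (forall j, j != i -> b' ord0 j = b ord0 j) ->
  box a b = box a b' `|` box a' b /\ box a b' `&` box a' b = set0.
Proof.
move=> /andP[ar rb] a'i a'j b'i b'j; split.
  apply/seteqP; split => [v vab|v [vab j|vab j]].
  - have [vr|rv] := ltP (v ord0 i) r; [left|right] => j; have /andP[h1 h2] := vab j;
      have [->|ji] := eqVneq j i; rewrite ?a'i ?b'i ?a'j ?b'j ?h1 ?h2// ?vr ?rv ?andbT//.
    + by have /andP[-> _] := vab i.
    + by have /andP[_ ->] := vab i.
  - have /andP[h1 h2] := vab j; rewrite h1/=; have [ji|ji] := eqVneq j i.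
      by move: h2; rewrite ji b'i => /lt_le_trans; exact.
    by rewrite -b'j.
  - have /andP[h1 h2] := vab j; rewrite h2 andbT; have [ji|ji] := eqVneq j i.
      by move: h1; rewrite ji a'i; exact: le_trans.
    by rewrite -a'j.
apply/seteqP; split => // v [/(_ i) /andP[_]]; rewrite b'i => vr /(_ i) /andP[].
by rewrite a'i => /(lt_le_trans vr); rewrite ltxx.
Qed.

Variables (mu nu : {measure set 'rV[R]_n -> \bar R}) (K : R).
Hypothesis K0 : 0 <= K.

Let bad c w := ~ (mu (box c (c + w)) <= K%:E * nu (box c (c + w)))%E.

(** If both halves satisfied the inequality, additivity of [mu] and [nu] would give it for the whole
    box. *)
Lemma bad_halve_step c w (i : 'I_n) : (forall j, 0 <= w ord0 j) ->
  bad c (halve i w) -> exists c', [/\ bad c' (halve i.+1 w),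
    forall j, c ord0 j <= c' ord0 j &
    forall j, c' ord0 j + halve i.+1 w ord0 j <= c ord0 j + halve i w ord0 j].
Proof.
move=> w0 bcw; set u := halve i w; set u' := halve i.+1 w.
have u0 j : 0 <= u ord0 j by rewrite mxE; case: ifP => _; rewrite ?divr_ge0.
have u'i : u' ord0 i = w ord0 i / 2 by rewrite mxE ltnSn.
have ui : u ord0 i = w ord0 i by rewrite mxE ltnn.
have u'j j : j != i -> u' ord0 j = u ord0 j.
  by move=> ji; rewrite !mxE ltnS leq_eqVlt (negbTE (_ : val j != val i)).
pose r := c ord0 i + w ord0 i / 2.
have [c' [c'i c'j]] := row_set_update c i r.
have := w0 i => wi0.
have [] := @box_split c (c + u) i r c' (c + u') _ c'i c'j.
- by rewrite !mxE -/u ltnn /r; apply/andP; split; lra.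
- by rewrite [LHS]mxE u'i.
- by move=> j ji; rewrite [LHS]mxE [RHS]mxE u'j.
move=> boxU boxI.
have E : c + u = c' + u'.
  apply/rowP => j; rewrite [LHS]mxE [RHS]mxE; have [->|ji] := eqVneq j i.
    by rewrite c'i u'i ui /r; lra.
  by rewrite c'j// u'j.
have [b1|b1] := pselect (bad c u').
  exists c; split => // j; have [->|ji] := eqVneq j i; last by rewrite u'j.
  by rewrite u'i ui; lra.
have [b2|b2] := pselect (bad c' u').
  exists c'; split => // j.
    have [->|ji] := eqVneq j i; last by rewrite c'j.
    by rewrite c'i /r; lra.
  by have /rowP /(_ j) := E; rewrite [LHS]mxE [RHS]mxE => ->.
exfalso; apply: bcw; rewrite boxU !measureU//; try exact: measurable_rV_box.
rewrite ge0_muleDr ?measure_ge0//; apply: leeD; first by apply: contrapT; exact: b1.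
by rewrite E; apply: contrapT; exact: b2.
Qed.

Lemma bad_halve c w : (forall j, 0 <= w ord0 j) -> bad c w ->
  exists c', [/\ bad c' (2^-1 *: w), forall j, c ord0 j <= c' ord0 j &
    forall j, c' ord0 j + (2^-1 *: w) ord0 j <= c ord0 j + w ord0 j].
Proof.
move=> w0 bcw.
suff /(_ n (leqnn n)) [c' [h1 h2 h3]] : forall k, (k <= n)%N ->
    exists c', [/\ bad c' (halve k w), forall j, c ord0 j <= c' ord0 j &
    forall j, c' ord0 j + halve k w ord0 j <= c ord0 j + w ord0 j].
  have E : halve n w = 2^-1 *: w by apply/rowP => j; rewrite !mxE ltn_ord mulrC.
  by exists c'; rewrite -E.
elim => [_|k IH kn].
  have E : halve 0 w = w by apply/rowP => j; rewrite !mxE.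
  by exists c; rewrite E.
have [c1 [h1 h2 h3]] := IH (ltnW kn).
have [c2 [g1 g2 g3]] := @bad_halve_step c1 w (Ordinal kn) w0 h1.
by exists c2; split => // j; [exact: le_trans (h2 j) (g2 j)|exact: le_trans (g3 j) (h3 j)].
Qed.

(* Cousin-type argument: a box violating the conclusion has a half-size box of
   the same shape violating it too, and the nested boxes shrink to some [y]. *)
Lemma box_le_local a w : (forall j, 0 <= w ord0 j) ->
  (forall y, cbox a (a + w) y -> exists2 t0 : R, 0 < t0 & forall t c, 0 < t <= t0 ->
    cbox c (c + t *: w) y ->
    (mu (box c (c + t *: w)) <= K%:E * nu (box c (c + t *: w)))%E) ->
  (mu (box a (a + w)) <= K%:E * nu (box a (a + w)))%E.
Proof.
move=> w0 loc; apply: contrapT => bad0.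
pose good (k : nat) (c c' : 'rV[R]_n) := [/\ bad c' ((2^-1 ^+ k.+1) *: w),
  forall j, c ord0 j <= c' ord0 j &
  forall j, c' ord0 j + ((2^-1 ^+ k.+1) *: w) ord0 j <= c ord0 j + ((2^-1 ^+ k) *: w) ord0 j].
have w0k k j : 0 <= (2^-1 ^+ k *: w) ord0 j by rewrite mxE mulr_ge0// exprn_ge0// invr_ge0.
have step k c : exists c', bad c (2^-1 ^+ k *: w) -> good k c c'.
  have [b|nb] := pselect (bad c (2^-1 ^+ k *: w)); last by exists c.
  have [c' [h1 h2 h3]] := bad_halve (w0k k) b; exists c' => _.
  by split => //; rewrite exprS -scalerA.
pose f := fix f k := if k is k'.+1 then sval (cid (step k' (f k'))) else a.
have fS k : bad (f k) (2^-1 ^+ k *: w) -> good k (f k) (f k.+1).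
  by move=> b; rewrite /=; case: cid => /= c' /(_ b).
have fbad k : bad (f k) (2^-1 ^+ k *: w).
  by elim: k => [|k IH]; [rewrite expr0 scale1r|have [] := fS _ IH].
have flo j : {homo (fun k => f k ord0 j) : k l / (k <= l)%N >-> k <= l}.
  by apply: homo_leq => // [? ? ?|k]; [exact: le_trans|have [] := fS _ (fbad k)].
have fhi j : {homo (fun k => f k ord0 j + (2^-1 ^+ k *: w) ord0 j) : k l / (k <= l)%N >-> l <= k}.
  apply: homo_leq => // [? ? ? h1 h2|k]; [exact: le_trans h2 h1|].
  by have [] := fS _ (fbad k).
have flohi j k l : f k ord0 j <= f l ord0 j + (2^-1 ^+ l *: w) ord0 j.
  have h := w0k (maxn k l) j.
  apply: (le_trans (flo j _ _ (leq_maxl k l))); apply: le_trans (fhi j _ _ (leq_maxr k l)).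
  by rewrite lerDl.
(* The lower corners increase and stay below all the upper corners, so their supremum lies in every
   closed box. *)
pose y : 'rV[R]_n := \row_j sup (range (fun k => f k ord0 j)).
have yhi k : cbox (f k) (f k + 2^-1 ^+ k *: w) y.
  move=> j; rewrite [X in _ <= X <= _]mxE; apply/andP; split.
    apply: ub_le_sup; last by exists k.
    by exists (f 0%N ord0 j + (2^-1 ^+ 0 *: w) ord0 j) => _ [l _ <-]; exact: flohi.
  rewrite [leRHS]mxE; apply: sup_le_ub; first by exists (f 0%N ord0 j); exists 0%N.
  by move=> _ [l _ <-]; exact: flohi.
have [t0 t00 ht] := loc y (ltac:(by have := yhi 0%N; rewrite expr0 scale1r)).
have [k kt] : exists k, 2^-1 ^+ k < t0.
  have /cvgrPdist_lt /(_ t0 t00) [k _ /(_ k (leqnn k))] :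
      (fun k => 2^-1 ^+ k : R) @ \oo --> (0 : R).
    by apply: cvg_expr; rewrite ger0_norm ?invr_ge0// invf_lt1// ltr1n.
  by rewrite sub0r normrN ger0_norm ?exprn_ge0 ?invr_ge0// => ?; exists k.
by apply: (fbad k); apply: ht => //; rewrite exprn_gt0 ?invr_gt0//= ltW.
Qed.

End bisection.

Section differentials.
Context {R : realType}.

Lemma coord_le_norm n (v : 'rV[R]_n) i : `|v ord0 i| <= `|v|.
Proof.
rewrite [leRHS]/Num.norm /= mx_normrE; apply/bigmax_geP; right.
by exists (ord0, i).
Qed.

Lemma norm_le_coord n (v : 'rV[R]_n) (r : R) : 0 <= r ->
  (forall i, `|v ord0 i| <= r) -> `|v| <= r.
Proof.
move=> r0 vr; rewrite [leLHS]/Num.norm /= mx_normrE; apply/bigmax_leP; split=> //= -[i j] _ /=.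
by rewrite ord1.
Qed.

Lemma norm_mulmx_le n p (L : 'M[R]_(n, p)) :
  exists2 C : R, 0 < C & forall v : 'rV[R]_n, `|v *m L| <= C * `|v|.
Proof.
exists (\sum_i \sum_j `|L i j| + 1).
  by rewrite ltr_wpDl// sumr_ge0// => i _; rewrite sumr_ge0.
move=> v; have C0 : 0 <= \sum_i \sum_j `|L i j|.
  by rewrite sumr_ge0// => i _; rewrite sumr_ge0.
apply: norm_le_coord => [|j]; first by rewrite mulr_ge0// addr_ge0.
rewrite mxE (le_trans (ler_norm_sum _ _ _))// mulrDl mul1r -[leLHS]addr0 lerD//.
rewrite mulr_suml ler_sum// => i _; rewrite normrM mulrC ler_pM ?coord_le_norm//.
by rewrite (bigD1 j)//= lerDl sumr_ge0.
Qed.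

Lemma diff_expand n p (f : 'rV[R]_n -> 'rV[R]_p) x : differentiable f x ->
  forall d : R, 0 < d -> exists2 r : R, 0 < r &
  forall v, `|v - x| < r -> `|f v - f x - (v - x) *m 'J f x| <= d * `|v - x|.
Proof.
move=> df d d0; have /eqaddoP /(_ d d0) /nbhs_ballP [r /= r0 hr] := diff_locally df.
exists r => // v vr; have := hr (v - x).
rewrite -ball_normE /= sub0r normrN => /(_ vr).
rewrite /jacobian mul_rV_lin1.
rewrite (_ : _ (v - x) = f v - f x - 'd f x (v - x))//.
by rewrite !fctE /= subrK opprD addrA.
Qed.

Lemma jacobian_inv n (f g : 'rV[R]_n -> 'rV[R]_n) x : differentiable f x ->
  differentiable g (f x) -> (\forall y \near x, g (f y) = y) ->
  'J f x *m 'J g (f x) = 1%:M.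
Proof.
move=> df dg gf.
have H : 'd (g \o f) x = idfun :> ('rV[R]_n -> 'rV[R]_n).
  apply: diff_unique; first by move=> y; exact: id.
  apply/eqaddoP => e e0; have := gf; rewrite [X in X -> _](near_shift 0) subr0 => h.
  near=> y; rewrite !fctE /=.
  have -> : g (f (y + x)) = y + x by near: y; exact: h.
  by rewrite (nbhs_singleton gf) opprD addrA addrK subrr normr0 mulr_ge0// ltW.
have E (v : 'rV[R]_n) : v *m ('J f x *m 'J g (f x)) = v.
  rewrite mulmxA /jacobian !mul_rV_lin1.
  have /(congr1 (fun h : 'rV[R]_n -> 'rV[R]_n => h v)) E := diff_comp df dg.
  exact: etrans (esym E) (congr1 (fun h : 'rV[R]_n -> 'rV[R]_n => h v) H).
by apply/row_matrixP => i; rewrite -[in LHS](mul1mx (_ *m _)) row_mul E.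
Unshelve. all: by end_near. Qed.

(** Meant for [q i = 2 / l i]: moving each face of a box with sides [t * l i] by [d * t], outwards
    or inwards, multiplies its volume by the product of the [1 + d * q i] or the [1 - d * q i]. *)
Lemma prod_near1 n (q : 'I_n -> R) (K : R) : 1 < K -> (forall i, 0 <= q i) ->
  exists2 d : R, 0 < d & [/\ forall i, d * q i <= 1,
    \prod_i (1 + d * q i) <= K & K^-1 <= \prod_i (1 - d * q i)].
Proof.
move=> K1 q0.
have cv (s : seq 'I_n) (e : R) : \prod_(i <- s) (1 + e * d * q i) @[d --> 0^'+] --> (1 : R).
  elim: s => [|i s IH]; first by under eq_fun do rewrite big_nil; exact: cvg_cst.
  under eq_fun do rewrite big_cons.
  have hd : d @[d --> (0 : R)^'+] --> (0 : R) by apply: cvg_at_right_filter; exact: cvg_id.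
  have := cvgM (cvgD (cvg_cst (1 : R)) (cvgM (cvgM (cvg_cst e) hd) (cvg_cst (q i)))) IH.
  by rewrite mulr0 mul0r addr0 mulr1; exact.
have h1 : \forall d \near 0^'+, \prod_i (1 + d * q i) <= K.
  have := cv (index_enum 'I_n) 1; move=> /cvgr_le /(_ K K1).
  by apply: filterS => d; under eq_bigr do rewrite mul1r.
have h2 : \forall d \near 0^'+, K^-1 <= \prod_i (1 - d * q i).
  have := cv (index_enum 'I_n) (-1); move=> /cvgr_ge /(_ K^-1).
  rewrite invf_lt1 ?(lt_trans ltr01)// => /(_ K1).
  by apply: filterS => d; under eq_bigr do rewrite mulN1r mulNr.
have h3 : \forall d \near (0 : R)^'+, forall i, d * q i <= 1.
  apply: filter_forall => i; near=> d.
  have q1 : 0 < q i + 1 by rewrite ltr_wpDl.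
  have dq : d <= (q i + 1)^-1 by near: d; apply: nbhs_right_le; rewrite invr_gt0 ltr_wpDl.
  apply: le_trans (ler_wpM2r (q0 i) dq) _.
  by rewrite mulrC ler_pdivrMr// mul1r lerDl.
have h4 : \forall d \near (0 : R)^'+, 0 < d by exact: nbhs_right_gt.
have [d [[d0 d1] [d2 d3]]] := filter_ex (filterI (filterI h4 h1) (filterI h2 h3)).
by exists d.
Unshelve. all: by end_near. Qed.

End differentials.

Section open_measurable.
Context {R : realType}.

Lemma open_rV_measurable n (U : set 'rV[R]_n) : open U -> measurable U.
Proof. by move=> oU; apply: sub_sigma_algebra. Qed.

Lemma open_setI_preimage (X Y : topologicalType) (U : set X) (f : X -> Y) (W : set Y) :
  open U -> (forall x, U x -> {for x, continuous f}) -> open W -> open (U `&` f @^-1` W).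
Proof.
move=> oU cf oW; rewrite openE => x [Ux Wx].
rewrite /interior; apply: filterI; first exact: open_nbhs_nbhs.
by apply: cf => //; exact: open_nbhs_nbhs.
Qed.

Lemma open_continuous_measurable_rV n p (U : set 'rV[R]_n) (f : 'rV[R]_n -> 'rV[R]_p) :
  open U -> (forall x, U x -> {for x, continuous f}) -> measurable_fun U f.
Proof.
move=> oU cf; apply: (measurability (@open 'rV[R]_p)) => // _ [W oW <-].
by apply: open_rV_measurable; apply: open_setI_preimage.
Qed.

Lemma open_continuous_measurable_R n (U : set 'rV[R]_n) (f : 'rV[R]_n -> R) :
  open U -> (forall x, U x -> {for x, continuous f}) -> measurable_fun U f.
Proof.
move=> oU cf; apply: (measurability _ (RGenOpens.measurableE R)) => // _ [_ [a [b ->]] <-].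
by apply: open_rV_measurable; apply: open_setI_preimage => //; exact: interval_open.
Qed.

Lemma continuous_det n (A : 'rV[R]_n -> 'M[R]_n) x :
  {for x, continuous A} -> {for x, continuous (fun y => \det (A y))}.
Proof.
move=> cA.
rewrite /prop_for /continuous_at /determinant.
have add_cts : continuous (fun z : R * R => z.1 + z.2).
  by move=> z; apply: cvgD; [exact: cvg_fst|exact: cvg_snd].
have := @cvg_big R _ +%R 0 xpredT add_cts _ (nbhs x) (index_enum {perm 'I_n})
  (fun s y => (-1) ^+ s * \prod_i A y i (s i)) (fun s => (-1) ^+ s * \prod_i A x i (s i)).
apply=> s _; apply: (@cvgM _ _ _ (nbhs_filter x)); first exact: (@cvg_cst R _ _ _ (nbhs_filter x)).
have := @cvg_big R _ *%R 1 xpredT (@mul_continuous R) _ (nbhs x) (index_enum 'I_n)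
  (fun i y => A y i (s i)) (fun i => A x i (s i)).
apply=> i _; apply: (@continuous_comp _ _ _ A (fun M : 'M[R]_n => M i (s i))) => //.
exact: coord_continuous.
Qed.

End open_measurable.

Section density.
Local Open Scope ereal_scope.
Context d (T : measurableType d) (R : realType).
Variables (m : {measure set T -> \bar R}) (f : T -> \bar R).

Definition mdens of measurable_fun setT f & (forall x, 0 <= f x) : set T -> \bar R :=
  fun A => \int[m]_(x in A) f x.

Hypotheses (mf : measurable_fun setT f) (f0 : forall x, 0 <= f x).

Let mdens0 : mdens mf f0 set0 = 0. Proof. by rewrite /mdens integral_set0. Qed.
Let mdens_ge0 A : 0 <= mdens mf f0 A. Proof. by apply: integral_ge0 => x _. Qed.
Let mdens_sigma : semi_sigma_additive (mdens mf f0).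
Proof.
move=> F mF tF mUF; rewrite /mdens ge0_integral_bigcup//; last exact: measurable_funTS.
by apply: is_cvg_ereal_nneg_natsum_cond => k _ _; exact: integral_ge0.
Qed.
HB.instance Definition _ := isMeasure.Build _ _ _ (mdens mf f0) mdens0 mdens_ge0 mdens_sigma.
End density.

(** The cover is made disjoint and the traces on its pieces are summed. *)
Lemma measure_eq_cover d (T : measurableType d) (R : realType)
    (mu nu : {measure set T -> \bar R}) (K : nat -> set T) (A : set T) :
  (forall j, measurable (K j)) ->
  (forall j B, measurable B -> mu (B `&` K j) = nu (B `&` K j)) ->
  measurable A -> A `<=` \bigcup_j K j -> mu A = nu A.
Proof.
move=> mK munu mA AK.
have E : A = \bigcup_j (A `&` seqDU K j).
  by rewrite -setI_bigcupr -seqDU_bigcup_eq; apply/esym/setIidPl.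
have mD j : measurable (seqDU K j) by apply: seqDU_measurable.
have mAD j : measurable (A `&` seqDU K j) by exact: measurableI.
have tA : trivIset setT (fun j => A `&` seqDU K j).
  by apply: trivIset_setIl; exact: trivIset_seqDU.
rewrite E !measure_semi_bigcup//; try exact: bigcup_measurable.
apply: eq_eseriesr => j _.
have -> : A `&` seqDU K j = (A `&` seqDU K j) `&` K j.
  by rewrite -setIA; congr (_ `&` _); apply/esym/setIidPl; exact: subset_seqDU.
exact: munu.
Qed.

Section change_of_variables.
Context {R : realType} {n : nat}.
Local Notation m := (@lebesgue_rV R n).
Variables (U G : set 'rV[R]_n) (psi phi : 'rV[R]_n -> 'rV[R]_n).
Hypotheses (oU : open U) (oG : open G).
Hypotheses (psiU : forall x, U x -> G (psi x)) (psiK : forall x, U x -> phi (psi x) = x).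
Hypotheses (phiG : forall y, G y -> U (phi y)) (phiK : forall y, G y -> psi (phi y) = y).
Hypotheses (dpsi : forall x, U x -> differentiable psi x)
  (dphi : forall y, G y -> differentiable phi y).
Hypothesis cJ : forall y, G y -> {for y, continuous (fun y => 'J phi y)}.

Lemma cv_jacobian y : G y -> 'J phi y *m 'J psi (phi y) = 1%:M.
Proof.
move=> Gy; apply: jacobian_inv; [exact: dphi|by apply: dpsi; exact: phiG|].
have : nbhs y G by exact: open_nbhs_nbhs.
by apply: filterS => z; exact: phiK.
Qed.

Lemma cv_measurable A : measurable A -> measurable (U `&` psi @^-1` A).
Proof.
move=> mA; apply: (open_continuous_measurable_rV oU) => //; last exact: open_rV_measurable.
by move=> x Ux; apply: differentiable_continuous; exact: dpsi.
Qed.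

Section local_estimates.
Variables (y0 l : 'rV[R]_n) (K : R).
Hypotheses (Gy0 : G y0) (l0 : forall i, 0 < l ord0 i) (K1 : 1 < K).
Let D := `|\det ('J phi y0)|.
Let L := 'J phi y0.
Let M := 'J psi (phi y0).
Let LM : L *m M = 1%:M. Proof. exact: cv_jacobian. Qed.
Let uM : M \in unitmx. Proof. by have [] := mulmx1_unit LM. Qed.
Let ML : M *m L = 1%:M. Proof. exact: mulmx1C. Qed.
Let detM : `|\det M|^-1 = D.
Proof.
have := congr1 (fun A => `|\det A|) LM; rewrite /= det_mulmx det1 normr1 normrM => h.
have M0 : `|\det M| != 0 by rewrite normr_eq0 -unitfE -unitmxE.
by apply: (mulIf M0); rewrite mulVf// /D h.
Qed.
Let q0 i : 0 <= 2 / l ord0 i. Proof. by rewrite divr_ge0// ltW. Qed.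

Let mboxE (t : R) c : 0 < t -> m (box c (c + t *: l)) = (\prod_i (t * l ord0 i))%:E.
Proof.
move=> t0; rewrite lebesgue_rV_boxE => [|i]; last first.
  by rewrite !mxE lerDl mulr_ge0// ltW.
by congr _%:E; apply: eq_bigr => i _; rewrite !mxE; ring.
Qed.

(** Differentiability of [phi] at [y0]: if [psi x] lies in a small box near [y0], then
    [(x - phi y0) *m M] is [psi x - y0] up to a small error. So [x] lies in the affine preimage of a
    slightly larger box, whose volume is known from the determinant. *)
Lemma cv_upper : exists2 t0 : R, 0 < t0 & forall t c, 0 < t <= t0 ->
  cbox c (c + t *: l) y0 ->
  (m (U `&` psi @^-1` box c (c + t *: l)) <= (K * D)%:E * m (box c (c + t *: l)))%E.
Proof.
have [d d0 [_ dK _]] := prod_near1 K1 q0.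
have [C C0 MC] := norm_mulmx_le M.
pose lm := `|l| + 1; have lm0 : 0 < lm by rewrite ltr_wpDl.
have dC : 0 < d / (C * lm) by rewrite divr_gt0// mulr_gt0.
have [r r0 hr] := diff_expand (dphi Gy0) dC.
exists (r / (2 * lm)) => [|t c /andP[t0 tr] cy]; first by rewrite divr_gt0// mulr_gt0.
pose k := d * t.
(* The margin [k] for the linearization error is proportional to the size [t] of the box, so the
   relative change of volume depends on [d] alone. *)
have k0 : 0 < k by rewrite mulr_gt0.
pose c' : 'rV[R]_n := \row_i (c ord0 i - y0 ord0 i - k).
pose b' : 'rV[R]_n := \row_i (c ord0 i + t * l ord0 i - y0 ord0 i + k).
apply: (@le_trans _ _ (m ((fun v => (v - phi y0) *m M) @^-1` box c' b'))).
  apply: le_measure; rewrite ?inE.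
  - by apply: cv_measurable; exact: measurable_rV_box.
  - rewrite -[X in measurable X]setTI; apply: measurable_mulmx => //.
      by apply: measurable_addrV => //; exact: measurable_cst.
    exact: measurable_rV_box.
  move=> x [Ux Qx]; rewrite /=.
  have yy0 i : `|psi x ord0 i - y0 ord0 i| <= t * lm.
    have := Qx i; have := cy i; rewrite !mxE => /andP[h1 h2] /andP[h3 h4].
    apply: (@le_trans _ _ (t * l ord0 i)); first by rewrite ler_norml; apply/andP; split; lra.
    rewrite ler_wpM2l ?(ltW t0)// /lm (le_trans (ler_norm _))// (le_trans (coord_le_norm l i))//.
    by rewrite lerDl.
  have nyy0 : `|psi x - y0| <= t * lm.
    apply: norm_le_coord => [|i]; first by rewrite mulr_ge0// ltW.
    by rewrite !mxE; exact: yy0.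
  have lt_r : `|psi x - y0| < r.
    apply: (le_lt_trans nyy0); apply: (@le_lt_trans _ _ (r / 2)); last by lra.
    have := ler_wpM2r (ltW lm0) tr; rewrite invfM mulrA -[leRHS]mulrA mulVf ?mulr1//.
    by rewrite gt_eqF.
  have := hr _ lt_r; rewrite psiK//; set e := (X in `|X| <= _ -> _) => he.
  have xE : (x - phi y0) *m M = (psi x - y0) + e *m M.
    have -> : x - phi y0 = (psi x - y0) *m L + e by rewrite /e subrKC.
    by rewrite mulmxDl -mulmxA LM mulmx1.
  have eM : `|e *m M| <= k.
    apply: (le_trans (MC _)); apply: (@le_trans _ _ (C * (d / (C * lm) * (t * lm)))).
      rewrite ler_wpM2l ?(ltW C0)//; apply: (le_trans he); rewrite ler_wpM2l//.
      by rewrite divr_ge0 ?mulr_ge0// ltW.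
    by rewrite le_eqVlt; apply/orP; left; apply/eqP; rewrite /k; field; rewrite !gt_eqF.
  move=> i; rewrite xE !mxE; have := le_trans (coord_le_norm (e *m M) i) eM.
  have := Qx i; rewrite !mxE ler_norml => /andP[h1 h2] /andP[h3 h4].
  by apply/andP; split; lra.
rewrite (lebesgue_preimage_affine _ uM (measurable_rV_box _ _)) detM mboxE//.
rewrite lebesgue_rV_boxE; last first.
  by move=> i; rewrite !mxE; have := mulr_gt0 t0 (l0 i); lra.
rewrite -!EFinM lee_fin mulrAC [leRHS]mulrC ler_wpM2l ?normr_ge0//.
rewrite (eq_bigr (fun i => (1 + d * (2 / l ord0 i)) * (t * l ord0 i))); last first.
  by move=> i _; rewrite !mxE /k; field; rewrite gt_eqF.
rewrite big_split/= ler_wpM2r//; apply: prodr_ge0 => i _.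
by rewrite mulr_ge0// ltW.
Qed.

(** The mirror image of the upper estimate: differentiability of [psi] at [phi y0] shows that the
    affine preimage of a slightly smaller box is mapped by [psi] into the given one. *)
Lemma cv_lower : exists2 t0 : R, 0 < t0 & forall t c, 0 < t <= t0 ->
  cbox c (c + t *: l) y0 ->
  ((K^-1 * D)%:E * m (box c (c + t *: l)) <= m (U `&` psi @^-1` box c (c + t *: l)))%E.
Proof.
have [d d0 [d1 _ dK]] := prod_near1 K1 q0.
have [C C0 LC] := norm_mulmx_le L.
pose lm := `|l| + 1; have lm0 : 0 < lm by rewrite ltr_wpDl.
have Ux0 := phiG Gy0.
have dC : 0 < d / (C * lm) by rewrite divr_gt0// mulr_gt0.
have [r r0 hr] := diff_expand (dpsi Ux0) dC.
(* A second radius, to keep the affine preimage inside [U]. *)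
have /nbhs_ballP[r' /= r'0 hr'] : nbhs (phi y0) U by exact: open_nbhs_nbhs.
exists (Num.min r r' / (2 * (C * lm))) => [|t c /andP[t0 tr] cy].
  by rewrite divr_gt0 ?lt_min ?r0// !mulr_gt0.
pose k := d * t.
have k0 : 0 < k by rewrite mulr_gt0.
pose c' : 'rV[R]_n := \row_i (c ord0 i - y0 ord0 i + k).
pose b' : 'rV[R]_n := \row_i (c ord0 i + t * l ord0 i - y0 ord0 i - k).
have kl i : 2 * k <= t * l ord0 i.
  have := ler_wpM2r (ltW (mulr_gt0 t0 (l0 i))) (d1 i).
  rewrite mul1r; apply: le_trans; rewrite le_eqVlt; apply/orP; left; apply/eqP.
  by rewrite /k; field; rewrite gt_eqF.
apply: (@le_trans _ _ (m ((fun v => (v - phi y0) *m M) @^-1` box c' b'))); last first.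
  apply: le_measure; rewrite ?inE.
  - rewrite -[X in measurable X]setTI; apply: measurable_mulmx => //.
      by apply: measurable_addrV => //; exact: measurable_cst.
    exact: measurable_rV_box.
  - by apply: cv_measurable; exact: measurable_rV_box.
  move=> x /= Bx.
  set z := (x - phi y0) *m M in Bx.
  have zt i : `|z ord0 i| <= t * lm.
    have := Bx i; have := cy i; rewrite !mxE => /andP[h1 h2] /andP[h3 h4].
    apply: (@le_trans _ _ (t * l ord0 i)); first by rewrite ler_norml; apply/andP; split; lra.
    rewrite ler_wpM2l ?(ltW t0)// /lm (le_trans (ler_norm _))// (le_trans (coord_le_norm l i))//.
    by rewrite lerDl.
  have nz : `|z| <= t * lm.
    by apply: norm_le_coord => // ; rewrite mulr_ge0// ltW.
  have xz : x - phi y0 = z *m L by rewrite /z -mulmxA ML mulmx1.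
  have nx : `|x - phi y0| <= C * (t * lm).
    by rewrite xz (le_trans (LC _))// ler_wpM2l// ltW.
  have ltmin : `|x - phi y0| < Num.min r r'.
    have mr0 : 0 < Num.min r r' by rewrite lt_min r0.
    apply: (le_lt_trans nx); apply: (@le_lt_trans _ _ (Num.min r r' / 2)); last by lra.
    have Clm0 : 0 < C * lm by rewrite mulr_gt0.
    have := ler_wpM2r (ltW Clm0) tr.
    have -> : Num.min r r' / (2 * (C * lm)) * (C * lm) = Num.min r r' / 2.
      by field; rewrite !gt_eqF.
    by rewrite mulrCA.
  have Ux : U x.
    apply: hr'; rewrite -ball_normE /= distrC.
    by move: ltmin; rewrite lt_min => /andP[].
  split => // i.
  have xr : `|x - phi y0| < r by move: ltmin; rewrite lt_min => /andP[].
  have := hr _ xr; rewrite phiK// -/M -/z; set e := (X in `|X| <= _ -> _) => he.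
  have ek : `|e| <= k.
    apply: (le_trans he); apply: (@le_trans _ _ (d / (C * lm) * (C * (t * lm)))).
      by rewrite ler_wpM2l// divr_ge0 ?mulr_ge0// ltW.
    by rewrite le_eqVlt; apply/orP; left; apply/eqP; rewrite /k; field; rewrite !gt_eqF.
  have pE : psi x = y0 + z + e by rewrite /e addrAC -addrA subrK subrKC.
  rewrite pE; have := le_trans (coord_le_norm e i) ek.
  have := Bx i; rewrite !mxE ler_norml => /andP[h1 h2] /andP[h3 h4].
  by apply/andP; split; lra.
rewrite (lebesgue_preimage_affine _ uM (measurable_rV_box _ _)) detM mboxE//.
rewrite lebesgue_rV_boxE; last first.
  by move=> i; rewrite !mxE; have := kl i; lra.
rewrite -!EFinM lee_fin mulrAC mulrC ler_wpM2l ?normr_ge0//.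
rewrite [leRHS](eq_bigr (fun i => (1 - d * (2 / l ord0 i)) * (t * l ord0 i))); last first.
  by move=> i _; rewrite !mxE /k; field; rewrite gt_eqF.
rewrite [leRHS]big_split/= ler_wpM2r//; apply: prodr_ge0 => i _.
by rewrite mulr_ge0// ltW.
Qed.

End local_estimates.

End change_of_variables.

(** The square appears because two measures are compared through the volume of a small box, each
    comparison losing a factor [K]. *)
Lemma lee_of_mul_gt1 {R : realType} (x y : \bar R) : (0 <= y)%E ->
  (forall K : R, 1 < K -> (x <= (K * K)%:E * y)%E) -> (x <= y)%E.
Proof.
case: y => [y| |]// y0 H; last by rewrite leey.
rewrite lee_fin in y0; apply/lee_addgt0Pr => e e0.
(* With [s <= 1] one has [(1 + s) ^ 2 <= 1 + 3 * s], and the second bound makes [3 * s * y] at most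
   [e]. *)
pose s := Num.min 1 (e / (3 * (y + 1))).
have y1 : 0 < 3 * (y + 1) by rewrite mulr_gt0// ltr_wpDl.
have s0 : 0 < s by rewrite lt_min ltr01 divr_gt0.
have s1 : s <= 1 by rewrite ge_min lexx.
have sy : 3 * s * y <= e.
  have : s <= e / (3 * (y + 1)) by rewrite ge_min lexx orbT.
  rewrite ler_pdivlMr// => h; apply: le_trans h; rewrite -subr_ge0.
  by rewrite (_ : _ - _ = 3 * s); [rewrite mulr_ge0// ltW|ring].
apply: (le_trans (H (1 + s) _)); first by rewrite ltrDl.
rewrite -EFinM -EFinD lee_fin.
have : (1 + s) * (1 + s) <= 1 + 3 * s by nra.
by move=> /(ler_wpM2r y0) /le_trans; apply; lra.
Qed.

(** * From local estimates to the change of variables formula *)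

Section change_of_variables_formula.
Context {R : realType} {n : nat}.
Local Notation m := (@lebesgue_rV R n).
Variables (U G : set 'rV[R]_n) (psi phi : 'rV[R]_n -> 'rV[R]_n).
Hypotheses (oU : open U) (oG : open G).
Hypotheses (psiU : forall x, U x -> G (psi x)) (psiK : forall x, U x -> phi (psi x) = x).
Hypotheses (phiG : forall y, G y -> U (phi y)) (phiK : forall y, G y -> psi (phi y) = y).
Hypotheses (dpsi : forall x, U x -> differentiable psi x)
  (dphi : forall y, G y -> differentiable phi y).
Hypothesis cJ : forall y, G y -> {for y, continuous (fun y => 'J phi y)}.

Let jac y := `|\det ('J phi y)|.

Lemma jac_gt0 y : G y -> 0 < jac y.
Proof.
move=> Gy; have [uJ _] := mulmx1_unit (cv_jacobian oG phiG phiK dpsi dphi Gy).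
by rewrite /jac normr_gt0 -unitfE -unitmxE.
Qed.

Lemma jac_continuous y : G y -> {for y, continuous jac}.
Proof.
move=> Gy; apply: (@continuous_comp _ _ _ (fun y => \det ('J phi y)) (fun x => `|x|)).
  by apply: continuous_det; exact: cJ.
exact: norm_continuous.
Qed.

Let mG : measurable G. Proof. exact: open_rV_measurable. Qed.

Let mU : measurable U. Proof. exact: open_rV_measurable. Qed.

Lemma measurable_jac : measurable_fun G jac.
Proof. by apply: open_continuous_measurable_R => // y; exact: jac_continuous. Qed.

(** Off [G] the patched function takes the default point of the extended reals, which is 0. *)
Let f := (EFin \o jac) \_ G.

Let f0 y : (0 <= f y)%E.
Proof. by rewrite /f patchE; case: ifP => // _; rewrite lee_fin normr_ge0. Qed.

Let mf : measurable_fun setT f.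
Proof.
apply/(measurable_restrictT _ mG); apply/measurable_EFinP; exact: measurable_jac.
Qed.

Let lam := mdens m mf f0.

(** Nothing is known of [psi] off [U]. Replacing it there by a constant makes it globally
    measurable, and restricting Lebesgue measure to [U] discards the extra preimages. *)
Let psit := psi \_ U.

Let mpsit : measurable_fun setT psit.
Proof.
apply/(measurable_restrictT _ mU); apply: open_continuous_measurable_rV => // x Ux.
by apply: differentiable_continuous; exact: dpsi.
Qed.

Let nu := mpush (mrestr m mU) mpsit.

Let nuE A : nu A = m (U `&` psi @^-1` A).
Proof.
rewrite /nu mpushE /mrestr; congr (lebesgue_rV n _).
apply/seteqP; split => [x [/= Ax Ux]|x [/= Ux Ax]]; split => //; move: Ax; rewrite /psit /= patchE mem_set//.
Qed.

(** By continuity, the Jacobian on a small box stays within a factor [K] of its value at [y0]. *)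
Lemma dens_local (y0 l : 'rV[R]_n) (K : R) : G y0 -> (forall i, 0 < l ord0 i) -> 1 < K ->
  exists2 t0 : R, 0 < t0 & forall t c, 0 < t <= t0 -> cbox c (c + t *: l) y0 ->
  ((K^-1 * jac y0)%:E * m (box c (c + t *: l)) <= lam (box c (c + t *: l)) /\
   lam (box c (c + t *: l)) <= (K * jac y0)%:E * m (box c (c + t *: l)))%E.
Proof.
move=> Gy0 l0 K1; have D0 := jac_gt0 Gy0.
have near1 : \forall y \near y0, [/\ G y, K^-1 * jac y0 <= jac y & jac y <= K * jac y0].
  have h1 : \forall y \near y0, G y by exact: open_nbhs_nbhs.
  have h2 : \forall y \near y0, jac y <= K * jac y0.
    by have /cvgr_le := jac_continuous Gy0; apply; rewrite ltr_pMl.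
  have h3 : \forall y \near y0, K^-1 * jac y0 <= jac y.
    have /cvgr_ge := jac_continuous Gy0; apply; rewrite gtr_pMl//.
    by rewrite invf_lt1// (lt_trans ltr01).
  by near=> y; split; near: y.
have /nbhs_ballP[r /= r0 hr] := near1.
pose lm := `|l| + 1; have lm0 : 0 < lm by rewrite ltr_wpDl.
exists (r / (2 * lm)) => [|t c /andP[t0 tr] cy]; first by rewrite divr_gt0// mulr_gt0.
have Qr y : box c (c + t *: l) y -> [/\ G y, K^-1 * jac y0 <= jac y & jac y <= K * jac y0].
  move=> Qy; apply: hr; rewrite -ball_normE /= distrC.
  have nyy0 : `|y - y0| <= t * lm.
    apply: norm_le_coord => [|i]; first by rewrite mulr_ge0// ltW.
    have := Qy i; have := cy i; rewrite !mxE => /andP[h1 h2] /andP[h3 h4].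
    apply: (@le_trans _ _ (t * l ord0 i)); first by rewrite ler_norml; apply/andP; split; lra.
    rewrite ler_wpM2l ?(ltW t0)// /lm (le_trans (ler_norm _))// (le_trans (coord_le_norm l i))//.
    by rewrite lerDl.
  apply: (le_lt_trans nyy0); apply: (@le_lt_trans _ _ (r / 2)); last by lra.
  have := ler_wpM2r (ltW lm0) tr.
  by rewrite (_ : r / (2 * lm) * lm = r / 2)//; field; rewrite gt_eqF.
have mQ := measurable_rV_box c (c + t *: l).
have mfQ : measurable_fun (box c (c + t *: l)) f by exact: measurable_funTS.
split; rewrite /lam /mdens -integral_cst//; apply: ge0_le_integral => //.
- by move=> y _; rewrite lee_fin mulr_ge0 ?invr_ge0 ?normr_ge0// ltW// (lt_trans ltr01).
- by move=> y /Qr [Gy h1 h2]; rewrite /f patchE mem_set//= lee_fin.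
- by move=> y /Qr [Gy h1 h2]; rewrite /f patchE mem_set//= lee_fin.
Unshelve. all: by end_near. Qed.

(** The closed box has to lie in [G] because the bisection may converge to a point of its boundary.
    Near that point both measures of a small box are close to [jac y] times its volume. *)
Let box_eq a b : cbox a b `<=` G -> nu (box a b) = lam (box a b).
Proof.
move=> abG.
have [ab|/existsNP[i /negP]] := pselect (forall i, a ord0 i < b ord0 i); last first.
  rewrite -leNgt => ba; rewrite (_ : box a b = set0) ?measure0//.
  apply/seteqP; split => // v /(_ i) /andP[av vb].
  by have := lt_le_trans (le_lt_trans av vb) ba; rewrite ltxx.
pose w := b - a.
have w0 i : 0 < w ord0 i by rewrite !mxE subr_gt0.
have bE : b = a + w by rewrite /w subrKC.
have wge i : 0 <= w ord0 i by exact: ltW.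
apply/eqP; rewrite eq_le; apply/andP; split; apply: lee_of_mul_gt1 => // K K1;
  have K0 : 0 < K := lt_trans ltr01 K1;
  have KK0 : 0 <= K * K by rewrite mulr_ge0 ?(ltW K0).
- rewrite bE; apply: box_le_local => //.
  move=> y; rewrite -bE => /abG Gy.
  have [t1 t10 h1] := cv_upper oU oG psiK phiG phiK dpsi dphi Gy w0 K1.
  have [t2 t20 h2] := dens_local Gy w0 K1.
  exists (Num.min t1 t2) => [|t c]; first by rewrite lt_min t10.
  rewrite le_min => /and3P[t0 tt1 tt2] cy.
  have tt1' : 0 < t <= t1 by rewrite t0.
  have tt2' : 0 < t <= t2 by rewrite t0.
  have [h3 _] := h2 t c tt2' cy; have := h1 t c tt1' cy.
  rewrite nuE => /le_trans; apply.
  have KKE : (0 <= (K * K)%:E)%E by rewrite lee_fin.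
  have := lee_wpmul2l KKE h3.
  apply: le_trans; rewrite muleA -EFinM.
  by rewrite (_ : K * K * _ = K * `|\det ('J phi y)|)// /jac; field; rewrite gt_eqF.
- rewrite bE; apply: box_le_local => //.
  move=> y; rewrite -bE => /abG Gy.
  have [t1 t10 h1] := cv_lower oU oG phiG phiK dpsi dphi Gy w0 K1.
  have [t2 t20 h2] := dens_local Gy w0 K1.
  exists (Num.min t1 t2) => [|t c]; first by rewrite lt_min t10.
  rewrite le_min => /and3P[t0 tt1 tt2] cy.
  have tt1' : 0 < t <= t1 by rewrite t0.
  have tt2' : 0 < t <= t2 by rewrite t0.
  have h3 := h1 t c tt1' cy; have [_] := h2 t c tt2' cy.
  rewrite nuE => /le_trans; apply.
  have KKE : (0 <= (K * K)%:E)%E by rewrite lee_fin.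
  have := lee_wpmul2l KKE h3.
  apply: le_trans; rewrite muleA -EFinM.
  by rewrite (_ : K * K * _ = K * `|\det ('J phi y)|)// /jac; field; rewrite gt_eqF.
Qed.

Let good (p : 'rV[rat]_n * 'rV[rat]_n) :=
  cbox (map_mx ratr p.1) (map_mx ratr p.2) `<=` G /\
  exists M, forall y, rbox p y -> jac y <= M.

(** An enumeration of the rational boxes with closure in [G], where the two measures agree on boxes,
    and with bounded Jacobian, so that the density measure is finite and uniqueness applies. All
    other indices give the empty set. *)
Let Kj (j : nat) : set 'rV[R]_n :=
  if @unpickle ('rV[rat]_n * 'rV[rat]_n)%type j is Some p then
    if `[< good p >] then rbox p else set0 else set0.

Let Kj_eq j A : measurable A -> nu (A `&` Kj j) = lam (A `&` Kj j).
Proof.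
move=> mA; rewrite /Kj; case: unpickle => [p|]; last by rewrite setI0 !measure0.
case: asboolP => [[pG [M pM]]|]; last by rewrite setI0 !measure0.
have mp : measurable (@rbox R n p) by exact: measurable_rV_box.
have E q : nu (rbox q `&` rbox p) = lam (rbox q `&` rbox p).
  rewrite rbox_setI; apply: box_eq => v vqp; apply: pG => i; have := vqp i.
  rewrite !mxE => /andP[h1 h2]; apply/andP; split.
    by apply: le_trans h1; rewrite ler_rat le_max lexx orbT.
  by apply: le_trans h2 _; rewrite ler_rat ge_min lexx orbT.
apply/esym; rewrite -[LHS]/(mrestr lam mp A) -[RHS]/(mrestr nu mp A).
apply: measure_rV_unique => // q; first exact/esym/E.
apply: (@le_lt_trans _ _ (lam (rbox p))).
  by apply: (@le_measure _ _ _ lam); rewrite ?inE//; apply: measurableI => //; exact: measurable_rV_box.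
rewrite /lam /mdens; apply: (@le_lt_trans _ _ (\int[m]_(x in rbox p) cst `|M|%:E x)%E).
  apply: ge0_le_integral => //; first exact: measurable_funTS.
  move=> y py; rewrite /f patchE; case: ifP => _ /=.
    by rewrite lee_fin; apply: le_trans (ler_norm M); exact: pM.
  by rewrite -[point]/(0%:E) lee_fin.
by rewrite integral_cst//; apply: lte_mul_pinfty => //; exact: lebesgue_rV_box_lty.
Qed.

Let Kj_cover : G `<=` \bigcup_j Kj j.
Proof.
move=> y Gy.
have near1 : \forall z \near y, G z /\ jac z <= jac y + 1.
  have h1 : \forall z \near y, G z by exact: open_nbhs_nbhs.
  have h2 : \forall z \near y, jac z <= jac y + 1.
    by have /cvgr_le := jac_continuous Gy; apply; rewrite ltrDl.
  by near=> z; split; near: z.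
have [p py pG] := cbox_nbhs near1.
exists (pickle p) => //; rewrite /Kj pickleK; case: asboolP => // -[].
split; first by move=> z /pG [].
exists (jac y + 1) => z pz; have [] // := pG z _.
by move=> i; have /andP[-> /ltW ->] := pz i.
Unshelve. all: by end_near. Qed.

Theorem change_of_variables A : measurable A ->
  m (U `&` psi @^-1` A) = (\int[m]_(y in G `&` A) (jac y)%:E)%E.
Proof.
move=> mA; have mGA : measurable (G `&` A) by exact: measurableI.
transitivity (nu (G `&` A)).
  rewrite nuE; congr (lebesgue_rV n _); apply/seteqP; split => x [Ux Ax]; split => //.
    by split => //; exact: psiU.
  by case: Ax.
rewrite (@measure_eq_cover _ _ _ nu lam Kj (G `&` A))//.
- rewrite /lam /mdens; apply: eq_integral => y; rewrite inE => -[Gy _].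
  by rewrite /f patchE mem_set.
- move=> j; rewrite /Kj; case: unpickle => // p; case: asboolP => // _.
  exact: measurable_rV_box.
- by move=> y [Gy _]; exact: Kj_cover.
Qed.

End change_of_variables_formula.

(** * Oscillation over Euclidean balls *)

Section euclidean_balls.
Context {R : realType}.
Local Notation m := (@lebesgue_rV R _).

Lemma eucl_coord n (x y : 'rV[R]_n) i : `|x ord0 i - y ord0 i| <= eucl_dist x y.
Proof.
rewrite -sqrtr_sqr ler_sqrt.
  by rewrite (bigD1 i)//= lerDl sumr_ge0// => j _; exact: sqr_ge0.
by rewrite sumr_ge0// => j _; exact: sqr_ge0.
Qed.

Lemma eucl_le n (x y : 'rV[R]_n) : eucl_dist x y <= \sum_i `|x ord0 i - y ord0 i|.
Proof.
have S0 : 0 <= \sum_i `|x ord0 i - y ord0 i| by rewrite sumr_ge0.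
rewrite -[leRHS]ger0_norm// -sqrtr_sqr ler_sqrt ?sqr_ge0// expr2 big_distrl /=.
apply: ler_sum => i _; rewrite -real_normK ?num_real// expr2 ler_wpM2l//.
by rewrite (bigD1 i)//= lerDl sumr_ge0.
Qed.

Lemma measurable_eucl_ball n (x : 'rV[R]_n) (e : R) : 0 < e -> measurable (eucl_ball x e).
Proof.
move=> e0; pose h (y : 'rV[R]_n) := \sum_(i < n) (x ord0 i - y ord0 i) ^+ 2.
have mh : measurable_fun setT h.
  apply: measurable_sum => i; apply: measurable_funX.
  by apply: measurable_funB => //; exact: measurable_rV_coord.
rewrite (_ : eucl_ball x e = h @^-1` `]-oo, e ^+ 2[%classic).
  by rewrite -[X in measurable X]setTI; apply: mh => //; exact: measurable_itv.
apply/seteqP; split => y; rewrite /eucl_ball /= in_itv /= /eucl_dist -/(h y).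
  have hy0 : 0 <= h y by rewrite sumr_ge0// => i _; exact: sqr_ge0.
  by move=> hy; rewrite -(sqr_sqrtr hy0) ltr_pXn2r// nnegrE ?sqrtr_ge0// ltW.
move=> hy; rewrite -[ltRHS]gtr0_norm// -sqrtr_sqr ltr_sqrt// exprn_gt0//.
Qed.

Lemma eucl_ball_nbhs n (x : 'rV[R]_n) (e : R) : 0 < e -> nbhs x (eucl_ball x e).
Proof.
move=> e0; apply/nbhs_ballP; exists (e / n.+1%:R) => /=; first by rewrite divr_gt0.
move=> y [_ xy]; rewrite /eucl_ball /=; apply: (le_lt_trans (eucl_le x y)).
apply: (@le_lt_trans _ _ (\sum_(i < n) (e / n.+1%:R))).
  by apply: ler_sum => i _; apply/ltW; exact: xy.
rewrite sumr_const card_ord -[_ *+ n]mulr_natr mulrAC ltr_pdivrMr// ltr_pM2l// ltr_nat//.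
Qed.

Lemma lebesgue_rV_gt0 n (x : 'rV[R]_n) (A : set 'rV[R]_n) : measurable A -> nbhs x A ->
  (0 < m A)%E.
Proof.
move=> mA /rbox_nbhs[p px pA].
apply: (@lt_le_trans _ _ (m (rbox p))); last first.
  by apply: le_measure; rewrite ?inE//; exact: measurable_rV_box.
rewrite lebesgue_rV_boxE => [|i]; last first.
  by have /andP[h1 h2] := px i; apply: le_trans h1 (ltW h2).
rewrite lte_fin; apply: prodr_gt0 => i _.
by have /andP[h1 h2] := px i; rewrite subr_gt0; apply: le_lt_trans h1 h2.
Qed.

Lemma bounded_lebesgue_lty n (A : set 'rV[R]_n) (M : R) : measurable A ->
  (forall v, A v -> forall i, `|v ord0 i| <= M) -> (m A < +oo)%E.
Proof.
move=> mA AM; apply: le_lt_trans (lebesgue_rV_box_lty (const_mx (- M)) (const_mx (M + 1))).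
apply: le_measure; rewrite ?inE//; first exact: measurable_rV_box.
exact: bounded_sub_box.
Qed.

Lemma eucl_ball_gt0 n (x : 'rV[R]_n) (e : R) : 0 < e -> (0 < m (eucl_ball x e))%E.
Proof.
by move=> e0; apply: (@lebesgue_rV_gt0 n x); [exact: measurable_eucl_ball|exact: eucl_ball_nbhs].
Qed.

Lemma eucl_ball_scale n (x : 'rV[R]_n) (e : R) : 0 < e ->
  m (eucl_ball x e) = ((e ^+ n)%:E * m (@eucl_ball R n 0 1))%E.
Proof.
move=> e0.
have ue : ((e^-1)%:M : 'M[R]_n) \in unitmx.
  by rewrite unitmxE det_scalar unitfE expf_neq0// invr_eq0 gt_eqF.
have -> : eucl_ball x e = (fun v => (v - x) *m (e^-1)%:M) @^-1` (@eucl_ball R n 0 1).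
  apply/funext => y; apply/propext; rewrite /eucl_ball /= /eucl_dist.
  rewrite [in X in _ <-> X](_ : \sum_i _ = e^-1 ^+ 2 * \sum_i (x ord0 i - y ord0 i) ^+ 2).
    by rewrite sqrtrM ?sqr_ge0// sqrtr_sqr gtr0_norm ?invr_gt0// mulrC ltr_pdivrMr// mul1r.
  rewrite mulr_sumr; apply: eq_bigr => i _.
  by rewrite mul_mx_scalar !mxE sub0r sqrrN exprMn; congr (_ * _); ring.
rewrite lebesgue_preimage_affine//; last exact: measurable_eucl_ball.
rewrite det_scalar; congr (_%:E * _)%E.
by rewrite ger0_norm ?exprn_ge0 ?invr_ge0 ?ltW// exprVn invrK.
Qed.

Lemma eucl_ball_lty n (x : 'rV[R]_n) (e : R) : 0 < e -> (m (eucl_ball x e) < +oo)%E.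
Proof.
move=> e0; have ? := measurable_eucl_ball x e0.
apply: (@bounded_lebesgue_lty _ _ (`|x| + e)) => // v xv i.
rewrite -[v ord0 i](subrK (x ord0 i)) (le_trans (ler_normD _ _))// addrC lerD//.
  exact: coord_le_norm.
by rewrite distrC (le_trans (eucl_coord x v i))// ltW.
Qed.

End euclidean_balls.

Section oscillation.
Context {R : realType} {n : nat}.
Local Notation m := (@lebesgue_rV R n).
Local Open Scope ereal_scope.
Implicit Types (f g : 'rV[R]_n -> R) (K C : set 'rV[R]_n).

(* No measurability: the integral is a supremum over simple functions below. *)
Lemma ge0_le_integral_nomeas d (T : measurableType d) (mu : {measure set T -> \bar R})
    (f g : T -> \bar R) :
  (forall x, 0 <= f x) -> (forall x, f x <= g x) -> \int[mu]_x f x <= \int[mu]_x g x.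
Proof.
move=> f0 fg; rewrite !ge0_integralTE//; last by move=> x; exact: le_trans (f0 x) (fg x).
apply: le_ereal_sup => _ [h hf <-]; exists h => // x.
exact: le_trans (hf x) (fg x).
Qed.

Lemma ae_not_negligible d (T : measurableType d) (mu : {measure set T -> \bar R})
    (A : set T) (Q : T -> Prop) : ~ mu.-negligible A ->
  (\forall x \ae mu, A x -> Q x) -> exists2 x, A x & Q x.
Proof.
move=> nA AQ; apply: contrapT => h; apply: nA; apply: negligibleS AQ => x Ax /= AQx.
by apply: h; exists x => //; exact: AQx.
Qed.

Lemma not_negligible d (T : measurableType d) (mu : {measure set T -> \bar R})
    (A : set T) : measurable A -> 0 < mu A -> ~ mu.-negligible A.
Proof. by move=> mA A0 /(measure_negligible mA) h; rewrite h ltxx in A0. Qed.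

Section osc_pos.
Variables (f : 'rV[R]_n -> R) (K : set 'rV[R]_n).
Hypotheses (mK : measurable K) (K0 : 0 < m K).

Let sups := [set y | \forall x \ae m, K x -> (f x)%:E <= y].
Let infs := [set y | \forall x \ae m, K x -> y <= (f x)%:E].

(** [K] is the union of its parts on which [f <= k], so one of these is not negligible, and [k]
    dominates every essential lower bound. With the symmetric lemma this excludes a difference of
    equal infinities in [osc], which would count as [-oo]. *)
Lemma osc_infs_lty : ereal_sup infs < +oo.
Proof.
have [k nk] : exists k : nat, ~ m.-negligible (K `&` [set x | (f x <= k%:R)%R]).
  apply: contrapT => h; apply: (not_negligible mK K0).
  have : m.-negligible (\bigcup_k (K `&` [set x | (f x <= k%:R)%R])).
    apply: negligible_bigcup => k; apply: contrapT => hk; by apply: h; exists k.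
  apply: negligibleS => x Kx; exists (Num.truncn `|f x|).+1 => //; split => //=.
  by apply: (le_trans (ler_norm _)); apply/ltW; exact: truncnS_gt.
apply: (@le_lt_trans _ _ k%:R%:E); last by rewrite ltry.
apply: ge_ereal_sup => y Ky.
have [|x [Kx fx] yx] := @ae_not_negligible _ _ m _ (fun x => y <= (f x)%:E) nk.
  by apply: filterS Ky => x h [/h].
by apply: (le_trans yx); rewrite lee_fin.
Qed.

Lemma osc_sups_gtNy : -oo < ereal_inf sups.
Proof.
have [k nk] : exists k : nat, ~ m.-negligible (K `&` [set x | (- k%:R <= f x)%R]).
  apply: contrapT => h; apply: (not_negligible mK K0).
  have : m.-negligible (\bigcup_k (K `&` [set x | (- k%:R <= f x)%R])).
    apply: negligible_bigcup => k; apply: contrapT => hk; by apply: h; exists k.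
  apply: negligibleS => x Kx; exists (Num.truncn `|f x|).+1 => //; split => //=.
  rewrite lerNl; apply: (le_trans (ler_norm _)); rewrite normrN.
  by apply/ltW; exact: truncnS_gt.
apply: (@lt_le_trans _ _ (- k%:R)%:E); first by rewrite ltNyr.
apply: le_ereal_inf_tmp => y Ky.
have [|x [Kx fx] yx] := @ae_not_negligible _ _ m _ (fun x => (f x)%:E <= y) nk.
  by apply: filterS Ky => x h [/h].
by apply: le_trans yx; rewrite lee_fin.
Qed.

Lemma osc_ge0 : 0 <= osc f K.
Proof.
have le : ereal_sup infs <= ereal_inf sups.
  apply: ge_ereal_sup => y Ky; apply: le_ereal_inf_tmp => z Kz.
  have [|x Kx [h1 h2]] := @ae_not_negligible _ _ m K
      (fun x => y <= (f x)%:E /\ (f x)%:E <= z) (not_negligible mK K0).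
    by apply: filterS2 Ky Kz => x h1 h2 Kx; split; [exact: h1|exact: h2].
  exact: le_trans h1 h2.
rewrite /osc -/sups -/infs; move: osc_infs_lty osc_sups_gtNy le.
case: (ereal_sup infs) (ereal_inf sups) => [a| |] [b| |]//; rewrite ?lee_fin//.
- by rewrite subr_ge0.
all: by move=> *; exact: leey.
Qed.

End osc_pos.

Lemma osc_le f K (a b : R) : (forall x, K x -> (a <= f x <= b)%R) -> osc f K <= (b - a)%:E.
Proof.
move=> Kab; rewrite EFinB; apply: leeB.
  by apply: ereal_inf_lbound; apply: aeW => x /Kab /andP[_]; rewrite lee_fin.
by apply: ereal_sup_ubound; apply: aeW => x /Kab /andP[]; rewrite lee_fin.
Qed.

(** Only countably many exceptional sets occur: the negligible sets where [f] exceeds a rational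
    level inside a rational box. If the bound fails at [x], a level between [y] and [f x] and a box
    inside the ball put [x] into one of them. *)
Lemma ae_le_ess_sup_ball f : measurable_fun setT f ->
  \forall x \ae m, forall (e : R) (y : \bar R), (0 < e)%R ->
    (\forall z \ae m, eucl_ball x e z -> (f z)%:E <= y) -> (f x)%:E <= y.
Proof.
move=> mf.
pose N (j : nat) : set 'rV[R]_n :=
  if @unpickle ('rV[rat]_n * 'rV[rat]_n * rat)%type j is Some (p, c) then
    let A := rbox p `&` [set x | (ratr c < f x)%R] in
    if `[< m.-negligible A >] then A else set0 else set0.
have negN j : m.-negligible (N j).
  rewrite /N; case: unpickle => [[p c]|]; last exact: negligible_set0.
  by case: asboolP => // _; exact: negligible_set0.
have := negligible_bigcup negN; apply: negligibleS => x /= hx; apply: contrapT => Nx.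
apply: hx => e y e0 Bxy; rewrite leNgt; apply/negP => yfx.
have [c /andP[yc cf]] : exists c : rat, (y <= (ratr c)%:E) && (ratr c < f x)%R.
  case: y yfx {Bxy} => [y| |] //.
    rewrite lte_fin => yfx; have [c] := rat_in_itvoo yfx.
    by rewrite in_itv /= => /andP[/ltW yc cf]; exists c; rewrite lee_fin yc.
  move=> _; have [c] := @rat_in_itvoo R (f x - 1)%R (f x) (ltac:(by rewrite ltrBlDr ltrDl)).
  by rewrite in_itv /= => /andP[_ cf]; exists c; rewrite leNye.
have [p px pB] := rbox_nbhs (eucl_ball_nbhs x e0).
apply: Nx; exists (pickle (p, c)) => //; rewrite /N pickleK.
case: asboolP => [_|]; first by split.
case; apply: negligibleS Bxy => z [pz cz] /= h.
have := h (pB _ pz); rewrite leNgt => /negP; apply.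
by apply: (le_lt_trans yc); rewrite lte_fin.
Qed.

End oscillation.

Section oscillation_ball.
Context {R : realType} {n : nat}.
Local Notation m := (@lebesgue_rV R n).
Local Open Scope ereal_scope.
Implicit Types (f g : 'rV[R]_n -> R) (K C : set 'rV[R]_n).

(* Otherwise the essential infimum of [g] over every ball is below [k], so [g - k]
   is at most the oscillation a.e., and integrating over [C] contradicts the bounds. *)
Lemma osc_small_ball C g (e q k c : R) : (0 < e)%R -> (0 < k)%R ->
  measurable C -> m C = c%:E -> measurable_fun setT g -> (forall x, 0 <= g x)%R ->
  (forall x, ~ C x -> g x = 0%R) ->
  \int[m]_x osc g (eucl_ball x e) <= q%:E ->
  (q + k * c)%:E < \int[m]_x (g x)%:E ->
  exists x, \forall z \ae m, eucl_ball x e z -> (k <= g z)%R.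
Proof.
move=> e0 k0 mC mCc mg g0 gC oscq qg; apply: contrapT => nex.
have [A [mA A0 hA]] := ae_le_ess_sup_ball mg.
(* The indicator removes the null set [A], so that the oscillation bounds [h] at every point: the
   comparison of integrals used for [osc] is pointwise. *)
pose h x := (Num.max (g x - k) 0 * \1_(C `\` A) x)%R.
have h0 x : (0 <= h x)%R by rewrite mulr_ge0// le_max lexx orbT.
have mh : measurable_fun setT h.
  apply: measurable_funM; last by apply: measurable_indic; exact: measurableD.
  by apply: measurable_funrpos; apply: measurable_funB => //; exact: measurable_cst.
have hosc x : (h x)%:E <= osc g (eucl_ball x e).
  have mB := measurable_eucl_ball x e0; have B0 := eucl_ball_gt0 x e0.
  have o0 := osc_ge0 g mB B0.
  rewrite /h indicE; case: (boolP (x \in _)) => [/set_mem [Cx nAx]|_]; last by rewrite mulr0.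
  rewrite mulr1 /Num.max; case: ifP => _ //.
  have xgood : forall (e : R) (y : \bar R), (0 < e)%R ->
    (\forall z \ae m, eucl_ball x e z -> (g z)%:E <= y) -> (g x)%:E <= y.
    by apply: contrapT => hx; apply: nAx; exact: hA.
  rewrite EFinB; apply: leeB.
    by apply: le_ereal_inf_tmp => y; exact: xgood.
  apply: ge_ereal_sup => y hy; rewrite leNgt; apply/negP => ky; apply: nex; exists x.
  apply: filterS hy => z hz Bz; rewrite -lee_fin; apply: le_trans (hz Bz); exact: ltW.
have : \int[m]_x (h x)%:E <= q%:E.
  by apply: le_trans oscq; apply: ge0_le_integral_nomeas => // x; rewrite lee_fin.
apply/negP; rewrite -ltNge.
have ghk : \int[m]_x (g x)%:E <= \int[m]_x ((h x)%:E + (k * \1_C x)%:E).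
  apply: ae_ge0_le_integral => //.
  - by move=> x _; rewrite lee_fin.
  - by apply/measurable_EFinP.
  - by move=> x _; rewrite adde_ge0// lee_fin// mulr_ge0// ltW.
  - apply: emeasurable_funD; first exact/measurable_EFinP.
    apply/measurable_EFinP; apply: measurable_funM; first exact: measurable_cst.
    exact: measurable_indic.
  exists A; split => // x /= hx; apply: contrapT => nAx; apply: hx => _.
  rewrite -EFinD lee_fin /h !indicE; have [Cx|nCx] := pselect (C x).
    rewrite !mem_set//= !mulr1 -lerBlDr.
    by rewrite le_max lexx.
  by rewrite gC// addr_ge0// mulr_ge0 ?le_max ?lexx ?orbT// ltW.
have hE : \int[m]_x ((h x)%:E + (k * \1_C x)%:E) = \int[m]_x (h x)%:E + (k * c)%:E.
  rewrite ge0_integralD//; last 4 first.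
  - by move=> x _; rewrite lee_fin.
  - exact/measurable_EFinP.
  - by move=> x _; rewrite lee_fin mulr_ge0// ltW.
  - apply/measurable_EFinP; apply: measurable_funM; first exact: measurable_cst.
    exact: measurable_indic.
  congr (_ + _); under eq_integral do rewrite EFinM.
  rewrite ge0_integralZl_EFin//; last 2 first.
  - exact/measurable_EFinP/measurable_indic.
  - exact: ltW.
  by rewrite integral_indic// setIT mCc EFinM.
move: (lt_le_trans qg ghk); rewrite hE EFinD lteD2rE//.
Qed.

(** On the part of the good ball where [H] vanishes, [g] and [H] differ by at least [k]; by Markov's
    inequality this part has measure at most [dl / k]. *)
Lemma osc_support_ball C g (H : 'rV[R]_n -> R) (e q k c dl : R) : (0 < e)%R -> (0 < k)%R ->
  measurable C -> m C = c%:E -> measurable_fun setT g -> (forall x, 0 <= g x)%R ->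
  (forall x, ~ C x -> g x = 0%R) ->
  measurable_fun setT H -> (forall x, 0 <= H x)%R ->
  \int[m]_x osc g (eucl_ball x e) <= q%:E ->
  (q + k * c)%:E < \int[m]_x (g x)%:E ->
  \int[m]_x `|(g x)%:E - (H x)%:E| <= dl%:E ->
  m (eucl_ball 0%R e) <= m [set x | (0 < H x)%R] + (dl / k)%:E.
Proof.
move=> e0 k0 mC mCc mg g0 gC mH H0 oscq qg gH.
have [x xk] := osc_small_ball e0 k0 mC mCc mg g0 gC oscq qg.
have mHp : measurable [set x | (0 < H x)%R] by exact: measurable_lt_set.
have mB := measurable_eucl_ball x e0.
have -> : m (eucl_ball 0%R e) = m (eucl_ball x e).
  by rewrite eucl_ball_scale// [RHS]eucl_ball_scale.
set P := [set x | _] in mHp *.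
rewrite (measureDI _ mB mHp) addeC; apply: leeD.
  by apply: le_measure; rewrite ?inE//; exact: measurableI.
have mD : measurable (eucl_ball x e `\` P) by exact: measurableD.
rewrite -(@lee_pmul2l _ k%:E)// -EFinM mulrCA mulfV ?gt_eqF// mulr1.
apply: le_trans gH.
have mgH : measurable_fun setT (fun x => `|(g x)%:E - (H x)%:E|).
  apply: measurableT_comp => //; apply: emeasurable_funB; exact/measurable_EFinP.
apply: (@le_trans _ _ (\int[m]_(x in eucl_ball x e `\` P) `|(g x)%:E - (H x)%:E|)); last first.
  by apply: ge0_subset_integral.
rewrite -integral_cst//; apply: ae_ge0_le_integral => //.
- by move=> y _; rewrite lee_fin ltW.
- exact: measurable_funTS.
apply: filterS xk => y hy [By /negP]; rewrite -leNgt => Hy.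
have -> : H y = 0%R by apply/eqP; rewrite eq_le Hy H0.
by rewrite sube0 gee0_abs ?lee_fin//; exact: hy.
Qed.

End oscillation_ball.

(** * Lipschitz functions in the space of bounded oscillation *)

Section lipschitz_Valpha.
Context {R : realType} {n : nat}.
Local Notation m := (@lebesgue_rV R n).
Variables (C : set 'rV[R]_n) (alpha te0 : R).
Hypotheses (cC : compact C) (a1 : alpha <= 1) (te00 : 0 < te0).

Lemma compact_coord_bounded : exists2 M : R, 0 < M & forall v, C v -> `|v| <= M.
Proof.
have [M [_ hM]] := compact_bounded cC.
exists (Num.max (M + 1) 1); first by rewrite lt_max ltr01 orbT.
by move=> v Cv; apply: hM => //; rewrite lt_max ltrDl ltr01.
Qed.

Lemma compact_rV_measurable : measurable C.
Proof.
have : closed C by apply: compact_closed => //; exact: norm_hausdorff.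
by move=> /closed_openC oC; rewrite -[C]setCK; apply: measurableC; exact: open_rV_measurable.
Qed.

Lemma compact_lebesgue_lty : (m C < +oo)%E.
Proof.
have [M M0 hM] := compact_coord_bounded.
apply: (@bounded_lebesgue_lty _ _ _ M); first exact: compact_rV_measurable.
by move=> v /hM vM i; exact: le_trans (coord_le_norm v i) vM.
Qed.

(** Lipschitz on the whole space and not only on [C]: the extension by zero then has no jump at the
    boundary of [C] that would enter the oscillation. *)
Definition lipschitz_on_C (L : R) (f : 'rV[R]_n -> R) :=
  (forall x y, `|f x - f y| <= L * `|x - y|) /\ (forall x, ~ C x -> f x = 0).

Lemma lipschitz_measurable L f : lipschitz_on_C L f -> measurable_fun setT f.
Proof.
move=> [fL _]; apply: open_continuous_measurable_R; first exact: openT.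
move=> x _; apply/(@cvgrPdist_le _ _ _ (nbhs x) (nbhs_filter x)) => e e0.
have L0 : 0 < `|L| + 1 by rewrite ltr_wpDl.
near=> y; apply: (le_trans (fL _ _)).
apply: (@le_trans _ _ ((`|L| + 1) * `|x - y|)).
  by rewrite ler_wpM2r// (le_trans (ler_norm L))// lerDl.
rewrite mulrC -ler_pdivlMr//; near: y.
apply/nbhs_ballP; exists (e / (`|L| + 1)) => /=; first by rewrite divr_gt0.
by move=> z; rewrite -ball_normE => /ltW.
Unshelve. all: by end_near. Qed.

(** The oscillation over a ball of radius [e] is at most [2 * L * e] and vanishes far from [C], so
    the seminorm is controlled by [e ^ (1 - alpha)], which is bounded for [e <= te0] because
    [alpha <= 1]. *)
Lemma lipschitz_Vnorm (L : R) : (0 < n)%N -> 0 <= L -> exists M : R,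
  forall f, lipschitz_on_C L f -> Valpha C alpha te0 f /\ (Vnorm alpha te0 f <= M%:E)%E.
Proof.
move=> n0 L0; have [M M0 hM] := compact_coord_bounded.
have mC := compact_rV_measurable.
(* Contains every point at distance less than [te0] from [C]; off it the oscillations in question
   vanish. *)
pose C' : set 'rV[R]_n := box (const_mx (- (M + te0))) (const_mx (M + te0 + 1)).
have mC' : measurable C' by exact: measurable_rV_box.
have C'oo : (m C' < +oo)%E by exact: lebesgue_rV_box_lty.
have C'fin : m C' \is a fin_num by rewrite ge0_fin_numE.
pose c := fine (m C); pose c' := fine (m C').
have cE : m C = c%:E by rewrite fineK// ge0_fin_numE// compact_lebesgue_lty.
have c'E : m C' = c'%:E by rewrite fineK.
have c'0 : 0 <= c' by exact: fine_ge0.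
pose B := L * (M + M + 1).
exists (B * c + 2 * L * te0 `^ (1 - alpha) * c') => f [fL fC].
have mf := lipschitz_measurable (conj fL fC).
have fB x : `|f x| <= B * \1_C x.
  rewrite indicE; have [Cx|nCx] := pselect (C x); last first.
    by rewrite fC// normr0 memNset// mulr0.
  rewrite mem_set// mulr1.
  (* A point outside [C], hence a zero of [f]; its norm is [M + 1] because the dimension is
     positive. *)
  pose y : 'rV[R]_n := const_mx (M + 1).
  have yM : `|y| = M + 1.
    apply/eqP; rewrite eq_le; apply/andP; split.
      by apply: norm_le_coord => [|i]; rewrite ?mxE ?ger0_norm// addr_ge0// ltW.
    by have := coord_le_norm y (Ordinal n0); rewrite mxE; apply: le_trans; exact: ler_norm.
  have nCy : ~ C y by move=> /hM; rewrite yM; lra.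
  have := fL x y; rewrite (fC y nCy) subr0 => /le_trans; apply.
  rewrite /B ler_wpM2l// (le_trans (ler_normB _ _))// yM addrA lerD2r// lerD2r.
  exact: hM.
have L1 : (L1norm f <= (B * c)%:E)%E.
  rewrite /L1norm EFinM -cE -[in leRHS](setIT C) -integral_indic//.
  have B0 : 0 <= B by rewrite mulr_ge0// !addr_ge0// ltW.
  rewrite -ge0_integralZl_EFin//; last first.
    exact/measurable_EFinP/measurable_indic.
  apply: ge0_le_integral => //.
  - by do 2 apply: measurableT_comp => //.
  - by apply/measurable_EFinP; apply: measurable_funM; [exact: measurable_cst|exact: measurable_indic].
  - by move=> x _; rewrite -EFinM lee_fin.
have osc2 x e : 0 < e <= te0 -> (osc f (eucl_ball x e) <= (2 * L * e * \1_C' x)%:E)%E.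
  move=> /andP[e0 et]; rewrite indicE; have [C'x|nC'x] := pselect (C' x).
    rewrite mem_set// mulr1; have -> : 2 * L * e = (f x + L * e) - (f x - L * e) by lra.
    apply: osc_le => y By; have := fL x y.
    have : `|x - y| <= e.
      apply: norm_le_coord => [|i]; first exact: ltW.
      by rewrite !mxE (le_trans (eucl_coord x y i))// ltW.
    move=> /(ler_wpM2l L0) h /le_trans /(_ h); rewrite ler_norml => /andP[h1 h2].
    by apply/andP; split; lra.
  rewrite memNset// mulr0; apply: le_trans (@osc_le _ _ _ _ 0 0 _) _; last by rewrite subr0.
  move=> y By.
  rewrite fC ?lexx// => Cy; apply: nC'x => i; rewrite !mxE.
  have := le_trans (coord_le_norm y i) (hM _ Cy).
  have := le_trans (eucl_coord x y i) (ltW (lt_le_trans By et)).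
  rewrite !ler_norml => /andP[h1 h2] /andP[h3 h4].
  by apply/andP; split; lra.
have var : (var_seminorm alpha te0 f <= (2 * L * te0 `^ (1 - alpha) * c')%:E)%E.
  apply: ge_ereal_sup => _ [e /= /andP[e0 et] <-].
  apply: (@le_trans _ _ ((e `^ (- alpha))%:E * ((2 * L * e)%:E * m C'))%E).
    apply: lee_wpmul2l; first by rewrite lee_fin powR_ge0.
    rewrite -[in leRHS](setIT C') -integral_indic// -ge0_integralZl_EFin//; last 2 first.
    - exact/measurable_EFinP/measurable_indic.
    - by rewrite !mulr_ge0// ltW.
    apply: ge0_le_integral_nomeas => x.
      by apply: osc_ge0; [exact: measurable_eucl_ball|exact: eucl_ball_gt0].
    by rewrite -EFinM; apply: osc2; rewrite e0.
  rewrite c'E -!EFinM lee_fin mulrA ler_wpM2r//.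
  have -> : e `^ (- alpha) * (2 * L * e) = 2 * L * (e `^ (- alpha) * e) by ring.
  rewrite -{2}[e]powRr1 ?(ltW e0)// -powRD; last first.
    by rewrite (gt_eqF e0) implybT.
  rewrite [- alpha + 1]addrC ler_wpM2l ?mulr_ge0//.
  by apply: ge0_ler_powR => //; rewrite ?nnegrE ?subr_ge0// ltW.
split; last by rewrite /Vnorm EFinD; exact: leeD.
split; last by apply: le_lt_trans var _; rewrite ltry.
split => //; apply/integrableP; split; first exact/measurable_EFinP.
by apply: le_lt_trans L1 _; rewrite ltry.
Qed.

End lipschitz_Valpha.

(** * Transfer operators *)

Section transport.
Local Open Scope ereal_scope.
Context d d' (T : measurableType d) (T' : measurableType d') (R : realType).
Variables (m : {measure set T -> \bar R}) (mu : {measure set T' -> \bar R}).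
Variables (D : set T) (psi : T -> T') (k : T' -> \bar R).
Hypotheses (mD : measurable D) (mpsi : measurable_fun D psi).
Hypotheses (mk : measurable_fun setT k) (k0 : forall y, 0 <= k y) (kfin : forall y, k y \is a fin_num).
Hypothesis H : forall A, measurable A -> m (D `&` psi @^-1` A) = \int[mu]_(y in A) k y.

Import HBNNSimple.

Let transport_indic (A : set T') : measurable A ->
  \int[m]_(x in D) (\1_A (psi x))%:E = \int[mu]_y (k y * (\1_A y)%:E).
Proof.
move=> mA; have mB : measurable (D `&` psi @^-1` A) by exact: mpsi.
transitivity (\int[m]_(x in D) (\1_(D `&` psi @^-1` A) x)%:E).
  apply: eq_integral => x; rewrite inE => Dx; congr _%:E; rewrite !indicE; congr (nat_of_bool _)%:R.
  by apply/idP/idP => /set_mem; [move=> Ax; apply/mem_set; split|move=> [_ ?]; exact/mem_set].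
rewrite integral_indic// setIAC setIid H// [LHS]integral_mkcond.
apply: eq_integral => y _; rewrite patchE indicE; case: ifP => _; rewrite ?mule1 ?mule0//.
Qed.

Let transport_nnsfun (h : {nnsfun T' >-> R}) :
  \int[m]_(x in D) (h (psi x))%:E = \int[mu]_y (k y * (h y)%:E).
Proof.
have mhc c : measurable (h @^-1` [set c]) by exact: measurable_sfunP.
have mi c : measurable_fun D (fun x => (\1_(h @^-1` [set c]) (psi x))%:E : \bar R).
  by apply/measurable_EFinP; apply: measurableT_comp => //; exact: measurable_indic.
transitivity (\sum_(c \in range h) (c%:E * \int[m]_(x in D) (\1_(h @^-1` [set c]) (psi x))%:E)).
  under eq_integral => x _ do rewrite (fimfunE h) -fsumEFin//.
  rewrite ge0_integral_fsum//; last 2 first.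
  - move=> c; under eq_fun do rewrite EFinM.
    by apply: measurable_funeM; exact: mi.
  - by move=> c x _; rewrite EFinM; exact: nnfun_muleindic_ge0.
  apply: eq_fsbigr => c /set_mem [y _ <-]; under eq_integral do rewrite EFinM.
  by rewrite ge0_integralZl_EFin// => x _; rewrite lee_fin.
transitivity (\sum_(c \in range h) (\int[mu]_y (k y * (c * \1_(h @^-1` [set c]) y)%:E))).
  apply: eq_fsbigr => c /set_mem [y _ <-]; rewrite transport_indic//.
  rewrite -ge0_integralZl_EFin//; last 2 first.
  - by move=> z _; rewrite mule_ge0// lee_fin.
  - by apply: emeasurable_funM => //; exact/measurable_EFinP/measurable_indic.
  by apply: eq_integral => z _; rewrite muleCA EFinM.
rewrite -ge0_integral_fsum//; last 2 first.
- move=> c; apply: emeasurable_funM => //; apply/measurable_EFinP.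
  by apply: measurable_funM; [exact: measurable_cst|exact: measurable_indic].
- by move=> c y _; rewrite mule_ge0// EFinM; exact: nnfun_muleindic_ge0.
apply: eq_integral => y _; rewrite (fimfunE h) -fsumEFin// ge0_mule_fsumr//.
by move=> c; rewrite EFinM; exact: nnfun_muleindic_ge0.
Qed.

(** From indicators to simple functions by linearity, then by monotone convergence; finiteness of
    [k] lets the limit pass through the product. *)
Lemma ge0_integral_transport (F : T' -> \bar R) : measurable_fun setT F ->
  (forall y, 0 <= F y) -> \int[m]_(x in D) F (psi x) = \int[mu]_y (k y * F y).
Proof.
move=> mF F0; pose F_ := nnsfun_approx measurableT mF.
have cF y : EFin \o F_^~ y @ \oo --> F y by apply: cvg_nnsfun_approx.
have ndF y a b : (a <= b)%N -> ((F_ a y)%:E <= (F_ b y)%:E).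
  by move=> ab; rewrite lee_fin; exact/lefP/nd_nnsfun_approx.
transitivity (limn (fun n => \int[m]_(x in D) (F_ n (psi x))%:E)).
  rewrite -monotone_convergence//.
  - by apply: eq_integral => x _; apply/esym/cvg_lim => //; exact: cF.
  - by move=> n; apply/measurable_EFinP; apply: measurableT_comp.
  - by move=> n x _; rewrite lee_fin.
  - by move=> x _ a b; exact: ndF.
under eq_fun do rewrite transport_nnsfun.
rewrite -monotone_convergence//.
- apply: eq_integral => y _; apply: cvg_lim => //.
  by apply: cvgeZl; [exact: kfin|exact: cF].
- by move=> n; apply: emeasurable_funM => //; exact/measurable_EFinP.
- by move=> n y _; rewrite mule_ge0// lee_fin.
- by move=> y _ a b ab; apply: lee_wpmul2l => //; exact: ndF.
Qed.

End transport.

Lemma norm_inv_of_mul1 {R : realType} (a b : R) : a * b = 1 -> `|b|^-1 = `|a|.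
Proof.
move=> ab; have b0 : `|b| != 0.
  by rewrite normr_eq0; apply/eqP => b0; move/eqP: ab; rewrite b0 mulr0 eq_sym oner_eq0.
by apply: (mulIf b0); rewrite mulVf// -normrM ab normr1.
Qed.

Lemma jacobian_near_eq {R : realType} {N : nat} (f g : 'rV[R]_N -> 'rV[R]_N) x : differentiable g x ->
  (\forall y \near x, f y = g y) -> 'J f x = 'J g x.
Proof.
move=> dg fg.
suff H : 'd f x = 'd g x :> ('rV[R]_N -> 'rV[R]_N).
  exact: (congr1 (fun h : 'rV[R]_N -> 'rV[R]_N => lin1_mx h) H).
apply: diff_unique; first exact: diff_continuous.
apply/eqaddoP => e e0; have /eqaddoP /(_ e e0) := diff_locally dg.
have := fg; rewrite [X in X -> _](near_shift 0) subr0 => fg0.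
apply: filterS2 fg0 => y fgy; rewrite !fctE /= (nbhs_singleton fg).
by move: fgy => /= ->.
Qed.

Section branch_integral.
Context {R : realType} {N : nat}.
Local Notation m := (@lebesgue_rV R N).
Variables (U V : set 'rV[R]_N) (T psi phi : 'rV[R]_N -> 'rV[R]_N) (f : 'rV[R]_N -> R).
Hypotheses (oU : open U) (UV : U `<=` V) (TU : forall x, U x -> T x = psi x).
Hypotheses (phiK : forall x, V x -> phi (psi x) = x).
Hypotheses (C1psi : C1_on V psi) (C1phi : C1_on (psi @` V) phi).
Hypotheses (mf : measurable_fun setT f) (f0 : forall x, 0 <= f x).

Let G := T @` U.
Let term y := `|\det ('J T (phi y))|^-1 * f (phi y) * \1_G y.
Let dpsi x : U x -> differentiable psi x.
Proof. by have [_ dV] := C1psi => /UV/dV[]. Qed.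
(** Describing the image through the inverse branch shows that it is open. *)
Let GE : G = (psi @` V) `&` phi @^-1` U.
Proof.
apply/seteqP; split => [_ [x Ux <-]|_ [[x Vx <-] /=]].
  rewrite TU//; split; first by exists x => //; exact: UV.
  by rewrite /= phiK//; exact: UV.
by rewrite phiK// => Ux; exists x => //; rewrite TU.
Qed.
Let GV : G `<=` psi @` V. Proof. by rewrite GE => y []. Qed.
Let dphi y : G y -> differentiable phi y.
Proof. by have [_ dV] := C1phi => /GV/dV[]. Qed.
Let cphi y : G y -> {for y, continuous (fun y => 'J phi y)}.
Proof. by have [_ dV] := C1phi => /GV/dV[]. Qed.
Let oG : open G.
Proof.
rewrite GE; have [oV dV] := C1phi.
apply: (open_setI_preimage oV _ oU) => y /dV[dy _]; exact: differentiable_continuous.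
Qed.
Let psiU x : U x -> G (psi x).
Proof. by move=> Ux; exists x => //; exact: TU. Qed.
Let psiK x : U x -> phi (psi x) = x. Proof. by move=> /UV; exact: phiK. Qed.
Let phiG y : G y -> U (phi y). Proof. by rewrite GE => -[]. Qed.
Let phiGK y : G y -> psi (phi y) = y.
Proof. by move=> [x Ux <-]; rewrite TU// psiK. Qed.

Let jac y := `|\det ('J phi y)|.

(** The weight [|\det DT|^-1] at [phi y] is the Jacobian of the inverse branch at [y]: [T] coincides
    with [psi] near [phi y], and the Jacobian matrices of [psi] and [phi] are inverse to each
    other. *)
Let termE y : G y -> term y = jac y * f (phi y).
Proof.
move=> Gy; rewrite /term indicE mem_set// mulr1; congr (_ * _).
have -> : 'J T (phi y) = 'J (psi) (phi y).
  apply: jacobian_near_eq; first by apply: dpsi; exact: phiG.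
  have : nbhs (phi y) (U) by apply: open_nbhs_nbhs; split => //; exact: phiG.
  by apply: filterS => z; exact: TU.
apply: norm_inv_of_mul1; rewrite -det_mulmx.
by rewrite (cv_jacobian oG phiG phiGK dpsi dphi Gy) det1.
Qed.

Let mG : measurable G. Proof. exact: open_rV_measurable. Qed.
Let mjac : measurable_fun G jac. Proof. exact: (measurable_jac oG cphi). Qed.
Let mfphi : measurable_fun G (fun y => f (phi y)).
Proof.
apply: measurableT_comp => //; apply: open_continuous_measurable_rV => // y Gy.
by apply: differentiable_continuous; exact: dphi.
Qed.

Lemma measurable_term : measurable_fun setT (fun y => (term y)%:E).
Proof.
apply/measurable_EFinP.
rewrite (_ : term = (fun y => jac y * f (phi y)) \_ G).
  by apply/(measurable_restrictT _ mG); exact: measurable_funM.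
apply/funext => y; rewrite patchE; case: ifPn => [/set_mem|/negP nG]; first exact: termE.
by rewrite /term indicE memNset ?mulr0// => /mem_set.
Qed.

Lemma integral_term E : measurable E ->
  (\int[m]_(y in E) (term y)%:E = \int[m]_(x in U `&` psi @^-1` E) (f x)%:E)%E.
Proof.
move=> mE.
pose k := (EFin \o jac) \_ G.
have k0 y : (0 <= k y)%E.
  by rewrite /k patchE; case: ifP => // _; rewrite lee_fin normr_ge0.
have kfin y : k y \is a fin_num.
  by rewrite /k patchE; case: ifP => _; rewrite /= /point /= ?fin_numE.
have mk : measurable_fun setT k.
  by apply/(measurable_restrictT _ mG)/measurable_EFinP.
pose F := (fun y => (f (phi y))%:E) \_ (G `&` E).
have F0 y : (0 <= F y)%E by rewrite /F patchE; case: ifP => // _; rewrite lee_fin.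
have mF : measurable_fun setT F.
  apply/(measurable_restrictT _ (measurableI _ _ mG mE))/measurable_EFinP.
  by apply: measurable_funS mfphi => // y [].
have mU : measurable (U) by exact: open_rV_measurable.
have mb : measurable_fun (U) (psi).
  by apply: open_continuous_measurable_rV => // x Ux; apply: differentiable_continuous; exact: dpsi.
have H A : measurable A -> (m (U `&` psi @^-1` A) = \int[m]_(y in A) k y)%E.
  move=> mA; rewrite (change_of_variables oU oG psiU psiK phiG phiGK dpsi dphi cphi)//.
  by rewrite setIC integral_mkcondr.
have := ge0_integral_transport mU mb mk k0 kfin H mF F0.
rewrite [LHS]integral_mkcond => h; rewrite [LHS]integral_mkcond [RHS]integral_mkcond.
transitivity (\int[m]_y (k y * F y))%E.
  apply: eq_integral => y _; rewrite /k /F !patchE in_setI.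
  case: (boolP (y \in E)) => /=; case: (boolP (y \in G)) => [/set_mem Gy|/negP nG] _ /=.
  - by rewrite termE// EFinM.
  - by rewrite mul0e /term indicE memNset ?mulr0// => /mem_set.
  - by rewrite mule0.
  - by rewrite mul0e.
rewrite -h; apply: eq_integral => x _; rewrite /F !patchE.
case: (boolP (x \in U)) => [/set_mem Ux|/negP nU]; last first.
  by rewrite memNset// => -[/mem_set].
case: (boolP (_ \in G `&` E)) => [/set_mem [Gx Ex]|/negP nE].
  by rewrite mem_set// psiK.
rewrite memNset// => -[_ Ex]; apply: nE; apply/mem_set; split => //; exact: psiU.
Qed.

End branch_integral.

Section transfer_duality.
Context {R : realType} {N : nat} {Omega : ptopologicalType}.
Variables (X : saussol_data R N Omega) (w : Omega).
Local Notation m := (@lebesgue_rV R N).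
Local Notation C := (sC X).
Local Notation T := (sT X w).
Local Notation I := (sI X w).
Local Notation U := (sU X w).
Local Notation V := (sV X w).
Local Notation branch := (sbranch X w).
Local Notation phi := (branch_inv X w).

(** What the duality of the transfer operator asks of a single fiber; almost every fiber has these
    properties. *)
Definition good_fiber :=
  [/\ forall i, I i -> {in U i, T =1 branch i},
     forall i, I i -> [/\ C1_on (V i) (branch i), {in V i &, injective (branch i)} &
         C1_on (branch i @` V i) (phi i)],
     m (C `\` \bigcup_(i in I) U i) = 0%E,
     trivIset I U &
     forall i, I i -> [/\ open (U i), U i `<=` C & U i `<=` V i]].

Hypothesis good : good_fiber.

Lemma transfer_ge0 f : (forall x, 0 <= f x) -> forall y, 0 <= transfer X w f y.
Proof.
move=> f0 y; rewrite /transfer fine_ge0// nneseries_ge0// => i _ _.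
by rewrite lee_fin !mulr_ge0// invr_ge0.
Qed.

Variables (f : 'rV[R]_N -> R).
Hypotheses (mf : measurable_fun setT f) (f0 : forall x, 0 <= f x).

Let term i y := `|\det ('J T (phi i y))|^-1 * f (phi i y) * \1_(T @` U i) y.

Let branch_facts i : I i -> [/\ open (U i), U i `<=` V i, forall x, U i x -> T x = branch i x,
  forall x, V i x -> phi i (branch i x) = x &
  C1_on (V i) (branch i) /\ C1_on (branch i @` V i) (phi i)].
Proof.
move=> Ii; have [TU C1 _ _ oU] := good; have [c1 inj c2] := C1 _ Ii; have [u1 u2 u3] := oU _ Ii.
split => // x Ux; first by apply: TU => //; exact/mem_set.
by rewrite /branch_inv pinvKV//; exact/mem_set.
Qed.

Let measurable_term_i i : I i -> measurable_fun setT (fun y => (term i y)%:E).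
Proof.
move=> /branch_facts [oU UV TU phiK [c1 c2]].
exact: (measurable_term oU UV TU phiK c1 c2 mf).
Qed.

Let integral_term_i i E : I i -> measurable E ->
  (\int[m]_(y in E) (term i y)%:E = \int[m]_(x in U i `&` branch i @^-1` E) (f x)%:E)%E.
Proof.
move=> /branch_facts [oU UV TU phiK [c1 c2]].
exact: (integral_term oU UV TU phiK c1 c2 mf f0).
Qed.

(** Each branch contributes the integral of [f] over its own piece of the preimage of [E]. The
    pieces are disjoint and exhaust the preimage up to the null set missed by the branch domains. *)
Lemma transfer_dual E : measurable E -> measurable_fun C T -> measurable C ->
  m.-integrable setT (EFin \o f) ->
  (\int[m]_(y in E) (transfer X w f y)%:E = \int[m]_(x in C `&` T @^-1` E) (f x)%:E)%E.
Proof.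
move=> mE mT mC intf.
have [_ _ null triv UVC] := good.
pose a i y : \bar R := (if i \in I then (term i y)%:E else 0)%E.
have a0 i y : (0 <= a i y)%E.
  by rewrite /a; case: ifP => // _; rewrite lee_fin !mulr_ge0// invr_ge0.
have ma i : measurable_fun setT (a i).
  rewrite /a; case: (boolP (i \in I)) => [/set_mem Ii|_]; last exact: measurable_cst.
  exact: measurable_term_i.
have trE y : transfer X w f y = fine (\sum_(0 <= i <oo) a i y)%E.
  by rewrite /transfer eseries_mkcond.
pose B i := if i \in I then U i `&` T @^-1` E else set0.
have mU i : I i -> measurable (U i) by move=> /UVC[oU _ _]; exact: open_rV_measurable.
have mB i : measurable (B i).
  rewrite /B; case: (boolP (i \in I)) => [/set_mem Ii|_]; last exact: measurable0.
  have [_ UC _] := UVC _ Ii.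
  rewrite (_ : U i `&` _ = U i `&` (C `&` T @^-1` E)); first by apply: measurableI; [exact: mU|exact: mT].
  by rewrite setIA; congr (_ `&` _); apply/esym/setIidPl.
have tB : trivIset setT B.
  move=> i j _ _ [x []]; rewrite /B; case: (boolP (i \in I)) => [/set_mem Ii|_] //.
  case: (boolP (j \in I)) => [/set_mem Ij|_] // [Ux _] [Ux' _].
  by apply: triv => //; exists x.
have intB i D : measurable D -> (\int[m]_(y in E `&` D) a i y =
    \int[m]_(x in B i `&` T @^-1` D) (f x)%:E)%E.
  move=> mD; rewrite /a /B; case: (boolP (i \in I)) => [/set_mem Ii|_]; last first.
    by rewrite set0I integral_set0 integral0.
  rewrite integral_term_i//; last exact: measurableI.
  have [_ _ TUi _ _] := branch_facts Ii.
  congr (integral _ _ _); apply/seteqP; split => [x [Ux [/= Ex Dx]]|x [[Ux /= Ex] /= Dx]].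
    by rewrite /= TUi.
  by split => //=; rewrite -TUi.
have sumE D : measurable D -> (\int[m]_(y in E `&` D) \sum_(0 <= i <oo) a i y =
    \int[m]_(x in C `&` T @^-1` (E `&` D)) (f x)%:E)%E.
  move=> mD; rewrite integral_nneseries//; last 2 first.
  - exact: measurableI.
  - by move=> i; exact: measurable_funTS.
  have mBD i : measurable (B i `&` T @^-1` D).
    rewrite (_ : B i `&` _ = B i `&` (C `&` T @^-1` D)); first by apply: measurableI; [exact: mB|exact: mT].
    rewrite setIA; congr (_ `&` _); apply/esym/setIidPl; rewrite /B.
    by case: (boolP (i \in I)) => [/set_mem/UVC[_ UC _] x [Ux _]|_ x []]; exact: UC.
  under eq_eseriesr do rewrite intB//.
  rewrite -ge0_integral_bigcup//; last 3 first.
  - by apply/measurable_EFinP; exact: measurable_funTS.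
  - by move=> x _; rewrite lee_fin.
  - exact: trivIset_setIr.
  have mU' : measurable (\bigcup_(i in I) U i) by apply: bigcup_measurable => i; exact: mU.
  have mCT : measurable (C `&` T @^-1` (E `&` D)) by apply: mT => //; exact: measurableI.
  have mBDU : measurable (\bigcup_i (B i `&` T @^-1` D)) by exact: bigcup_measurable.
  rewrite [LHS]integral_mkcond [RHS]integral_mkcond; apply: ae_eq_integral => //.
  - by apply/(measurable_restrictT _ mBDU)/measurable_EFinP; exact: measurable_funTS.
  - by apply/(measurable_restrictT _ mCT)/measurable_EFinP; exact: measurable_funTS.
  exists (C `\` \bigcup_(i in I) U i); split => //; first exact: measurableD.
  move=> x /= hx; apply: contrapT => nx; apply: hx => _; rewrite !patchE.
  have [[Cx [Ex Dx]]|nC] := pselect ((C `&` T @^-1` (E `&` D)) x).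
    have [i Ii Ux] : (\bigcup_(i in I) U i) x by apply: contrapT => nU; exact: nx.
    rewrite !mem_set//; exists i => //; split => //; rewrite /B mem_set//.
  rewrite !memNset// => -[i _ [Bx Dx]]; apply: nC; split; last first.
    by split => //; move: Bx; rewrite /B; case: ifP => // _ [].
  by move: Bx; rewrite /B; case: (boolP (i \in I)) => [/set_mem/UVC[_ UC _] [Ux _]|_ []]; exact: UC.
have mS : measurable_fun setT (fun y => \sum_(0 <= i <oo) a i y)%E.
  by apply: ge0_emeasurable_sum.
have S0 y : (0 <= \sum_(0 <= i <oo) a i y)%E by apply: nneseries_ge0.
have := sumE setT measurableT; rewrite setIT => SE.
have mCT : measurable (C `&` T @^-1` E) by exact: mT.
(* The series has a finite integral, so it is finite almost everywhere, and there [fine] in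
   [transfer] changes nothing. *)
have intS : m.-integrable E (fun y => \sum_(0 <= i <oo) a i y)%E.
  apply/integrableP; split; first exact: measurable_funTS.
  under eq_integral do rewrite gee0_abs//.
  rewrite SE; have /integrableP[_] := intf; apply: le_lt_trans.
  under [leRHS]eq_integral do rewrite gee0_abs ?lee_fin//.
  by apply: ge0_subset_integral => //; [exact/measurable_EFinP|move=> x _; rewrite lee_fin].
rewrite -SE; apply: ae_eq_integral => //.
- apply/measurable_EFinP.
  have -> : transfer X w f = (fun y => fine (\sum_(0 <= i <oo) a i y)%E) by exact/funext.
  by apply: measurable_funTS; exact: measurableT_comp.
- exact: measurable_funTS.
apply: filterS (integrable_ae mE intS) => y /= + Ey => /(_ Ey) fin.
by rewrite trE fineK.
Qed.

End transfer_duality.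

(** * Mutual singularity of ergodic measures *)

Section invariant_sets.
Local Open Scope ereal_scope.
Context d (T : measurableType d) (R : realType).
Variables (D : set T) (F : T -> T).
Hypotheses (mD : measurable D) (mF : measurable_fun D F).

Let Fi (A : set T) := D `&` F @^-1` A.

Let mFi A : measurable A -> measurable (Fi A). Proof. by move=> mA; exact: mF. Qed.

(* The limsup of the iterated preimages of [E] is strictly invariant. *)
Lemma ergodic_ae_invariant (mu : probability T R) E : preserves mu D F -> ergodic mu D F ->
  measurable E -> E `<=` D -> mu (E `\` Fi E) = 0 -> mu (Fi E `\` E) = 0 ->
  mu E = 0 \/ mu E = 1.
Proof.
move=> pmu emu mE ED n1 n2.
have muFi A : measurable A -> mu (Fi A) = mu A by move=> mA; exact: pmu.
pose Ek k := iter k Fi E.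
have mEk k : measurable (Ek k) by elim: k => //= k IH; exact: mFi.
have EkD k : Ek k `<=` D by case: k => //= k x [].
have muD0 A B : measurable A -> measurable B -> A `<=` B -> mu B = 0 -> mu A = 0.
  by move=> mA mB AB B0; apply/eqP; rewrite -measure_le0 -B0 le_measure// inE.
have muU0 A B : measurable A -> measurable B -> mu A = 0 -> mu B = 0 -> mu (A `|` B) = 0.
  move=> mA mB A0 B0; apply/eqP; rewrite -measure_le0.
  have h : mu (A `|` B) <= mu A + mu B by exact: measureU2.
  by rewrite A0 B0 adde0 in h.
have nk1 k : mu (E `\` Ek k) = 0.
  elim: k => [|k IH]; first by rewrite /Ek /= setDv measure0.
  apply: (@muD0 _ ((E `\` Fi E) `|` Fi (E `\` Ek k))).
  - exact: measurableD.
  - by apply: measurableU; [apply: measurableD => //; exact: mFi|apply: mFi; exact: measurableD].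
  - move=> x [Ex nx]; have [[Dx Fx]|nF] := pselect (Fi E x); last by left.
    by right; split => //; split => // EFx; apply: nx; split.
  - apply: muU0 => //; first by apply: measurableD => //; exact: mFi.
      by apply: mFi; exact: measurableD.
    by rewrite muFi//; exact: measurableD.
have nk2 k : mu (Ek k `\` E) = 0.
  elim: k => [|k IH]; first by rewrite /Ek /= setDv measure0.
  apply: (@muD0 _ ((Fi E `\` E) `|` Fi (Ek k `\` E))).
  - by apply: measurableD.
  - by apply: measurableU; [apply: measurableD => //; exact: mFi|apply: mFi; exact: measurableD].
  - move=> x [[Dx Ex] nx]; have [EF|nF] := pselect (E (F x)); first by left; split.
    by right; split.
  - apply: muU0 => //; first by apply: measurableD => //; exact: mFi.
      by apply: mFi; exact: measurableD.
    by rewrite muFi//; exact: measurableD.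
pose E' := \bigcap_n \bigcup_k Ek (n + k)%N.
have mE' : measurable E' by apply: bigcapT_measurable => n; exact: bigcup_measurable.
have E'D : E' `<=` D by move=> x /(_ 0%N I) [k _ /EkD].
have E'inv : D `&` F @^-1` E' = E'.
  apply/seteqP; split => [x [Dx Fx] n _|x E'x].
    by have [k _ Ekx] := Fx n I; exists k.+1 => //; rewrite addnS; split.
  split; first exact: E'D.
  by move=> n _; have [k _] := E'x n.+1 I; rewrite addSn => -[_ h]; exists k.
have bc0 (A : nat -> set T) : (forall k, measurable (A k)) -> (forall k, mu (A k) = 0) ->
    mu (\bigcup_k A k) = 0.
  move=> mA A0; apply: measure_negligible; first exact: bigcup_measurable.
  by apply: negligible_bigcup => k; exists (A k); split; [exact: mA|exact: A0|].
have e1 : mu (E `\` E') = 0.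
  apply: (@muD0 _ (\bigcup_k (E `\` Ek k))) => //; [exact: measurableD| | |].
  - by apply: bigcup_measurable => k _; exact: measurableD.
  - move=> x [Ex nE']; apply: contrapT => h; apply: nE' => n _; exists 0%N => //.
    by apply: contrapT => hk; apply: h; exists (n + 0)%N.
  - by apply: bc0 => // k; exact: measurableD.
have e2 : mu (E' `\` E) = 0.
  apply: (@muD0 _ (\bigcup_k (Ek k `\` E))) => //; [exact: measurableD| | |].
  - by apply: bigcup_measurable => k _; exact: measurableD.
  - by move=> x [/(_ 0%N I) [k _ Ekx] nE]; exists k.
  - by apply: bc0 => // k; exact: measurableD.
have : mu E = mu E'.
  have d1 : mu E = mu (E `\` E') + mu (E `&` E') by exact: measureDI.
  have d2 : mu E' = mu (E' `\` E) + mu (E' `&` E) by exact: measureDI.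
  by rewrite d1 d2 e1 e2 setIC.
by move=> ->; exact: emu.
Qed.

Variables (rho : {measure set T -> \bar R}).

Lemma integral_lt_null (h1 h2 : T -> R) A : measurable A ->
  measurable_fun setT h1 -> measurable_fun setT h2 ->
  (forall x, 0 <= h2 x)%R -> (forall x, A x -> h2 x < h1 x)%R ->
  \int[rho]_(x in A) (h2 x)%:E < +oo ->
  \int[rho]_(x in A) (h1 x)%:E <= \int[rho]_(x in A) (h2 x)%:E -> rho A = 0.
Proof.
move=> mA m1 m2 h20 h21 fin le.
have mB : measurable_fun A (fun x => (h1 x - h2 x)%:E).
  by apply/measurable_EFinP; apply: measurable_funTS; exact: measurable_funB.
have E : \int[rho]_(x in A) (h1 x)%:E =
    \int[rho]_(x in A) (h2 x)%:E + \int[rho]_(x in A) (h1 x - h2 x)%:E.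
  rewrite -ge0_integralD//.
  - by apply: eq_integral => x _; rewrite -EFinD addrC subrK.
  - by move=> x _; rewrite lee_fin.
  - by apply/measurable_EFinP; exact: measurable_funTS.
  - by move=> x /h21; rewrite lee_fin subr_ge0 => /ltW.
have int0 : \int[rho]_(x in A) (h1 x - h2 x)%:E = 0.
  apply/eqP; rewrite eq_le integral_ge0 ?andbT; last first.
    by move=> x /h21; rewrite lee_fin subr_ge0 => /ltW.
  have f2 : \int[rho]_(x in A) (h2 x)%:E \is a fin_num.
    by rewrite ge0_fin_numE// integral_ge0// => x _; rewrite lee_fin.
  by move: le; rewrite E -[leRHS]adde0 leeD2lE.
have /ae_eq_integral_abs : \int[rho]_(x in A) `|(h1 x - h2 x)%:E| = 0.
  rewrite -[RHS]int0; apply: eq_integral => x; rewrite inE => /h21 h.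
  by rewrite gee0_abs// lee_fin subr_ge0 ltW.
move=> /(_ mA mB) [N [mN N0 hN]]; apply: measure_negligible => //.
exists N; split => // x Ax; apply: hN => /= /(_ Ax) [] /eqP.
by rewrite subr_eq0 => /eqP e; have := h21 _ Ax; rewrite e ltxx.
Qed.

Lemma integral0_ae (h : T -> R) A : measurable A -> measurable_fun setT h ->
  (forall x, 0 <= h x)%R -> \int[rho]_(x in A) (h x)%:E = 0 ->
  \forall x \ae rho, A x -> h x = 0%R.
Proof.
move=> mA mh h0 int0.
have mhA : measurable_fun A (EFin \o h) by apply/measurable_EFinP; exact: measurable_funTS.
have /(ae_eq_integral_abs rho mA mhA) : \int[rho]_(x in A) `|(EFin \o h) x| = 0.
  by rewrite -[RHS]int0; apply: eq_integral => x _; rewrite gee0_abs// lee_fin.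
by apply: filterS => x h' Ax; have [] := h' Ax.
Qed.

Variables (mu1 mu2 : probability T R) (h1 h2 : T -> R).
Hypotheses (mh1 : measurable_fun setT h1) (mh2 : measurable_fun setT h2).
Hypotheses (h10 : forall x, (0 <= h1 x)%R) (h20 : forall x, (0 <= h2 x)%R).
Hypotheses (mu1E : forall A, measurable A -> mu1 A = \int[rho]_(x in A) (h1 x)%:E)
  (mu2E : forall A, measurable A -> mu2 A = \int[rho]_(x in A) (h2 x)%:E).
Hypotheses (p1 : preserves mu1 D F) (p2 : preserves mu2 D F)
  (e1 : ergodic mu1 D F) (e2 : ergodic mu2 D F).

(* The set [h2 < h1] is invariant up to null sets: the mass [mu1] and [mu2] lose and
   gain on it are equal, while [mu1 <= mu2] off it. *)
Lemma ergodic_eq_or_singular : {in measurable, mu1 =1 mu2} \/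
  \forall x \ae rho, h1 x = 0%R \/ h2 x = 0%R.
Proof.
pose E := D `&` [set x | (h2 x < h1 x)%R].
have mE : measurable E by apply: measurableI => //; exact: measurable_lt_set.
have ED : E `<=` D by move=> x [].
have mFE := mFi mE.
pose a := E `\` Fi E; pose b := Fi E `\` E.
have ma : measurable a by exact: measurableD.
have mb : measurable b by exact: measurableD.
have ab (mu : probability T R) : preserves mu D F -> mu a = mu b.
  have d1 : mu E = mu a + mu (E `&` Fi E) by exact: measureDI.
  have d2 : mu (Fi E) = mu b + mu (E `&` Fi E) by rewrite [E `&` _]setIC; exact: measureDI.
  move=> p; have := p E mE; rewrite -/(Fi E) d1 d2 => /eqP.
  have fin : mu (E `&` Fi E) \is a fin_num by rewrite fin_num_measure//; exact: measurableI.
  by move: fin; case: (mu (E `&` Fi E)) => [r| |]// _; case: (mu a) (mu b) => [x| |] [y| |]//;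
    rewrite -!EFinD eqe => /eqP h; congr _%:E; lra.
have le_b : mu1 b <= mu2 b.
  rewrite mu1E// mu2E//; apply: ge0_le_integral => //.
  - by move=> x _; rewrite lee_fin.
  - by apply/measurable_EFinP; exact: measurable_funTS.
  - by apply/measurable_EFinP; exact: measurable_funTS.
  - move=> x [[Dx _] nE]; rewrite lee_fin leNgt; apply/negP => h; exact: nE.
have oo2 A : measurable A -> \int[rho]_(x in A) (h2 x)%:E < +oo.
  by move=> mA; rewrite -mu2E// ltey_eq fin_num_measure.
(* On [a], a part of [E], the density of [mu1] is strictly larger, and yet
   [mu1 a = mu1 b <= mu2 b = mu2 a]. *)
have rhoa : rho a = 0.
  apply: (@integral_lt_null h1 h2) => //.
  - by move=> x [[]].
  - exact: oo2.
  by rewrite -mu1E// -mu2E// (ab mu1 p1) (ab mu2 p2).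
have null0 (h : T -> R) A : measurable A -> measurable_fun setT h -> rho A = 0 ->
    \int[rho]_(x in A) (h x)%:E = 0.
  by move=> mA mh A0; apply: null_set_integral => //; apply/measurable_EFinP; exact: measurable_funTS.
have a1 : mu1 a = 0 by rewrite mu1E// null0.
have a2 : mu2 a = 0 by rewrite mu2E// null0.
have b1 : mu1 b = 0 by rewrite -(ab mu1 p1).
have b2 : mu2 b = 0 by rewrite -(ab mu2 p2).
have D1 (mu : probability T R) : preserves mu D F -> mu (~` D) = 0.
  move=> p; have := p setT measurableT; rewrite preimage_setT setIT probability_setT => D1.
  by rewrite probability_setC// D1 subee.
(* If [mu1 E = 0], then [mu1 <= mu2] everywhere, and two probabilities in this order are equal. If
   [E] has full measure for [mu1] and measure 0 for [mu2], they are singular. Full measure for both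
   would contradict [h2 < h1] on [E]. *)
have [E1|E1] := ergodic_ae_invariant p1 e1 mE ED a1 b1.
- left.
  have rE : rho E = 0.
    apply: (@integral_lt_null h1 h2) => //; first by move=> x [].
      exact: oo2.
    by rewrite -mu1E// E1 integral_ge0// => x _; rewrite lee_fin.
  have le A : measurable A -> mu1 A <= mu2 A.
    move=> mA; rewrite mu1E// mu2E//; apply: ae_ge0_le_integral => //.
    - by move=> x _; rewrite lee_fin.
    - by apply/measurable_EFinP; exact: measurable_funTS.
    - by move=> x _; rewrite lee_fin.
    - by apply/measurable_EFinP; exact: measurable_funTS.
    have mDc : measurable (~` D) by exact: measurableC.
    have := integral0_ae mDc mh1 h10; rewrite -mu1E// => /(_ (D1 mu1 p1)).
    have nE : \forall x \ae rho, ~ E x.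
      by apply/negligibleS; last (apply/(negligibleP _ mE); exact: rE); move=> x /= /contrapT.
    apply: filterS2 nE => x nE hD _; rewrite lee_fin.
    have [Dx|nDx] := pselect (D x); last by rewrite hD.
    by rewrite leNgt; apply/negP => h; exact: nE.
  move=> A; rewrite inE => mA; apply/eqP; rewrite eq_le le//=.
  have := le _ (measurableC mA); rewrite !probability_setC//.
  have f1 : mu1 A \is a fin_num by exact: fin_num_measure.
  have f2 : mu2 A \is a fin_num by exact: fin_num_measure.
  by rewrite -(fineK f1) -(fineK f2) -!EFinB !lee_fin; lra.
- have [E2|E2] := ergodic_ae_invariant p2 e2 mE ED a2 b2.
  + right.
    have mEc : measurable (~` E) by exact: measurableC.
    have := integral0_ae mEc mh1 h10; rewrite -mu1E// probability_setC// E1 subee// => /(_ erefl).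
    have := integral0_ae mE mh2 h20; rewrite -mu2E// E2 => /(_ erefl).
    apply: filterS2 => x hE hEc; have [Ex|nEx] := pselect (E x); first by right; exact: hE.
    by left; exact: hEc.
  + exfalso; have rE : rho E = 0.
      apply: (@integral_lt_null h1 h2) => //; first by move=> x [].
        exact: oo2.
      by rewrite -mu1E// -mu2E// E1 E2.
    by move: E1; rewrite mu1E// null0// => /eqP; rewrite eqe eq_sym oner_eq0.
Qed.

End invariant_sets.

(** * Fibers of invariant densities *)

Lemma ae_mono d (T : measurableType d) (R : realType) (mu : {measure set T -> \bar R})
    (Q1 Q2 : T -> Prop) : (forall x, Q1 x -> Q2 x) ->
  (\forall x \ae mu, Q1 x) -> \forall x \ae mu, Q2 x.
Proof. by move=> Q12; apply: negligibleS => x /= nQ2 /Q12. Qed.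

Lemma ae_and d (T : measurableType d) (R : realType) (mu : {measure set T -> \bar R})
    (Q1 Q2 : T -> Prop) : (\forall x \ae mu, Q1 x) -> (\forall x \ae mu, Q2 x) ->
  \forall x \ae mu, Q1 x /\ Q2 x.
Proof. by move=> h1 h2; apply: filterI. Qed.

Section fibers.
Context {R : realType} {N : nat} {Omega : ptopologicalType}.
Variables (P : probability (borel Omega) R) (X : saussol_data R N Omega)
  (sigma sigmaV : Omega -> Omega).
Local Notation m := (@lebesgue_rV R N).
Local Notation C := (sC X).
Local Notation T := (sT X).
Local Notation bO := (borel Omega).
Local Notation phase := ([set: bO] `*` C).
Hypothesis base : @invertible_ergodic _ (borel Omega) R P sigma sigmaV.
Hypothesis mC : measurable C.
Hypothesis mskew : measurable_fun phase (skew_product X sigma).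
Local Open Scope ereal_scope.

Let msigma : measurable_fun [set: bO] (sigma : bO -> bO).
Proof. by have [_ []] := base. Qed.

Let msigmaV : measurable_fun [set: bO] (sigmaV : bO -> bO).
Proof. by have [_ []] := base. Qed.

Let sigmaK : cancel sigma sigmaV. Proof. by have [[]] := base. Qed.
Let sigmaVK : cancel sigmaV sigma. Proof. by have [[]] := base. Qed.

Lemma sigma_preserves (A : set bO) : measurable A -> P ((sigma : bO -> bO) @^-1` A) = P A.
Proof. by move=> mA; have [_ _ /(_ A mA) <- _] := base; rewrite setTI. Qed.

Lemma sigmaV_preserves (A : set bO) : measurable A -> P ((sigmaV : bO -> bO) @^-1` A) = P A.
Proof.
move=> mA; rewrite -(@sigma_preserves ((sigmaV : bO -> bO) @^-1` A)).
  by congr (P _); apply/seteqP; split => w /=; rewrite sigmaK.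
by rewrite -[X in measurable X]setTI; exact: msigmaV.
Qed.

Lemma ae_sigmaV (Q : bO -> Prop) : (\forall w \ae P, Q w) -> \forall w \ae P, Q (sigmaV w).
Proof.
move=> [A [mA A0 QA]]; exists ((sigmaV : bO -> bO) @^-1` A); split.
- by rewrite -[X in measurable X]setTI; exact: msigmaV.
- by rewrite sigmaV_preserves.
- by move=> w /= nQ; apply: QA.
Qed.

Lemma ae_orbit (Q : bO -> Prop) : (\forall w \ae P, Q w) ->
  \forall w \ae P, forall j, Q (iter j sigmaV w).
Proof.
move=> Qw; apply: ae_foralln => j; elim: j => [|j IH]; first exact: Qw.
apply: ae_mono (ae_sigmaV IH) => w.
by rewrite -iterSr iterS.
Qed.

Lemma int_sigmaV (F : bO -> \bar R) : measurable_fun setT F -> (forall w, 0 <= F w) ->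
  \int[P]_w F (sigmaV w) = \int[P]_w F w.
Proof.
move=> mF F0.
have := @ge0_integral_transport _ _ bO bO R P P setT (sigmaV : bO -> bO) (cst 1)
  measurableT msigmaV (measurable_cst _) _ _ _ F mF F0.
move=> ->//; first by apply: eq_integral => w _; rewrite mul1e.
by move=> A mA; rewrite setTI integral_cst// mul1e; exact: sigmaV_preserves.
Qed.

Lemma int_sigma (F : bO -> \bar R) : measurable_fun setT F -> (forall w, 0 <= F w) ->
  \int[P]_w F (sigma w) = \int[P]_w F w.
Proof.
move=> mF F0; rewrite -[LHS]int_sigmaV//.
- by apply: eq_integral => w _; rewrite sigmaVK.
- exact: (measurableT_comp mF msigma).
Qed.

Local Notation Pm := (P \x leb N).

Lemma prod_leb_sigma_finite : sigma_finite setT Pm.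
Proof.
exists (fun k => setT `*` rbox (const_mx (- k%:R), const_mx k%:R)%R).
  apply/seteqP; split => // -[w x] _.
  have [k _ kx] : (\bigcup_k rbox (const_mx (- k%:R), const_mx k%:R)%R) x by rewrite box_cover.
  by exists k.
move=> k; have mk : measurable (@rbox R N (const_mx (- k%:R), const_mx k%:R)%R).
  exact: measurable_rV_box.
split; first exact: measurableX.
set b := rbox _ in mk *; have -> : Pm (setT `*` b) = P setT * leb N b by exact: product_measure1E.
rewrite probability_setT mul1e; exact: lebesgue_rV_box_lty.
Qed.

(** Almost all sections of a null set are null, hence null for the kernel, so [mu] is absolutely
    continuous with respect to the product. A joint density is measurable in both variables
    together, which a choice of density in each fiber would not guarantee. *)
Lemma acip_density (mu : probability (bO * 'rV[R]_N)%type R) : skew_acip P X sigma mu ->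
  exists H : bO * 'rV[R]_N -> R, [/\ measurable_fun setT H, forall p, (0 <= H p)%R &
    forall A, measurable A -> mu A = \int[Pm]_(p in A) (H p)%:E].
Proof.
move=> [_ [k [_ km muk]]].
have dom : mu `<< Pm.
  apply/null_content_dominatesP => A mA A0; rewrite muk//.
  have mx : measurable_fun setT (fun w : bO => leb N (xsection A w)).
    exact: (measurable_fun_xsection (leb N) mA).
  have /ae_eq_integral_abs : \int[P]_w `|leb N (xsection A w)| = 0.
    by rewrite -[RHS]A0; apply: eq_integral => w _; rewrite gee0_abs.
  move=> /(_ measurableT mx) h.
  rewrite (@ae_eq_integral _ _ _ P setT (cst 0))//; first by rewrite integral_cst// mul0e.
    by apply: measurable_fun_xsection_finite_kernel; rewrite inE.
  apply: filterS h => w /= h _; have := km w.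
  move=> /null_content_dominatesP; apply; first exact: measurable_xsection.
  exact: h.
pose Pms := sfpack prod_leb_sigma_finite.
have doms : mu `<< Pms by exact: dom.
exists (fun p => fine (Radon_Nikodym_SigmaFinite.f mu Pms p)); split.
- apply: measurableT_comp => //.
  by have /integrableP[] := Radon_Nikodym_SigmaFinite.f_integrable doms.
- by move=> p; apply: fine_ge0; exact: Radon_Nikodym_SigmaFinite.f_ge0.
- move=> A mA; rewrite (Radon_Nikodym_SigmaFinite.f_integral doms)//.
  apply: eq_integral => p _; rewrite fineK//.
  exact: Radon_Nikodym_SigmaFinite.f_fin_num.
Qed.

Section density.
Variables (mu : probability (bO * 'rV[R]_N)%type R) (H : bO * 'rV[R]_N -> R).
Hypotheses (mH : measurable_fun setT H) (H0 : forall p, (0 <= H p)%R).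
Hypothesis muH : forall A, measurable A -> mu A = \int[Pm]_(p in A) (H p)%:E.
Hypothesis pmu : preserves mu phase (skew_product X sigma).

Let mHw w : measurable_fun setT (fun x => H (w, x)).
Proof. by apply: (measurableT_comp mH); exact: pair1_measurable. Qed.

Let restr A := (EFin \o H) \_ A.

Let mrestr A : measurable A -> measurable_fun setT (restr A).
Proof.
by move=> mA; apply/(measurable_restrictT _ mA)/measurable_EFinP; exact: measurable_funTS.
Qed.

Let restr0 A p : 0 <= restr A p.
Proof. by rewrite /restr patchE; case: ifP => // _; rewrite lee_fin. Qed.

Let restrE A w : \int[leb N]_(x in xsection A w) (H (w, x))%:E = \int[leb N]_x restr A (w, x).
Proof.
by rewrite integral_mkcond; apply: eq_integral => x _; rewrite /restr !patchE mem_xsection.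
Qed.

Lemma dens_section_measurable A : measurable A ->
  measurable_fun setT (fun w : bO => \int[leb N]_(x in xsection A w) (H (w, x))%:E).
Proof.
move=> /mrestr mf; under eq_fun do rewrite restrE.
exact: (@measurable_fun_fubini_tonelli_F _ _ _ _ R (leb N) _ mf (restr0 A)).
Qed.

Lemma dens_fubini A : measurable A ->
  mu A = \int[P]_w \int[leb N]_(x in xsection A w) (H (w, x))%:E.
Proof.
move=> mA; rewrite muH// integral_mkcond; under [RHS]eq_integral do rewrite restrE.
exact: (@fubini_tonelli1 _ _ _ _ R P (leb N) _ (mrestr mA) (restr0 A)).
Qed.

Lemma ae_eq_of_integral (u v : bO -> \bar R) : measurable_fun setT u -> measurable_fun setT v ->
  (forall w, 0 <= u w) -> \int[P]_w u w < +oo ->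
  (forall E, measurable E -> \int[P]_(w in E) u w = \int[P]_(w in E) v w) ->
  \forall w \ae P, u w = v w.
Proof.
move=> mu' mv u0 uoo uv.
have iu : P.-integrable setT u.
  apply/integrableP; split => //.
  by under eq_integral do rewrite gee0_abs//.
have := integral_ae_eq measurableT iu mv (fun E _ mE => uv E mE).
by apply: ae_mono => w h; exact: h.
Qed.

Lemma xsection_prod (E : set bO) (B : set 'rV[R]_N) w :
  xsection (E `*` B) w = if w \in E then B else set0.
Proof.
apply/seteqP; split => x; rewrite /xsection /= inE.
  by move=> [/= Ew Bx]; rewrite mem_set.
by case: ifPn => // /set_mem Ew Bx; split.
Qed.

Lemma dens_rect E B : measurable E -> measurable B ->
  mu (E `*` B) = \int[P]_(w in E) \int[leb N]_(x in B) (H (w, x))%:E.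
Proof.
move=> mE mB; rewrite dens_fubini; last exact: measurableX.
rewrite [RHS]integral_mkcond; apply: eq_integral => w _.
by rewrite patchE xsection_prod; case: ifPn => // _; rewrite integral_set0.
Qed.

Let mI B : measurable B ->
  measurable_fun setT (fun w : bO => \int[leb N]_(x in B) (H (w, x))%:E).
Proof.
move=> mB; have := dens_section_measurable (measurableX measurableT mB).
congr (measurable_fun _ _); apply/funext => w.
by rewrite xsection_prod mem_set.
Qed.

Let I0 w B : 0 <= \int[leb N]_(x in B) (H (w, x))%:E.
Proof. by apply: integral_ge0 => x _; rewrite lee_fin. Qed.

Let muT : mu phase = 1.
Proof. by have := pmu measurableT; rewrite preimage_setT setIT probability_setT. Qed.

Lemma fiber_off_C : \forall w \ae P, \int[m]_(x in ~` C) (H (w, x))%:E = 0.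
Proof.
have mCc : measurable (~` C) by exact: measurableC.
have mu0 : mu (setT `*` ~` C) = 0.
  have -> : setT `*` ~` C = ~` phase.
    by apply/seteqP; split => [[w x] [_ nC] [_ Cx]|[w x] /= h]; [|split=> // Cx; exact: h].
  rewrite probability_setC ?muT ?subee//; exact: measurableX.
move: mu0; rewrite dens_rect// => int0.
have /(ae_eq_integral_abs P measurableT (mI mCc)) :
    \int[P]_w `|\int[leb N]_(x in ~` C) (H (w, x))%:E| = 0.
  by rewrite -[RHS]int0; apply: eq_integral => w _; rewrite gee0_abs.
by apply: ae_mono => w h; exact: h.
Qed.

Hypothesis marg : forall E : set bO, measurable E -> mu (E `*` setT) = P E.

Lemma fiber_mass : \forall w \ae P, \int[m]_x (H (w, x))%:E = 1.
Proof.
apply: ae_eq_of_integral (mI measurableT) (measurable_cst _) (fun w => I0 w setT) _ _.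
  by rewrite -dens_rect// marg// probability_setT ltry.
by move=> E mE; rewrite -dens_rect// marg// integral_cst// mul1e.
Qed.

Let pre (B : set 'rV[R]_N) : set (bO * 'rV[R]_N) :=
  phase `&` skew_product X sigma @^-1` (setT `*` B).

Let mpre B : measurable B -> measurable (pre B).
Proof.
by move=> mB; apply: mskew; [exact: measurableX|exact: measurableX].
Qed.

Let xpre B w : xsection (pre B) w = C `&` T w @^-1` B.
Proof.
apply/seteqP; split => x; rewrite /xsection /= inE.
  by move=> [[_ /= Cx] [_ /= Bx]].
by move=> [Cx Bx]; split.
Qed.

(** Sections of measurable sets are measurable, so joint measurability of the skew product passes to
    every single [T w]. *)
Lemma fiber_map_measurable w : measurable_fun C (T w).
Proof.
move=> _ B mB; rewrite -xpre; apply: measurable_xsection; exact: mpre.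
Qed.

Lemma fiber_invariant_box q : \forall w \ae P,
  \int[m]_(x in C `&` T w @^-1` (rbox q)) (H (w, x))%:E =
  \int[m]_(x in rbox q) (H (sigma w : bO, x))%:E.
Proof.
have mq : measurable (@rbox R N q) by exact: measurable_rV_box.
pose u w := \int[leb N]_(x in C `&` T w @^-1` (rbox q)) (H (w, x))%:E.
have mu_ : measurable_fun setT (u : bO -> \bar R).
  have := dens_section_measurable (mpre mq).
  by congr (measurable_fun _ _); apply/funext => w; rewrite xpre.
have u0 w : 0 <= u w by apply: integral_ge0 => x _; rewrite lee_fin.
pose v w := \int[leb N]_(x in rbox q) (H (sigma w : bO, x))%:E.
have mv : measurable_fun setT (v : bO -> \bar R) by exact: (measurableT_comp (mI mq) msigma).
apply: (ae_eq_of_integral mu_ mv u0).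
  apply: (@le_lt_trans _ _ (mu setT)); last by rewrite probability_setT ltry.
  rewrite (dens_fubini measurableT); apply: ge0_le_integral => //.
    exact: dens_section_measurable.
  move=> w _; apply: ge0_subset_integral => //.
  - by rewrite -xpre; apply: measurable_xsection; exact: mpre.
  - exact: measurable_xsection.
  - by apply/measurable_EFinP; apply: measurable_funTS.
  - by move=> x _; rewrite lee_fin.
  - by move=> x _; rewrite /xsection /= inE.
move=> E mE.
(* The image of [E] under [sigma]: the preimage of [E'] times a box under the skew product then lies
   exactly above [E]. *)
pose E' : set bO := (sigmaV : bO -> bO) @^-1` E.
have mE' : measurable E' by rewrite -[X in measurable X]setTI; exact: msigmaV.
have e := pmu (measurableX mE' mq).
transitivity (mu (phase `&` skew_product X sigma @^-1` (E' `*` rbox q))).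
  rewrite dens_fubini; last by apply: mskew; exact: measurableX.
  rewrite [LHS]integral_mkcond; apply: eq_integral => w _.
  rewrite patchE; case: ifPn => [/set_mem Ew|/negP nE].
    congr (integral _ _ _); apply/seteqP; split => x; rewrite /xsection /= inE.
      by move=> [Cx qx]; split => //; split => //=; rewrite /E' /= sigmaK.
    by move=> [[_ /= Cx] [_ /= qx]].
  rewrite (_ : xsection _ _ = set0) ?integral_set0//; apply/seteqP; split => x //.
  rewrite /xsection /= inE => -[_ [/= E'w _]]; apply: nE.
  by move: E'w; rewrite /E' /= sigmaK => ?; exact/mem_set.
rewrite e (dens_rect mE' mq) [LHS]integral_mkcond [RHS]integral_mkcond -int_sigma.
- apply: eq_integral => w _; rewrite !patchE.
  have -> : (sigma w \in E') = (w \in E) by rewrite /E'; apply/idP/idP => /set_mem h; apply/mem_set; move: h; rewrite /= sigmaK.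
  by [].
- apply/(measurable_restrictT _ mE'); exact: measurable_funTS (mI mq).
- by move=> w; rewrite patchE; case: ifP.
Qed.

(** The integrated form of L_w H_w = H_(sigma w). For a fixed box the exceptional null set depends
    on the box; rational boxes are countable and determine the measures, so one null set serves all
    Borel sets. *)
Lemma fiber_invariant : \forall w \ae P, forall B, measurable B ->
  \int[m]_(x in C `&` T w @^-1` B) (H (w, x))%:E =
  \int[m]_(x in B) (H (sigma w : bO, x))%:E.
Proof.
pose Q j w := if @unpickle ('rV[rat]_N * 'rV[rat]_N)%type j is Some q then
  \int[m]_(x in C `&` T w @^-1` (rbox q)) (H (w, x))%:E =
  \int[m]_(x in rbox q) (H (sigma w : bO, x))%:E else True.
have Qae : \forall w \ae P, forall j, Q j w.
  apply: ae_foralln => j; rewrite /Q; case: unpickle => [q|]; last exact: aeW.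
  exact: fiber_invariant_box.
have fin : \forall w \ae P, \int[m]_x (H (w, x))%:E < +oo.
  by apply: ae_mono fiber_mass => w ->; rewrite ltry.
apply: ae_mono (ae_and Qae fin) => w [Qw finw] B mB.
have Qq q : \int[m]_(x in C `&` T w @^-1` (rbox q)) (H (w, x))%:E =
    \int[m]_(x in rbox q) (H (sigma w : bO, x))%:E.
  by have := Qw (pickle q); rewrite /Q pickleK.
pose Tt := T w \_ C.
have mTt : measurable_fun setT Tt by apply/(measurable_restrictT _ mC); exact: fiber_map_measurable.
pose h1 := (fun x => (H (w, x))%:E) \_ C.
have h10 x : 0 <= h1 x by rewrite /h1 patchE; case: ifP => // _; rewrite lee_fin.
have mh1 : measurable_fun setT h1.
  by apply/(measurable_restrictT _ mC)/measurable_EFinP; exact: measurable_funTS.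
have h20 x : 0 <= (H (sigma w : bO, x))%:E by rewrite lee_fin.
have mh2 : measurable_fun setT (fun x => (H (sigma w : bO, x))%:E) by exact/measurable_EFinP.
pose n1 := mpush (mdens m mh1 h10) mTt.
have n1E A : n1 A = \int[m]_(x in C `&` T w @^-1` A) (H (w, x))%:E.
  rewrite /n1 mpushE /mdens [LHS]integral_mkcond [RHS]integral_mkcond; apply: eq_integral => x _.
  rewrite !patchE /h1 patchE; case: (boolP (x \in C)) => [Cx|nCx]; last first.
    by rewrite (_ : (x \in C `&` _) = false) ?if_same//; apply/negbTE; move: nCx; apply: contra => /set_mem [/mem_set].
  rewrite in_setI Cx /=.
  suff -> : (x \in Tt @^-1` A) = (x \in T w @^-1` A) by [].
  by apply/idP/idP => /set_mem h; apply/mem_set; move: h; rewrite /Tt /= patchE Cx.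
rewrite -n1E -[RHS]/(mdens m mh2 h20 B).
apply: measure_rV_unique => // q; first by rewrite /= [LHS]n1E Qq.
rewrite [ltLHS]n1E; apply: le_lt_trans finw; apply: ge0_subset_integral => //.
- by apply: fiber_map_measurable => //; exact: measurable_rV_box.
- exact/measurable_EFinP.
- by move=> x _; rewrite lee_fin.
Qed.

End density.

End fibers.

(** * Transfer does not increase the L^1 distance *)

Section contraction.
Local Open Scope ereal_scope.
Context d (T : measurableType d) (R : realType) (mu : {measure set T -> \bar R}).
Implicit Types f h u v : T -> R.

Lemma measurable_abs_sub u v : measurable_fun setT u -> measurable_fun setT v ->
  measurable_fun setT (fun x => `|(u x - v x)%:E|).
Proof.
by move=> mu' mv; do 2 apply: measurableT_comp => //; exact: measurable_funB.
Qed.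

Lemma L1_triangle u v f : measurable_fun setT u -> measurable_fun setT v ->
  measurable_fun setT f ->
  \int[mu]_x `|(u x - v x)%:E| <= \int[mu]_x `|(u x - f x)%:E| + \int[mu]_x `|(f x - v x)%:E|.
Proof.
move=> mu' mv mf; rewrite -ge0_integralD//; try exact: measurable_abs_sub.
apply: ge0_le_integral => //; first exact: measurable_abs_sub.
  by apply: emeasurable_funD; exact: measurable_abs_sub.
move=> x _; rewrite !abse_EFin -EFinD lee_fin.
by rewrite -[X in `|X|%R](_ : u x - f x + (f x - v x) = u x - v x)%R ?ler_normD//; ring.
Qed.

Lemma dct_L1 (u_ : nat -> T -> R) u g : (forall n, measurable_fun setT (u_ n)) ->
  measurable_fun setT u -> measurable_fun setT g ->
  (forall x, u_ ^~ x @ \oo --> u x)%R -> (forall n x, `|u_ n x| <= g x)%R ->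
  \int[mu]_x (g x)%:E < +oo -> forall dl : R, (0 < dl)%R ->
  exists n, \int[mu]_x `|(u_ n x - u x)%:E| <= dl%:E.
Proof.
move=> mu_ mu' mg cv ug goo dl dl0.
have ig : mu.-integrable setT (EFin \o g).
  apply/integrableP; split; first exact/measurable_EFinP.
  under eq_integral => x _ do rewrite /= ger0_norm ?(le_trans _ (ug 0%N x))//.
  exact: goo.
have mEu n : measurable_fun setT (EFin \o u_ n) by exact/measurable_EFinP.
have mEu' : measurable_fun setT (EFin \o u) by exact/measurable_EFinP.
have cvE : {ae mu, forall x, setT x -> (EFin \o u_ n) x @[n --> \oo] --> (EFin \o u) x}.
  by apply: aeW => x _; apply: cvg_EFin; [exact: nearW|exact: cv].
have ugE : {ae mu, forall x n, setT x -> `|(EFin \o u_ n) x| <= (EFin \o g) x}.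
  by apply: aeW => x n _; rewrite /= lee_fin.
have [_ + _] := dominated_convergence measurableT mEu mEu' cvE ig ugE.
move=> /fine_cvgP [finn /cvgrPdist_lt /(_ dl dl0) ltn].
have [n [fn hn]] := filter_ex (filterI finn ltn).
exists n; rewrite -[leLHS](fineK fn) lee_fin.
by move: hn; rewrite sub0r normrN => /ltW; apply: le_trans; exact: ler_norm.
Qed.

Section half.
Variables (C : set T) (F : T -> T).
Hypothesis mF : forall E, measurable E -> measurable (C `&` F @^-1` E).

(** Where [v <= u], the integral of [u - v] is that of [f - h] over the preimage. The integral of
    [v] is added to both sides so that every integrand stays nonnegative. *)
Lemma contract_half f h u v E : measurable_fun setT f -> measurable_fun setT h ->
  measurable_fun setT u -> measurable_fun setT v ->
  (forall x, 0 <= f x)%R -> (forall x, 0 <= h x)%R -> (forall x, 0 <= v x)%R ->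
  measurable E -> (forall x, E x -> v x <= u x)%R ->
  \int[mu]_(x in E) (v x)%:E < +oo ->
  \int[mu]_(x in E) (u x)%:E = \int[mu]_(x in C `&` F @^-1` E) (f x)%:E ->
  \int[mu]_(x in E) (v x)%:E = \int[mu]_(x in C `&` F @^-1` E) (h x)%:E ->
  \int[mu]_(x in E) `|(u x - v x)%:E| <= \int[mu]_(x in C `&` F @^-1` E) `|(f x - h x)%:E|.
Proof.
move=> mf mh mu' mv f0 h0 v0 mE Euv voo Eu Ev.
have mQ := mF mE.
have vfin : \int[mu]_(x in E) (v x)%:E \is a fin_num.
  by rewrite ge0_fin_numE// integral_ge0// => x _; rewrite lee_fin.
rewrite -(@leeD2lE _ (\int[mu]_(x in E) (v x)%:E))//.
rewrite -ge0_integralD//; last 3 first.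
- by move=> x _; rewrite lee_fin.
- by apply/measurable_EFinP; exact: measurable_funTS.
- by apply: measurable_funTS; exact: measurable_abs_sub.
rewrite [leLHS](_ : _ = \int[mu]_(x in E) (u x)%:E); last first.
  apply: eq_integral => x; rewrite inE => /Euv vu.
  by rewrite abse_EFin ger0_norm ?subr_ge0// -EFinD addrC subrK.
rewrite Eu Ev -ge0_integralD//; last 3 first.
- by move=> x _; rewrite lee_fin.
- by apply/measurable_EFinP; exact: measurable_funTS.
- by apply: measurable_funTS; exact: measurable_abs_sub.
apply: ge0_le_integral => //.
- by move=> x _; rewrite lee_fin.
- by apply/measurable_EFinP; exact: measurable_funTS.
- apply: emeasurable_funD; first by apply/measurable_EFinP; exact: measurable_funTS.
  by apply: measurable_funTS; exact: measurable_abs_sub.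
- move=> x _; rewrite abse_EFin -EFinD lee_fin.
  by have := ler_norm (f x - h x)%R; lra.
Qed.

(** The space is split where [u - v] changes sign, and the two preimages are disjoint. Only the
    duality with [F] enters, so the lemma covers invariant densities, for which the transfer
    identity is available in integrated form. *)
Lemma L1_contract f h u v : measurable_fun setT f -> measurable_fun setT h ->
  measurable_fun setT u -> measurable_fun setT v ->
  (forall x, 0 <= f x)%R -> (forall x, 0 <= h x)%R ->
  (forall x, 0 <= u x)%R -> (forall x, 0 <= v x)%R ->
  \int[mu]_x (u x)%:E < +oo -> \int[mu]_x (v x)%:E < +oo ->
  (forall E, measurable E ->
    \int[mu]_(x in E) (u x)%:E = \int[mu]_(x in C `&` F @^-1` E) (f x)%:E) ->
  (forall E, measurable E ->
    \int[mu]_(x in E) (v x)%:E = \int[mu]_(x in C `&` F @^-1` E) (h x)%:E) ->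
  \int[mu]_x `|(u x - v x)%:E| <= \int[mu]_x `|(f x - h x)%:E|.
Proof.
move=> mf mh mu' mv f0 h0 u0 v0 uoo voo Eu Ev.
pose E := [set x | (v x <= u x)%R].
have mE : measurable E by rewrite -[E]setTI; exact: measurable_fun_le.
have mEc : measurable (~` E) by exact: measurableC.
have sub (w : T -> R) A : measurable_fun setT w -> measurable A -> (forall x, 0 <= w x)%R ->
    \int[mu]_x (w x)%:E < +oo -> \int[mu]_(x in A) (w x)%:E < +oo.
  move=> mw mA w0; apply: le_lt_trans; apply: ge0_subset_integral => //.
    exact/measurable_EFinP.
  by move=> x _; rewrite lee_fin.
have h1 := contract_half mf mh mu' mv f0 h0 v0 mE (fun x Ex => Ex) (sub v E mv mE v0 voo)
  (Eu _ mE) (Ev _ mE).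
have Ecle x : (~` E) x -> (u x <= v x)%R.
  by rewrite /E /= => /negP; rewrite -ltNge => /ltW.
have h2 := contract_half mh mf mv mu' h0 f0 u0 mEc Ecle (sub u _ mu' mEc u0 uoo)
  (Ev _ mEc) (Eu _ mEc).
have muv := measurable_abs_sub mu' mv; have mfh := measurable_abs_sub mf mh.
rewrite -[in leLHS](setUv E) ge0_integral_setU//; last 2 first.
- by rewrite setUv.
- by apply/disj_set2P; rewrite setICr.
apply: (@le_trans _ _ (\int[mu]_(x in C `&` F @^-1` E) `|(f x - h x)%:E| +
    \int[mu]_(x in C `&` F @^-1` (~` E)) `|(f x - h x)%:E|)).
  apply: leeD => //; under eq_integral => x _ do rewrite abse_EFin distrC -abse_EFin.
  by apply: (le_trans h2); under eq_integral => x _ do rewrite abse_EFin distrC -abse_EFin.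
rewrite -ge0_integral_setU//; last 4 first.
- exact: mF.
- exact: mF.
- exact: measurable_funTS.
- by apply/disj_set2P; apply/seteqP; split => x // [[_ /= Ex] [_ /= nEx]].
by apply: ge0_subset_integral => //; apply: measurableU; exact: mF.
Qed.
End half.

End contraction.

(** * Approximation by fiberwise Lipschitz functions *)

Section lipschitz_approximation.
Context {R : realType} {n : nat} d (W : measurableType d) (P : probability W R).
Local Notation m := (@lebesgue_rV R n).
Local Notation Pm := (P \x leb n)%E.
Variables (C O : set 'rV[R]_n).
Hypotheses (n0 : (0 < n)%N) (cC : compact C) (oO : open O) (OC : O `<=` C).

(** Cutting everything off to [O] makes the approximants vanish off [C] and provides an integrable
    dominating function. *)
Let O' : set (W * 'rV[R]_n) := setT `*` O.
Let mO : measurable O. Proof. exact: open_rV_measurable. Qed.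
Let mO' : measurable O'. Proof. exact: measurableX. Qed.

Definition lipschitz_family (L : R) (Phi : W * 'rV[R]_n -> R) :=
  [/\ measurable_fun setT Phi, 0 <= L & forall w, lipschitz_on_C C L (fun x => Phi (w, x))].

(* The Lipschitz constant is uniform in [w], which makes the [Vnorm] of the fibers
   uniformly bounded. *)
Definition lip_approx (u : W * 'rV[R]_n -> R) := forall dl : R, 0 < dl ->
  exists Phi L, lipschitz_family L Phi /\ (\int[Pm]_p `|(Phi p - u p)%:E| <= dl%:E)%E.

Lemma lipschitz_familyD L1 L2 Phi1 Phi2 : lipschitz_family L1 Phi1 -> lipschitz_family L2 Phi2 ->
  lipschitz_family (L1 + L2) (Phi1 \+ Phi2).
Proof.
move=> [m1 l1 h1] [m2 l2 h2]; split; [exact: measurable_funD|exact: addr_ge0|].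
move=> w; split => [x y /=|x nCx /=]; last by rewrite (proj2 (h1 w))// (proj2 (h2 w))// addr0.
rewrite opprD addrACA mulrDl (le_trans (ler_normD _ _))//.
by rewrite lerD//; [exact: (proj1 (h1 w))|exact: (proj1 (h2 w))].
Qed.

Lemma lipschitz_familyZ L Phi (c : R) : lipschitz_family L Phi ->
  lipschitz_family (`|c| * L) (fun p => c * Phi p).
Proof.
move=> [m1 l1 h1]; split; [by apply: measurable_funM|by rewrite mulr_ge0|].
move=> w; split => [x y /=|x nCx /=]; last by rewrite (proj2 (h1 w))// mulr0.
by rewrite -mulrBr normrM -mulrA ler_wpM2l//; exact: (proj1 (h1 w)).
Qed.

Lemma lipschitz_family_pos L Phi : lipschitz_family L Phi ->
  lipschitz_family L (fun p => Num.max (Phi p) 0).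
Proof.
move=> [m1 l1 h1]; split => //; first exact: measurable_funrpos.
move=> w; split => [x y /=|x nCx /=]; last by rewrite (proj2 (h1 w))// maxxx.
apply: le_trans (proj1 (h1 w) x y) => /=; move: (Phi (w, x)) (Phi (w, y)) => a b.
rewrite /Num.max; case: (ltP a 0); case: (ltP b 0) => b0 a0.
- by rewrite subrr normr0.
- by rewrite sub0r normrN ger0_norm// ler0_norm; lra.
- by rewrite subr0 ger0_norm// ger0_norm; lra.
- by [].
Qed.

Lemma lip_approxD (u v : W * 'rV[R]_n -> R) : measurable_fun setT u -> measurable_fun setT v ->
  lip_approx u -> lip_approx v -> lip_approx (u \+ v).
Proof.
move=> mu mv au av dl dl0; have dl20 : 0 < dl / 2 by rewrite divr_gt0.
have [Phi1 [L1 [f1 h1]]] := au _ dl20; have [Phi2 [L2 [f2 h2]]] := av _ dl20.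
exists (Phi1 \+ Phi2), (L1 + L2); split; first exact: lipschitz_familyD.
have [m1 _ _] := f1; have [m2 _ _] := f2.
rewrite (splitr dl) EFinD; apply: le_trans (leeD h1 h2).
rewrite -ge0_integralD//; try exact: measurable_abs_sub.
apply: ge0_le_integral => //.
- by apply: measurable_abs_sub; exact: measurable_funD.
- by apply: emeasurable_funD; exact: measurable_abs_sub.
move=> p _ /=; rewrite -EFinD lee_fin opprD addrACA; exact: ler_normD.
Qed.

Lemma lip_approxZ (u : W * 'rV[R]_n -> R) c : measurable_fun setT u -> lip_approx u -> lip_approx (fun p => c * u p).
Proof.
move=> mu au dl dl0; have c0 : 0 < `|c| + 1 by rewrite ltr_wpDl.
have dlc : 0 < dl / (`|c| + 1) by rewrite divr_gt0.
have [Phi [L [f h]]] := au _ dlc.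
exists (fun p => c * Phi p), (`|c| * L); split; first exact: lipschitz_familyZ.
have [mp _ _] := f.
apply: (@le_trans _ _ (`|c|%:E * \int[Pm]_p `|(Phi p - u p)%:E|)%E).
  rewrite -ge0_integralZl_EFin//; last exact: measurable_abs_sub.
  rewrite le_eqVlt; apply/orP; left; apply/eqP; apply: eq_integral => p _.
  by rewrite -mulrBr EFinM abseM.
apply: (@le_trans _ _ (`|c|%:E * (dl / (`|c| + 1))%:E)%E); first exact: lee_wpmul2l.
rewrite -EFinM lee_fin mulrCA -[leRHS]mulr1 ler_wpM2l ?ltW// ltr_pdivrMr//.
by rewrite mul1r ltrDl.
Qed.

Lemma lip_approx_lim (u : W * 'rV[R]_n -> R) : measurable_fun setT u ->
  (forall dl : R, 0 < dl -> exists v, [/\ measurable_fun setT v, lip_approx v &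
     (\int[Pm]_p `|(v p - u p)%:E| <= dl%:E)%E]) -> lip_approx u.
Proof.
move=> mu H dl dl0; have dl20 : 0 < dl / 2 by rewrite divr_gt0.
have [v [mv av vu]] := H _ dl20; have [Phi [L [f h]]] := av _ dl20.
exists Phi, L; split => //; have [mp _ _] := f.
apply: (le_trans (@L1_triangle _ _ _ Pm _ _ v mp mu mv)).
by rewrite (splitr dl) EFinD; apply: leeD.
Qed.

Lemma lip_approx_dct (u_ : nat -> W * 'rV[R]_n -> R) (u g : W * 'rV[R]_n -> R) :
  (forall k, measurable_fun setT (u_ k)) -> measurable_fun setT u -> measurable_fun setT g ->
  (forall p, u_ ^~ p @ \oo --> u p) -> (forall k p, `|u_ k p| <= g p) ->
  (\int[Pm]_p (g p)%:E < +oo)%E -> (forall k, lip_approx (u_ k)) -> lip_approx u.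
Proof.
move=> mu_ mu mg cv ug goo au; apply: lip_approx_lim => // dl dl0.
have [k hk] := @dct_L1 _ _ _ Pm u_ u g mu_ mu mg cv ug goo dl dl0.
by exists (u_ k).
Qed.

Let Cbound : exists2 M : R, 0 < M & forall v, C v -> `|v| <= M.
Proof. exact: compact_coord_bounded. Qed.

Let Ooo : (Pm O' < +oo)%E.
Proof.
have -> : Pm O' = (P setT * leb n O)%E by exact: product_measure1E.
rewrite probability_setT mul1e; apply: le_lt_trans (compact_lebesgue_lty cC).
by apply: le_measure; rewrite ?inE//; exact: compact_rV_measurable.
Qed.

Section open_indicator.
Variable U : set 'rV[R]_n.
Hypotheses (oU : open U) (UC : U `<=` C).

Let dists x := [set `|x - z| | z in ~` U].
Let dist x := inf (dists x).

Let dists_nonempty x : dists x !=set0.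
Proof.
have [M M0 hM] := Cbound; exists `|x - const_mx (M + 1)|; exists (const_mx (M + 1)) => //.
move=> /UC /hM; have := coord_le_norm (const_mx (M + 1) : 'rV[R]_n) (Ordinal n0).
by rewrite mxE ger0_norm; lra.
Qed.

Let dists_lb x : has_lbound (dists x).
Proof. by exists 0 => _ [z _ <-]. Qed.

Let dist_ge0 x : 0 <= dist x.
Proof. by apply: lb_le_inf => // _ [z _ <-]. Qed.

Let dist_lip x y : dist x <= `|x - y| + dist y.
Proof.
rewrite -lerBlDl; apply: lb_le_inf => // _ [z Uz <-]; rewrite lerBlDl.
apply: le_trans (ler_distD y _ _); apply: ge_inf => //; by exists z.
Qed.

Let dist_out x : ~ U x -> dist x = 0.
Proof.
move=> nU; apply/eqP; rewrite eq_le dist_ge0 andbT.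
by apply: ge_inf => //; exists x => //; rewrite subrr normr0.
Qed.

Let dist_in x : U x -> 0 < dist x.
Proof.
move=> Ux; have /nbhs_ballP[e /= e0 eU] : nbhs x U by exact: open_nbhs_nbhs.
apply: (lt_le_trans e0); apply: lb_le_inf => // _ [z nUz <-].
by rewrite leNgt; apply/negP => xz; apply: nUz; apply: eU; rewrite -ball_normE.
Qed.

(** Truncated multiples of the distance to the complement of [U]: zero off [U], and equal to 1 at
    each given point of [U] once [k] is large. *)
Definition bump (k : nat) x := Num.min 1 (k%:R * dist x).

Lemma bump_lipschitz k : lipschitz_on_C C k%:R (bump k).
Proof.
split => [x y|x nCx]; last first.
  by rewrite /bump dist_out ?mulr0 ?minr_r//; [rewrite min_r|move=> /UC].
have h1 := dist_lip x y; have h2 := dist_lip y x; rewrite distrC in h2.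
have k0 : 0 <= k%:R :> R by [].
have := ler_wpM2l k0 h1; have := ler_wpM2l k0 h2; rewrite !mulrDr /bump.
move: (k%:R * dist x) (k%:R * dist y) (k%:R * `|x - y|) => a b c ab ba.
rewrite /Num.min ler_norml; case: (ltP 1 a) => a1; case: (ltP 1 b) => b1; apply/andP; split; lra.
Qed.

Lemma bump_ge0 k x : 0 <= bump k x.
Proof. by rewrite le_min ler01 mulr_ge0. Qed.

Lemma bump_le k x : bump k x <= \1_U x.
Proof.
rewrite indicE; have [Ux|nU] := pselect (U x).
  by rewrite mem_set// ge_min lexx.
by rewrite memNset// /bump dist_out// mulr0 ge_min lexx orbT.
Qed.

Lemma bump_cvg x : bump ^~ x @ \oo --> (\1_U x : R).
Proof.
rewrite indicE; have [Ux|nU] := pselect (U x); last first.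
  rewrite memNset//; apply: cvg_near_cst; apply: nearW => k.
  by rewrite /bump dist_out// mulr0 min_r.
rewrite mem_set//; apply: cvg_near_cst.
exists (Num.truncn (dist x)^-1).+1 => // k /= hk.
rewrite /bump min_l// -ler_pdivrMr ?dist_in// mul1r.
apply/ltW/(lt_le_trans (truncnS_gt _)); by rewrite ler_nat.
Qed.

End open_indicator.

(** The factor in [w] is kept exact and only the factor in the space variable is smoothed, which
    keeps the Lipschitz constant independent of [w]. *)
Lemma lip_approx_rect (E : set W) (V : set 'rV[R]_n) : measurable E -> open V ->
  lip_approx \1_((E `*` V) `&` O').
Proof.
move=> mE oV; pose U := V `&` O.
have oU : open U by exact: openI.
have UC : U `<=` C by move=> x [_ /OC].
have mb k : measurable_fun setT (bump U k).
  exact: lipschitz_measurable (bump_lipschitz UC k).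
pose u k (p : W * 'rV[R]_n) := \1_E p.1 * bump U k p.2.
have mu k : measurable_fun setT (u k).
  apply: measurable_funM; first by apply: measurableT_comp => //; exact: measurable_indic.
  by apply: (measurableT_comp (mb k)).
have lim p : \1_((E `*` V) `&` O') p = \1_E p.1 * \1_U p.2 :> R.
  rewrite !indicE -natrM mulnb; congr (nat_of_bool _)%:R.
  apply/idP/andP => [/set_mem [[h1 h2] [_ h3]]|[/set_mem h1 /set_mem [h2 h3]]].
    by split; apply/mem_set.
  by apply/mem_set; split; split.
apply: (@lip_approx_dct u _ \1_O') => //.
- by apply: measurable_indic; apply: measurableI => //; apply: measurableX => //; exact: open_rV_measurable.
- by move=> p; rewrite lim; apply: cvgM; [exact: cvg_cst|exact: bump_cvg].
- move=> k p; rewrite ger0_norm; last by rewrite mulr_ge0//; exact: bump_ge0.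
  apply: (@le_trans _ _ (1 * \1_U p.2)).
    by apply: ler_pM => //; first [exact: bump_ge0|exact: bump_le|rewrite indicE; case: (_ \in _)].
  rewrite mul1r !indicE ler_nat; case: (boolP (p.2 \in U)) => // /set_mem [_ Op].
  by rewrite mem_set.
- by rewrite integral_indic// setIT.
move=> k dl dl0; exists (u k), k%:R; split; last first.
  rewrite (eq_integral (cst 0%E)) ?integral_cst ?mul0e ?lee_fin ?ltW// => p _.
  by rewrite subrr abse0.
split => // w; have [h1 h2] := bump_lipschitz UC k; split => [x y|x nCx].
  rewrite /u /= -mulrBr normrM -[leRHS]mul1r ler_pM//.
  by rewrite indicE; case: (_ \in _); rewrite ?normr1 ?normr0.
by rewrite /u /= h2// mulr0.
Qed.

Let indic_setIO (A : set (W * 'rV[R]_n)) p : \1_(A `&` O') p = \1_A p * \1_O' p :> R.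
Proof. by rewrite indicI. Qed.

Lemma lip_approx_setD (A B : set (W * 'rV[R]_n)) : measurable A -> measurable B -> A `<=` B ->
  lip_approx \1_(A `&` O') -> lip_approx \1_(B `&` O') -> lip_approx \1_((B `\` A) `&` O').
Proof.
move=> mA mB AB aA aB.
have -> : \1_((B `\` A) `&` O') = \1_(B `&` O') \+ (fun p => -1 * \1_(A `&` O') p) :> (_ -> R).
  apply/funext => p /=; rewrite !indic_setIO !indicE in_setD.
  have [/set_mem/AB Bp|] := boolP (p \in A); first by rewrite mem_set//=; ring.
  by move=> _; case: (p \in B); case: (p \in O') => /=; ring.
have mI Z : measurable Z -> measurable_fun setT (\1_(Z `&` O') : _ -> R).
  by move=> mZ; apply: measurable_indic; exact: measurableI.
by apply: lip_approxD; [exact: mI|apply: measurable_funM => //; exact: mI| |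
  apply: lip_approxZ => //; exact: mI].
Qed.

Lemma lip_approx_bigcup (F : nat -> set (W * 'rV[R]_n)) : (forall k, measurable (F k)) ->
  trivIset setT F -> (forall k, lip_approx \1_(F k `&` O')) ->
  lip_approx \1_(\bigcup_k F k `&` O').
Proof.
move=> mF tF aF.
pose u k (p : W * 'rV[R]_n) : R := \1_(\big[setU/set0]_(i < k) F i `&` O') p.
have mB k : measurable (\big[setU/set0]_(i < k) F i) by exact: bigsetU_measurable.
have mu k : measurable_fun setT (u k) by apply: measurable_indic; exact: measurableI.
apply: (@lip_approx_dct u _ \1_O') => //.
- by apply: measurable_indic; apply: measurableI => //; exact: bigcupT_measurable.
- move=> p; apply: cvg_near_cst; have [[k _ Fk]|nF] := pselect ((\bigcup_k F k) p).
    exists k.+1 => // j /= kj; rewrite /u !indic_setIO; congr (_ * _).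
    rewrite !indicE !mem_set//; [by exists k|].
    by rewrite -bigcup_mkord; exists k.
  apply: nearW => j; rewrite /u !indic_setIO; congr (_ * _).
  rewrite !indicE !memNset//; rewrite -bigcup_mkord => -[i _ Fi]; apply: nF; by exists i.
- move=> k p; rewrite /u ger0_norm; last by rewrite indicE; case: (_ \in _).
  by rewrite indic_setIO !indicE; case: (_ \in _); case: (_ \in _); rewrite ?mul0r ?mulr0 ?mul1r.
- by rewrite integral_indic// setIT.
elim=> [|k IH].
  have -> : u 0%N = (fun p => 0 * \1_O' p).
    by apply/funext => p; rewrite /u indic_setIO big_ord0 indic0.
  apply: lip_approxZ; first exact: measurable_indic.
  by have := lip_approx_rect measurableT openT; rewrite setXTT setTI.
have -> : u k.+1 = u k \+ \1_(F k `&` O').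
  apply/funext => p; rewrite /u /= !indic_setIO -mulrDl; congr (_ * _).
  rewrite big_ord_recr /= !indicE in_setU.
  case: (boolP (p \in F k)) => /= [/set_mem Fk|]; last by rewrite orbF addr0.
  rewrite memNset ?add0r//; rewrite -bigcup_mkord => -[i /= ik Fi].
  have ik' : i = k by apply: (tF i k) => //; exists p.
  by rewrite ik' ltnn in ik.
by apply: lip_approxD => //; apply: measurable_indic; exact: measurableI.
Qed.

(** Two Dynkin arguments: from open to Borel sets in the second factor, then from rectangles to the
    product sigma-algebra. *)
Lemma lip_approx_indic (A : set (W * 'rV[R]_n)) : measurable A -> lip_approx \1_(A `&` O').
Proof.
have base (E : set W) (V : set 'rV[R]_n) : measurable E -> measurable V -> lip_approx \1_((E `*` V) `&` O').
  move=> mE; move: V; apply: (@dynkin_induction _ _ (@open 'rV[R]_n)) => //.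
  - exact: openI.
  - by apply: lip_approx_rect => //; exact: openT.
  - by move=> V oV; exact: lip_approx_rect.
  - move=> V mV aV.
    have -> : E `*` ~` V = (E `*` setT) `\` (E `*` V).
      by apply/seteqP; split => -[a b] /= => [[Ea nVb]|[[Ea _] nEV]]; split=> //; [case|move=> Vb; exact: nEV].
    apply: lip_approx_setD => //; try exact: measurableX.
      by move=> p [].
    by apply: lip_approx_rect => //; exact: openT.
  move=> F mF tF aF; rewrite setX_bigcupr.
  apply: lip_approx_bigcup => //; first by move=> k; exact: measurableX.
  apply/trivIsetP => i j _ _ ij; rewrite -setXI setIid.
  by move/trivIsetP : tF => /(_ i j I I ij) ->; rewrite setX0.
have E : @measurable _ (W * 'rV[R]_n)%type = <<s [set A `*` B | A in measurable & B in measurable] >>.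
  exact: measurable_prod_measurableType.
rewrite E; move: A; apply: dynkin_induction => //.
- move=> _ _ [A1 mA1 [A2 mA2 <-]] [B1 mB1 [B2 mB2 <-]].
  exists (A1 `&` B1); first exact: measurableI.
  exists (A2 `&` B2); first exact: measurableI.
  by rewrite setXI.
- by rewrite -setXTT; exact: base.
- by move=> _ [A1 mA1 [A2 mA2 <-]]; exact: base.
- move=> A mA aA; rewrite -setTD; apply: lip_approx_setD => //.
  by rewrite -setXTT; exact: base.
- exact: lip_approx_bigcup.
Qed.

Lemma lip_approx_sum k (u : 'I_k -> W * 'rV[R]_n -> R) : (forall i, measurable_fun setT (u i)) ->
  (forall i, lip_approx (u i)) -> lip_approx (fun p => \sum_(i < k) u i p).
Proof.
elim: k u => [|k IH] u mu au.
  have -> : (fun p => \sum_(i < 0) u i p) = (fun p => 0 * \1_(setT `&` O') p).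
    by apply/funext => p; rewrite big_ord0 mul0r.
  apply: lip_approxZ; last exact: lip_approx_indic.
  by apply: measurable_indic; exact: measurableI.
have -> : (fun p => \sum_(i < k.+1) u i p) =
    (fun p => \sum_(i < k) u (widen_ord (leqnSn k) i) p) \+ u ord_max.
  by apply/funext => p; rewrite big_ord_recr.
apply: lip_approxD => //; first exact: measurable_sum.
exact: IH.
Qed.

Import HBNNSimple.

Lemma lip_approx_nonneg (H : W * 'rV[R]_n -> R) : measurable_fun setT H -> (forall p, 0 <= H p) ->
  (\int[Pm]_p (H p)%:E < +oo)%E -> (\forall p \ae Pm, ~ O p.2 -> H p = 0) ->
  forall dl : R, 0 < dl -> exists Phi L, [/\ lipschitz_family L Phi, forall p, 0 <= Phi p &
    (\int[Pm]_p `|(Phi p - H p)%:E| <= dl%:E)%E].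
Proof.
move=> mH H0 Hoo Haz dl dl0.
pose h p := H p * \1_O' p.
have mh : measurable_fun setT h by apply: measurable_funM => //; exact: measurable_indic.
have h0 p : 0 <= h p by rewrite mulr_ge0// indicE.
have hH p : h p <= H p by rewrite /h indicE; case: (_ \in _); rewrite ?mulr1// mulr0.
have hO p : h p * \1_O' p = h p by rewrite /h -mulrA !indicE -natrM mulnb andbb.
have meh : measurable_fun setT (EFin \o h) by apply/measurable_EFinP.
pose g := nnsfun_approx measurableT meh.
have cg p : (fun j => g j p) @ \oo --> h p.
  have : (EFin \o (fun j => g j p)) @ \oo --> (h p)%:E.
    by apply: (cvg_nnsfun_approx measurableT meh) => // q _; rewrite /= lee_fin.
  by move/fine_cvgP => [_].
have gh k p : g k p <= h p.
  have cgp := cg p; rewrite -(cvg_lim (@Rhausdorff R) cgp).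
  apply: (@nondecreasing_cvgn_le _ (fun j => g j p)) => //; last exact: (cvgP _ cgp).
  by move=> i j ij; exact/lefP/nd_nnsfun_approx.
have ah : lip_approx h.
  apply: (@lip_approx_dct (fun k p => g k p) h H) => //.
    by move=> k p; rewrite ger0_norm// (le_trans (gh k p)).
  move=> k; pose s : seq R := finmap.enum_fset (fset_set (range (g k))).
  have -> : (fun p => g k p) =
      (fun p => \sum_(i < size s) (s`_i * \1_(g k @^-1` [set s`_i] `&` O') p)).
    apply/funext => p; transitivity (g k p * \1_O' p).
      rewrite indicE; case: (boolP (p \in O')) => [_|pO]; first by rewrite mulr1.
      rewrite mulr0; apply/eqP; rewrite eq_le (le_trans (gh k p)) ?andTb//.
      by rewrite /h indicE (negbTE pO) mulr0.
    rewrite fimfunE fsbig_finite//= (big_nth 0) big_mkord mulr_suml.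
    apply: eq_bigr => i _.
    by rewrite indic_setIO mulrA.
  have mi i : measurable_fun setT (\1_(g k @^-1` [set s`_i] `&` O') : _ -> R).
    apply: measurable_indic; apply: measurableI => //.
  apply: lip_approx_sum => i; first by apply: measurable_funM.
  by apply: lip_approxZ => //; exact: lip_approx_indic.
have [Phi [L [LP hP]]] := ah _ dl0.
(* The target is nonnegative, so passing to the positive part does not increase the distance to
   it. *)
exists (fun p => Num.max (Phi p) 0), L; split; first exact: lipschitz_family_pos.
  by move=> p; rewrite le_max lexx orbT.
have [mP _ _] := LP.
apply: le_trans hP; apply: ae_ge0_le_integral => //.
- by apply: measurable_abs_sub => //; exact: measurable_funrpos.
- exact: measurable_abs_sub.
apply: filterS Haz => p Hp _.
have -> : H p = h p.
  rewrite /h indicE; have [Op|nO] := pselect (O p.2); first by rewrite mem_set ?mulr1.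
  by rewrite Hp// mul0r.
rewrite !abse_EFin lee_fin; have := h0 p; move: (h p) (Phi p) => a b a0.
rewrite /Num.max; case: ltP => // b0; rewrite sub0r normrN (ger0_norm a0) (@ler0_norm _ (b - a)); lra.
Qed.

End lipschitz_approximation.

(** * Iterated Lasota-Yorke inequality *)

Section iterated_transfer.
Context {R : realType} {N : nat} {Omega : ptopologicalType}.
Variables (X : saussol_data R N Omega) (sigmaV : Omega -> Omega).
Local Notation m := (@lebesgue_rV R N).
Local Notation C := (sC X).
Local Notation alpha := (salpha X).
Implicit Types (w : Omega) (f : 'rV[R]_N -> R).

(* [cocycle j w] is the composite of the transfer operators of
   sigma^-j w, ..., sigma^-1 w, from the fiber of sigma^-j w to that of w. *)
Fixpoint cocycle (j : nat) w f : 'rV[R]_N -> R :=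
  if j is j'.+1 then transfer X (sigmaV w) (cocycle j' (sigmaV w) f) else f.

Lemma iter_etaS (eta : Omega -> R) k w :
  iter_eta sigmaV eta k.+1 w = eta (sigmaV w) * iter_eta sigmaV eta k (sigmaV w).
Proof.
rewrite /iter_eta big_ltn//= big_add1 /=; congr (_ * _).
by apply: eq_bigr => i _; rewrite -iterSr.
Qed.

Lemma iter_eta0 (eta : Omega -> R) w : iter_eta sigmaV eta 0 w = 1.
Proof. by rewrite /iter_eta big_geq. Qed.

Lemma cocycle_ge0 j w f : (forall x, 0 <= f x) -> forall x, 0 <= cocycle j w f x.
Proof.
by move=> f0; elim: j w => [|j IH] w //= x; apply: transfer_ge0; exact: IH.
Qed.

Variable te0 : R.
Hypothesis bounded : forall w, bounded_op C alpha te0 (transfer X w).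

Lemma cocycle_Valpha j w f : Valpha C alpha te0 f -> Valpha C alpha te0 (cocycle j w f).
Proof.
move=> Vf; elim: j w => [w|j IH w]; first exact: Vf.
exact: (proj1 (bounded (sigmaV w)) (cocycle j (sigmaV w) f) (IH _)).
Qed.

Lemma Valpha_measurable f : Valpha C alpha te0 f -> measurable_fun setT f.
Proof. by case=> -[/integrableP[/measurable_EFinP]]. Qed.

Lemma Valpha_lty f : Valpha C alpha te0 f -> (forall x, 0 <= f x) ->
  (\int[m]_x (f x)%:E < +oo)%E.
Proof.
case=> -[/integrableP[_ fin] _] _ f0; apply: le_lt_trans fin.
by rewrite le_eqVlt; apply/orP; left; apply/eqP; apply: eq_integral => x _ /=; rewrite ger0_norm.
Qed.

Hypothesis mC : measurable C.
Hypothesis mT : forall w, measurable_fun C (sT X w).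

Lemma transfer_mass w f : good_fiber X w -> Valpha C alpha te0 f -> (forall x, 0 <= f x) ->
  (\int[m]_y (transfer X w f y)%:E = \int[m]_x (f x)%:E)%E.
Proof.
move=> gw Vf f0; have mf := Valpha_measurable Vf; have [[intf fC] _] := Vf.
have := transfer_dual gw mf f0 measurableT (mT w) mC intf.
rewrite (_ : C `&` sT X w @^-1` setT = C); last by rewrite preimage_setT setIT.
move=> ->; rewrite integral_mkcond; apply: eq_integral => x _.
by rewrite patchE; case: ifPn => // /negP nC; rewrite fC// => Cx; apply: nC; exact/mem_set.
Qed.

Lemma cocycle_mass j w f : (forall j, good_fiber X (iter j.+1 sigmaV w)) ->
  Valpha C alpha te0 f -> (forall x, 0 <= f x) ->
  (\int[m]_y (cocycle j w f y)%:E = \int[m]_x (f x)%:E)%E.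
Proof.
move=> gw Vf f0; elim: j w gw => [w gw|j IH w gw]; first by [].
have E := transfer_mass (gw 0%N) (cocycle_Valpha j (sigmaV w) Vf)
  (@cocycle_ge0 j (sigmaV w) f f0).
apply: (etrans E); apply: IH => i; rewrite -iterSr; exact: gw.
Qed.

Lemma L1norm_ge0E f : (forall x, 0 <= f x) -> L1norm f = (\int[m]_x (f x)%:E)%E.
Proof. by move=> f0; apply: eq_integral => x _; rewrite /= ger0_norm. Qed.

(** The mass is conserved, so every step adds the same [D * l], which the steps still to come
    multiply by their values of [eta]. The term [k = 0] belongs to the last step. *)
Lemma cocycle_Vnorm (eta : Omega -> R) (D M l : R) j w f : (forall w, 0 < eta w) -> 0 < D ->
  (forall j, good_fiber X (iter j.+1 sigmaV w)) ->
  (forall j, forall f, Valpha C alpha te0 f ->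
    (Vnorm alpha te0 (transfer X (iter j.+1 sigmaV w) f) <=
      (eta (iter j.+1 sigmaV w))%:E * Vnorm alpha te0 f + D%:E * L1norm f)%E) ->
  Valpha C alpha te0 f -> (forall x, 0 <= f x) ->
  (Vnorm alpha te0 f <= M%:E)%E -> L1norm f = l%:E ->
  (Vnorm alpha te0 (cocycle j w f) <=
    (iter_eta sigmaV eta j w * M + D * (\sum_(k < j) iter_eta sigmaV eta k w) * l)%:E)%E.
Proof.
move=> eta0 D0 gw LY Vf f0 fM fl; elim: j w gw LY => [|j IH] w gw LY.
  by rewrite iter_eta0 big_ord0 mulr0 mul0r addr0 mul1r.
have gw' i : good_fiber X (iter i.+1 sigmaV (sigmaV w)) by rewrite -iterSr; exact: gw.
have LY' i g : Valpha C alpha te0 g -> (Vnorm alpha te0 (transfer X (iter i.+1 sigmaV (sigmaV w)) g) <=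
    (eta (iter i.+1 sigmaV (sigmaV w)))%:E * Vnorm alpha te0 g + D%:E * L1norm g)%E.
  rewrite -iterSr; exact: LY.
apply: (le_trans (LY 0%N _ (cocycle_Valpha j _ Vf))).
have -> : L1norm (cocycle j (sigmaV w) f) = L1norm f.
  rewrite (L1norm_ge0E (@cocycle_ge0 j (sigmaV w) f f0)) (L1norm_ge0E f0).
  exact: cocycle_mass.
have IHw := IH (sigmaV w) gw' LY'.
have e0 : (0 <= (eta (sigmaV w))%:E)%E by rewrite lee_fin ltW.
apply: (le_trans (leeD (lee_wpmul2l e0 IHw) (lexx _))).
rewrite fl -EFinM -EFinM -EFinD lee_fin iter_etaS big_ord_recl iter_eta0.
have -> : \sum_(i < j) iter_eta sigmaV eta (lift ord0 i) w =
    eta (sigmaV w) * \sum_(i < j) iter_eta sigmaV eta i (sigmaV w).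
  by rewrite mulr_sumr; apply: eq_bigr => i _; rewrite -iter_etaS.
by rewrite le_eqVlt; apply/orP; left; apply/eqP; ring.
Qed.

(** The densities travel from fiber to fiber by the same duality as the functions of the cocycle, so
    no step increases the distance. *)
Lemma cocycle_L1_contract (H : Omega -> 'rV[R]_N -> R) (sigma : Omega -> Omega) j w f :
  cancel sigmaV sigma ->
  (forall w, measurable_fun setT (H w)) -> (forall w x, 0 <= H w x) ->
  (forall j, good_fiber X (iter j.+1 sigmaV w)) ->
  (forall j, \int[m]_x (H (iter j sigmaV w) x)%:E = 1)%E ->
  (forall j B, measurable B ->
    \int[m]_(x in C `&` sT X (iter j.+1 sigmaV w) @^-1` B) (H (iter j.+1 sigmaV w) x)%:E =
    \int[m]_(x in B) (H (sigma (iter j.+1 sigmaV w)) x)%:E)%E ->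
  Valpha C alpha te0 f -> (forall x, 0 <= f x) ->
  (\int[m]_x `|(cocycle j w f x - H w x)%:E| <=
   \int[m]_x `|(f x - H (iter j sigmaV w) x)%:E|)%E.
Proof.
move=> sVK mH H0; elim: j w => [//|j IH] w gw H1 Hinv Vf f0.
have := IH (sigmaV w); rewrite -iterSr => IHw.
apply: le_trans (IHw _ _ _ Vf f0); last first.
- by move=> i B mB; rewrite -iterSr; exact: Hinv.
- by move=> i; rewrite -iterSr; exact: H1.
- by move=> i; rewrite -iterSr; exact: gw.
have Vc := cocycle_Valpha j (sigmaV w) Vf.
have c0 := @cocycle_ge0 j (sigmaV w) f f0.
have Vt := proj1 (bounded (sigmaV w)) _ Vc.
have t0 := @transfer_ge0 _ _ _ X (sigmaV w) _ c0.
have [[intc _] _] := Vc; have [[intt _] _] := Vt.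
apply: (@L1_contract _ _ _ m C (sT X (sigmaV w))) => //=.
- by move=> E mE; apply: mT.
- exact: Valpha_measurable Vc.
- exact: Valpha_measurable Vt.
- exact: Valpha_lty Vt t0.
- by rewrite (H1 0%N) ltry.
- by move=> E mE; apply: (transfer_dual (gw 0%N) (Valpha_measurable Vc)).
- by move=> E mE; rewrite (Hinv 0%N) //= sVK.
Qed.

End iterated_transfer.

Section lasota_yorke_constants.
Context {R : realType} {Omega : ptopologicalType}.
Variables (sigmaV : Omega -> Omega) (eta : Omega -> R) (xi : R) (j0 : Omega -> nat) (w : Omega).
Hypotheses (xi0 : 0 < xi) (xi1 : xi < 1).
Hypothesis decay : forall j, (j0 w <= j)%N -> iter_eta sigmaV eta j w < xi ^+ j.
Local Notation theta := (LY_theta sigmaV eta xi j0 w).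

Lemma LY_theta_ge1 : 1 <= theta.
Proof. exact: bigmax_ge_id. Qed.

(** From [j0 w] on this is the decay, as theta is at least 1; the finitely many earlier indices are
    covered by the maximum that defines theta. *)
Lemma iter_eta_le_theta k : iter_eta sigmaV eta k w <= theta * xi ^+ k.
Proof.
have xk : 0 < xi ^+ k by rewrite exprn_gt0.
case: k xk => [|k] xk.
  by rewrite /iter_eta big_geq// mulr1; exact: LY_theta_ge1.
have [j0k|kj0] := leqP (j0 w) k.+1.
  by rewrite (le_trans (ltW (decay j0k)))// ler_peMl ?(ltW xk)// LY_theta_ge1.
rewrite -ler_pdivrMr//; apply: (@le_trans _ _ (Num.max (iter_eta sigmaV eta k.+1 w / xi ^+ k.+1) 1)).
  by rewrite le_max lexx.
have ik : k.+1 \in index_iota 1 (j0 w).+1 by rewrite mem_index_iota /= ltnS ltnW.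
rewrite /LY_theta; have := le_bigmax_seq 1 k.+1 xpredT
  (fun j => Num.max (iter_eta sigmaV eta j w / xi ^+ j) 1) ik.
by apply.
Qed.

Lemma sum_iter_eta_le k : \sum_(i < k) iter_eta sigmaV eta i w <= theta / (1 - xi).
Proof.
have xi1' : 0 < 1 - xi by rewrite subr_gt0.
apply: (@le_trans _ _ (\sum_(i < k) theta * xi ^+ i)).
  by apply: ler_sum => i _; exact: iter_eta_le_theta.
rewrite -mulr_sumr ler_wpM2l ?(le_trans _ LY_theta_ge1)//.
rewrite -[leRHS]mul1r ler_pdivlMr// mulrC.
have := subrX1 xi k => E; rewrite -opprB mulNr -E opprB lerBlDl lerDr.
by rewrite exprn_ge0// ltW.
Qed.

End lasota_yorke_constants.

Lemma L1_le_dist d (T : measurableType d) (R : realType) (mu : {measure set T -> \bar R})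
    (u v : T -> R) : measurable_fun setT u -> measurable_fun setT v ->
  (forall x, 0 <= u x) -> (forall x, 0 <= v x) ->
  (\int[mu]_x (u x)%:E <= \int[mu]_x `|(u x - v x)%:E| + \int[mu]_x (v x)%:E)%E.
Proof.
move=> mu_ mv u0 v0.
have mabs : measurable_fun setT (fun x => `|(u x - v x)%:E|)%E by exact: measurable_abs_sub.
rewrite -ge0_integralD//; last exact/measurable_EFinP.
  apply: ge0_le_integral => //.
  - by move=> x _; rewrite lee_fin.
  - exact/measurable_EFinP.
  - by apply: emeasurable_funD => //; exact/measurable_EFinP.
  by move=> x _; rewrite lee_fin -lerBlDr ler_norm.
by move=> x _; rewrite lee_fin.
Qed.

(** * From small mean oscillation to a lower bound for the support *)

Section support_lower_bound.
Context {R : realType} {N : nat}.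
Local Notation m := (@lebesgue_rV R N).
Variables (C : set 'rV[R]_N) (alpha te0 c D th xi : R) (H : 'rV[R]_N -> R).
Hypotheses (alpha0 : 0 < alpha) (te00 : 0 < te0) (mC : measurable C)
  (Cc : m C = c%:E) (c1 : 1 <= c) (D0 : 0 < D) (th1 : 1 <= th) (xi_half : 2^-1 < xi) (xi1 : xi < 1)
  (D_large : xi * te0 `^ (- alpha) <= D)
  (mH : measurable_fun setT H) (H0 : forall x, 0 <= H x) (H1 : (\int[m]_x (H x)%:E = 1)%E).
Let A := th / (1 - xi).
Let Theta := D * c * (1 + A).
Let e := Theta `^ (- alpha^-1).

Let xi1' : 0 < 1 - xi. Proof. by rewrite subr_gt0. Qed.
Let A2 : 2 < A.
Proof.
rewrite /A ltr_pdivlMr//; apply: (lt_le_trans _ th1).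
by move: xi_half; rewrite -(@ltr_pM2l _ 2)// divff//; lra.
Qed.
Let A0 : 0 < A. Proof. by apply: lt_trans A2. Qed.
Let Theta0 : 0 < Theta.
Proof. by rewrite /Theta !mulr_gt0// ?(lt_le_trans _ c1)// addr_gt0. Qed.
Let e0 : 0 < e. Proof. by rewrite powR_gt0. Qed.
Let e_alpha : e `^ (- alpha) = Theta.
Proof. by rewrite /e -powRrM mulrNN mulVf ?gt_eqF// powRr1// ltW. Qed.

(** The seminorm only controls scales up to [te0]. The claim amounts to [te0 ^ (- alpha) <= Theta],
    which follows from [te0 ^ (- alpha) <= D / xi <= 2 * D <= D * c * (1 + A)]: here the lower
    bounds on [xi], [D] and [c] come in. *)
Let e_le : e <= te0.
Proof.
have t0 : 0 < te0 `^ (- alpha) by rewrite powR_gt0.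
have h : te0 `^ (- alpha) <= Theta.
  apply: (@le_trans _ _ (D * 2)).
    apply: (@le_trans _ _ (xi * te0 `^ (- alpha) * 2)); last by rewrite ler_pM2r.
    rewrite mulrAC ler_peMl ?(ltW t0)//; move: xi_half.
    by rewrite -(@ltr_pM2r _ 2)// mulVf//; lra.
  rewrite /Theta -mulrA ler_pM2l//; apply: (@le_trans _ _ (1 * (1 + A))).
    by rewrite mul1r; move: A2; lra.
  by rewrite ler_pM2r// addr_gt0.
rewrite /e -[leRHS](_ : (te0 `^ (- alpha)) `^ (- alpha^-1) = te0); last first.
  by rewrite -powRrM mulrNN mulfV ?gt_eqF// powRr1// ltW.
rewrite (powRN Theta) (powRN (te0 `^ (- alpha))) lef_pV2 ?posrE ?powR_gt0//.
by apply: ge0_ler_powR => //; rewrite ?nnegrE ?invr_ge0 ?powR_ge0//; exact: ltW.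
Qed.

Let osc_small g v : (Vnorm alpha te0 g <= v%:E)%E ->
  (\int[m]_x osc g (eucl_ball x e) <= (v / Theta)%:E)%E.
Proof.
move=> gv.
have : ((e `^ (- alpha))%:E * \int[m]_x osc g (eucl_ball x e) <= v%:E)%E.
  apply: le_trans gv; apply: (@le_trans _ _ (var_seminorm alpha te0 g)).
    by apply: ereal_sup_ubound; exists e => //=; rewrite e0.
  by rewrite leeDr// integral_ge0.
rewrite e_alpha mulrC; move: (\int[m]_x _)%E => I h.
by rewrite [leRHS]EFinM lee_pdivlMl.
Qed.

(** The functions [g] stand for transported approximants of mass [l]. In the bound on their norm,
    [th * dl] is what is left of the initial norm and [D * A * l] is the geometric series of the
    Lasota-Yorke errors. *)
Lemma support_lower_bound :
  (forall dl : R, 0 < dl -> exists (g : 'rV[R]_N -> R) (l : R), [/\ measurable_fun setT g, forall x, 0 <= g x,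
     forall x, ~ C x -> g x = 0, L1norm g = l%:E &
     (Vnorm alpha te0 g <= (th * dl + D * A * l)%:E)%E /\
     (\int[m]_x `|(g x - H x)%:E| <= dl%:E)%E]) ->
  (m (eucl_ball 0 e) <= m [set x | (0 < H x)%R])%E.
Proof.
move=> approx.
(* [q0 < 1] bounds the mean oscillation of [g] over balls of radius [e], since
   [e `^ alpha = Theta^-1] and [g] has mass almost 1. *)
pose q0 := A / (1 + A); pose b := th / Theta.
have q01 : q0 < 1 by rewrite /q0 ltr_pdivrMr ?addr_gt0// mul1r ltrDr.
have q0_ge0 : 0 <= q0 by rewrite divr_ge0 ?ltW// addr_gt0.
have b0 : 0 <= b by rewrite divr_ge0 ?ltW// (lt_le_trans _ th1).
(* Half of the gap [1 - q0] is spent on the level, as [k * c = (1 - q0) / 2]. The errors total at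
   most [(b + 2) * dl], which [dl0] keeps below a quarter of the gap. *)
pose k := (1 - q0) / (2 * c).
have c0 : 0 < c by rewrite (lt_le_trans _ c1).
have k0 : 0 < k by rewrite divr_gt0 ?subr_gt0// mulr_gt0.
pose dl0 := (1 - q0) / (4 * (b + 2)).
have dl00 : 0 < dl0 by rewrite divr_gt0 ?subr_gt0// mulr_gt0// ltr_wpDl.
apply/lee_addgt0Pr => eps eps0.
pose dl := Num.min dl0 (eps * k).
have dl_gt0 : 0 < dl by rewrite lt_min dl00 mulr_gt0.
have [g [l [mg g0 gC gl [gV gH]]]] := approx dl dl_gt0.
have El : (\int[m]_x (g x)%:E = l%:E)%E by rewrite -gl; apply: eq_integral => x _; rewrite /= ger0_norm.
have [l_le l_ge] : l <= 1 + dl /\ 1 <= l + dl.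
  have := L1_le_dist m mg mH g0 H0; have := L1_le_dist m mH mg H0 g0.
  have -> : (\int[m]_x `|(H x - g x)%:E| = \int[m]_x `|(g x - H x)%:E|)%E.
    by apply: eq_integral => x _; rewrite !abse_EFin distrC.
  rewrite El H1 => h1 h2; split; rewrite -lee_fin EFinD.
    by apply: le_trans h2 _; rewrite addeC leeD2l.
  by apply: le_trans h1 _; rewrite addeC leeD2l.
(* The quotient equals [q0 / c], and [c >= 1]. *)
have DA : D * A / Theta <= q0.
  rewrite ler_pdivrMr// (_ : q0 * Theta = D * A * c).
    by rewrite ler_peMr// mulr_ge0 ?ltW.
  by rewrite /q0 /Theta; field; rewrite gt_eqF// addr_gt0.
apply: (@le_trans _ _ (m [set x | (0 < H x)%R] + (dl / k)%:E)%E); last first.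
  by rewrite leeD2l// lee_fin ler_pdivrMr// ge_min lexx orbT.
apply: (@osc_support_ball _ _ C g H e ((th * dl + D * A * l) / Theta) k c dl) => //.
- exact: osc_small.
rewrite El lte_fin.
have -> : k * c = (1 - q0) / 2 by rewrite /k; field; rewrite gt_eqF.
have h1 : (th * dl + D * A * l) / Theta <= b * dl + q0 * (1 + dl).
  rewrite mulrDl lerD//; first by rewrite /b mulrAC.
  rewrite mulrAC ler_pM//; first by rewrite ltW// divr_gt0// mulr_gt0.
  by rewrite -lee_fin -gl integral_ge0.
have h2 : dl * (4 * (b + 2)) <= 1 - q0.
  by rewrite -ler_pdivlMr ?mulr_gt0// ?ltr_wpDl// ge_min lexx.
nra.
Qed.

End support_lower_bound.

Lemma ae_not_false d (T : measurableType d) (R : realType) (P : probability T R) :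
  ~ (\forall x \ae P, False).
Proof.
case=> A [mA A0 sub].
have : (P setT <= P A)%E by apply: le_measure; rewrite ?inE// => x _; exact: sub.
by rewrite A0 probability_setT lee_fin ler10.
Qed.

(** * The support of an invariant density over almost every fiber *)

Section acip_support.
Context {R : realType} {N : nat} {Omega : ptopologicalType}.
Variables (P : probability (borel Omega) R) (X : saussol_data R N Omega)
  (sigma sigmaV : Omega -> Omega).
Local Notation m := (@lebesgue_rV R N).
Local Notation C := (sC X).
Local Notation alpha := (salpha X).
Local Notation bO := (borel Omega).
Local Notation phase := ([set: bO] `*` C).

Lemma skew_acip_marginal mu : skew_acip P X sigma mu ->
  forall E : set bO, measurable E -> (mu (E `*` [set: 'rV[R]_N]) = P E)%E.
Proof.
case=> _ [k [kC _ muE]] E mE; rewrite muE; last exact: measurableX.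
have <- : (\int[P]_w (\1_E w)%:E = P E)%E 
  by rewrite -[in RHS](setIT E); exact: (@integral_indic _ _ _ P setT measurableT E mE).
apply: eq_integral => w _; rewrite indicE; case: (boolP (w \in E)) => Ew.
  by rewrite in_xsectionX//; exact: prob_kernel.
by rewrite notin_xsectionX// measure0.
Qed.

Hypothesis base : @invertible_ergodic _ (borel Omega) R P sigma sigmaV.
Hypotheses (N0 : (0 < N)%N) (cC : compact C) (alpha01 : 0 < alpha <= 1).
Hypothesis mskew : measurable_fun phase (skew_product X sigma).
Variables (te0 c : R).
Hypotheses (te00 : 0 < te0) (Cc : m C = c%:E) (c1 : 1 <= c).
Hypothesis bounded : forall w, bounded_op C alpha te0 (transfer X w).
Hypothesis good : \forall w \ae P, good_fiber X w.

Let mC : measurable C. Proof. exact: compact_rV_measurable. Qed.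

Variables (mu : probability (bO * 'rV[R]_N)%type R) (H : bO * 'rV[R]_N -> R).
Hypotheses (mH : measurable_fun setT H) (H0 : forall p, 0 <= H p).
Hypothesis muH : forall A, measurable A -> (mu A = \int[P \x leb N]_(p in A) (H p)%:E)%E.
Hypothesis mu_inv : preserves mu phase (skew_product X sigma).
Hypothesis marg : forall E : set bO, measurable E -> (mu (E `*` [set: 'rV[R]_N]) = P E)%E.

Let msV : measurable_fun [set: bO] (sigmaV : bO -> bO).
Proof. by have [_ []] := base. Qed.

Let mHw (w : bO) : measurable_fun setT (fun x : 'rV[R]_N => H (w, x)).
Proof. by apply: measurableT_comp. Qed.

(** Invariance places the density on [C], which is compact, while the bump functions need an open
    set. The union of the branch domains of one good fiber is open and misses only a null part of
    [C]; it does not depend on [w]. *)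
Lemma density_off_open : exists O : set 'rV[R]_N, [/\ open O, O `<=` C &
  \forall p \ae (P \x leb N)%E, ~ O p.2 -> H p = 0].
Proof.
have [w0 [_ _ CU _ Uopen]] : exists w, good_fiber X w.
  apply: contrapT => /forallNP nogood; apply: (@ae_not_false _ _ _ P).
  by apply: ae_mono good => w; exact: nogood.
pose O := \bigcup_(i in sI X w0) sU X w0 i.
have oO : open O by apply: bigcup_open => i Ii; have [] := Uopen i Ii.
have OC : O `<=` C by move=> x [i Ii Ux]; have [_ UC _] := Uopen i Ii; exact: UC.
exists O; split => //.
have mO : measurable O by exact: open_rV_measurable.
have mOc : measurable (~` O) by exact: measurableC.
have int0 : (\int[P \x leb N]_(p in setT `*` ~` O) (H p)%:E = 0)%E.
  rewrite -muH; last exact: measurableX.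
  rewrite (dens_rect mH H0 muH measurableT mOc).
  have off : \forall w \ae P, setT w -> (\int[leb N]_(x in ~` O) (H (w, x))%:E = 0)%E.
    apply: ae_mono (fiber_off_C mC mH H0 muH mu_inv) => w h _.
    rewrite lebE -[RHS]h (@ge0_negligible_integral _ _ _ m (~` O) (C `\` O)).
    - congr (integral _ _ _); apply/seteqP; split => x /=.
        by move=> [nO nCO] Cx; apply: nCO.
      by move=> nC; split => [/OC|[]].
    - exact: measurableD.
    - exact: mOc.
    - by apply: measurable_funTS; exact/measurable_EFinP.
    - by move=> x _; rewrite lee_fin.
    - exact: CU.
  have mF : measurable_fun setT (fun w : bO => \int[leb N]_(x in ~` O) (H (w, x))%:E)%E.
    have := dens_section_measurable mH H0 (measurableX measurableT mOc).
    by congr (measurable_fun _ _); apply/funext => w; rewrite in_xsectionX// inE.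
  rewrite (@ge0_ae_eq_integral _ _ _ P setT _ (cst 0%E) measurableT mF)//.
  - by rewrite integral_cst// mul0e.
  - by move=> w _; apply: integral_ge0 => x _; rewrite lee_fin.
have := int0; rewrite (eq_integral (fun p => `|(H p)%:E|)%E); last first.
  by move=> p _; rewrite abse_EFin ger0_norm.
have mTO : measurable (setT `*` ~` O : set (bO * 'rV[R]_N)) by exact: measurableX.
have mHO : measurable_fun (setT `*` ~` O) (EFin \o H).
  by apply: measurable_funTS; exact/measurable_EFinP.
move/(ae_eq_integral_abs (P \x leb N)%E mTO mHO); apply: ae_mono => p hp nO.
by have := hp (conj I nO) => -[].
Qed.

Let miter j : measurable_fun [set: bO] (iter j sigmaV : bO -> bO).
Proof.
elim: j => [|i IH]; first exact: measurable_id.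
exact: (measurableT_comp msV IH).
Qed.

Let int_sigmaV_iter j (F : bO -> \bar R) : measurable_fun setT F -> (forall w, 0 <= F w)%E ->
  (\int[P]_w F (iter j sigmaV w) = \int[P]_w F w)%E.
Proof.
move=> mF F0; elim: j => [//|j <-].
have := int_sigmaV base (measurableT_comp mF (miter j)) (fun w => F0 (iter j sigmaV w)).
by move=> <-; apply: eq_integral => w _; rewrite iterSr.
Qed.

(* The rate at which a fixed Lipschitz approximation tends to the density is not
   controlled fiber by fiber; a Markov bound on the mean error gives, for almost every
   [w], one good index among countably many. *)
Lemma fiber_approximation (xi dl : R) : 0 < xi < 1 -> 0 < dl -> \forall w \ae P,
  exists (f : 'rV[R]_N -> R) (j : nat) (M : R), [/\ Valpha C alpha te0 f, forall x, 0 <= f x,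
    (Vnorm alpha te0 f <= M%:E)%E, 0 <= M /\ xi ^+ j * M <= dl &
    (\int[m]_x `|(f x - H (iter j sigmaV w, x))%:E| <= dl%:E)%E].
Proof.
move=> /andP[xi0 xi1] dl0.
have [U [oU UC HU]] := density_off_open.
have /andP[a0 a1] := alpha01.
have Hoo : (\int[P \x leb N]_p (H p)%:E < +oo)%E.
  by rewrite -(muH measurableT) probability_setT ltry.
pose good_approx (n : nat) (q : (bO * 'rV[R]_N -> R) * R * R * nat) :=
  [/\ lipschitz_family C q.1.1.2 q.1.1.1, forall p, 0 <= q.1.1.1 p,
    (\int[P \x leb N]_p `|(q.1.1.1 p - H p)%:E| <= (dl * n.+1%:R^-1)%:E)%E,
    forall f, lipschitz_on_C C q.1.1.2 f -> Valpha C alpha te0 f /\ (Vnorm alpha te0 f <= q.1.2%:E)%E &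
    0 <= q.1.2 /\ xi ^+ q.2 * q.1.2 <= dl].
have /choice[q hq] : forall n, exists q, good_approx n q.
  move=> n; have dn : 0 < dl * n.+1%:R^-1 by rewrite divr_gt0.
  have [Phi [L [hL Phi0 hPhi]]] := lip_approx_nonneg N0 cC oU UC mH H0 Hoo HU dn.
  have [_ L0 _] := hL.
  have [M0 hM0] := lipschitz_Vnorm cC a1 te00 N0 L0.
  pose M := Num.max M0 0.
  have hM f : lipschitz_on_C C L f -> Valpha C alpha te0 f /\ (Vnorm alpha te0 f <= M%:E)%E.
    move=> /hM0[Vf fM]; split; [exact: Vf|apply: (le_trans fM)].
    by rewrite lee_fin le_max lexx.
  (* The norm bound [M] may grow as the approximation improves; the number of steps is chosen after
     it. *)
  have [j hj] : exists j, xi ^+ j * M <= dl.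
    have cM : (fun j => xi ^+ j * M) @ \oo --> (0 * M : R).
      by apply: cvgM; [apply: cvg_expr; rewrite ger0_norm// ltW|exact: cvg_cst].
    rewrite mul0r in cM; have [j _ hj] := cvgr0_norm_le _ cM _ dl0.
    by exists j; apply: le_trans (hj j (leqnn j)); rewrite ler_norm.
  by exists (Phi, L, M, j); split => //; split => //; rewrite le_max lexx orbT.
pose a n (w : bO) := (\int[leb N]_x `|((q n).1.1.1 (w, x) - H (w, x))%:E|)%E.
have ma n : measurable_fun setT (a n).
  have [[mPhi _ _] _ _ _ _] := hq n.
  have mf : measurable_fun setT (fun p => `|((q n).1.1.1 p - H p)%:E|)%E by exact: measurable_abs_sub.
  exact: (@measurable_fun_fubini_tonelli_F _ _ _ _ R (leb N) _ mf (fun p => abse_ge0 _)).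
have a_ge0 n w : (0 <= a n w)%E by exact: integral_ge0.
(* Invariance of [P] makes the mean error over the fibers of sigma^-j w independent of [j]. *)
have inta n : (\int[P]_w a n (iter (q n).2 sigmaV w) <= (dl * n.+1%:R^-1)%:E)%E.
  have [[mPhi _ _] _ hPhi _ _] := hq n.
  have mf : measurable_fun setT (fun p => `|((q n).1.1.1 p - H p)%:E|)%E by exact: measurable_abs_sub.
  rewrite (int_sigmaV_iter (q n).2 (ma n) (a_ge0 n)); apply: le_trans hPhi.
  by rewrite (@fubini_tonelli1 _ _ _ _ R P (leb N) _ mf (fun p => abse_ge0 _)).
pose B n := [set w : bO | (dl%:E < a n (iter (q n).2 sigmaV w))%E].
have mai n : measurable_fun setT (fun w : bO => a n (iter (q n).2 sigmaV w)).
  exact: (measurableT_comp (ma n) (miter _)).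
have mB n : measurable (B n).
  rewrite (_ : B n = setT `&` (fun w : bO => a n (iter (q n).2 sigmaV w)) @^-1` `]dl%:E, +oo[%classic).
    by apply: mai => //; exact: emeasurable_itv.
  by rewrite setTI; apply/seteqP; split => w /=; rewrite in_itv /= andbT.
have PB n : (P (B n) <= (n.+1%:R^-1)%:E)%E.
  have dlE : (0 < dl%:E)%E by rewrite lte_fin.
  rewrite -(@lee_pmul2l _ dl%:E)// -EFinM; apply: le_trans (inta n).
  rewrite -(integral_cst P (mB n)).
  apply: (@le_trans _ _ (\int[P]_(w in B n) a n (iter (q n).2 sigmaV w))%E).
    apply: ge0_le_integral => //.
    - by move=> w _; rewrite lee_fin ltW.
    - exact: measurable_funTS.
    by move=> w /ltW.
  by apply: ge0_subset_integral.
have mcap : measurable (\bigcap_n B n) by exact: bigcapT_measurable.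
exists (\bigcap_n B n); split; first exact: mcap.
  apply/eqP; rewrite eq_le measure_ge0 andbT; apply/lee_addgt0Pr => e e0; rewrite add0e.
  have [n _ ne] := near_infty_natSinv_lt (PosNum e0).
  apply: (@le_trans _ _ (P (B n))); first by apply: le_measure; rewrite ?inE//; exact: bigcap_inf.
  by apply: le_trans (PB n) _; rewrite lee_fin ltW//; exact: (ne n (leqnn n)).
move=> w /= nex n _; rewrite /B /= ltNge; apply/negP => an; apply: nex.
have [[mPhi L0 lip] Phi0 _ hM hj] := hq n.
pose w' := iter (q n).2 sigmaV w.
have [VPhi VM] := hM _ (lip w').
by exists (fun x => (q n).1.1.1 (w', x)), (q n).2, (q n).1.2; split => //; rewrite -lebE.
Qed.

Theorem acip_support_ge (e0 : R) (eta : Omega -> R) (D xi : R) (j0 : Omega -> nat) :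
  te0 = sS X * e0 -> lasota_yorke_data P X sigmaV e0 eta D xi j0 ->
  \forall w \ae P, (m (eucl_ball 0 (LY_Theta X sigmaV eta D xi j0 w `^ (- alpha^-1))) <=
     m [set x | (0 < H (w, x))%R])%E.
Proof.
move=> te0E LY.
have [meta eta0 _ D0 LYineq _ xi1 xi_half D_large decay] := LY.
have xi0 : 0 < xi by apply: lt_trans xi_half; rewrite invr_gt0.
have /andP[a0 a1] := alpha01.
have [[_ sVK] _ _ _] := base.
have approx : \forall w \ae P, forall n : nat, exists (f : 'rV[R]_N -> R) (j : nat) (M : R),
    [/\ Valpha C alpha te0 f, forall x, 0 <= f x,
    (Vnorm alpha te0 f <= M%:E)%E, 0 <= M /\ xi ^+ j * M <= n.+1%:R^-1 &
    (\int[m]_x `|(f x - H (iter j sigmaV w, x))%:E| <= n.+1%:R^-1%:E)%E].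
  by apply: ae_foralln => n; apply: fiber_approximation; rewrite ?xi0// invr_gt0.
(* Each almost sure property is needed along the whole backward orbit of [w], which costs countably
   many null sets. *)
have mass := ae_orbit base (fiber_mass mH H0 muH marg).
have inv := ae_orbit base (fiber_invariant base mC mskew mH H0 muH mu_inv marg).
have ogood := ae_orbit base good.
have oLY := ae_orbit base LYineq.
have mT := fiber_map_measurable mC mskew.
apply: (ae_mono _ (ae_and approx (ae_and mass (ae_and inv (ae_and ogood (ae_and oLY decay)))))).
move=> w [ap [ms [iv [gw [lyw dec]]]]].
rewrite /LY_Theta Cc /=.
have Dl : xi * te0 `^ (- alpha) <= D by rewrite te0E.
have E := support_lower_bound a0 te00 mC Cc c1 D0 (LY_theta_ge1 sigmaV eta xi j0 w) xi_half xi1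
  Dl (mHw w) (fun x => H0 (w, x)) (ms 0%N).
apply: E => dl dl0.
have [n ndl] : exists n : nat, n.+1%:R^-1 <= dl.
  have [n _ ne] := near_infty_natSinv_lt (PosNum dl0).
  by exists n; rewrite ltW//; exact: (ne n (leqnn n)).
have [f [j [M [Vf f0 fM [M0 Mdl] fH]]]] := ap n.
pose l := fine (\int[m]_x (f x)%:E).
have fl : L1norm f = l%:E.
  rewrite (L1norm_ge0E f0) fineK// ge0_fin_numE; first exact: Valpha_lty Vf f0.
  by apply: integral_ge0 => x _; rewrite lee_fin.
have gwS i : good_fiber X (iter i.+1 sigmaV w) := gw i.+1.
have Vg := cocycle_Valpha sigmaV bounded j w Vf.
have g0 := @cocycle_ge0 _ _ _ X sigmaV j w f f0.
exists (cocycle X sigmaV j w f), l; split; [exact: Valpha_measurable Vg|exact: g0|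
  |by rewrite (L1norm_ge0E g0) (cocycle_mass bounded mC mT j gwS Vf f0) -(L1norm_ge0E f0)|].
  by have [[_ gC] _] := Vg.
have l0 : 0 <= l by rewrite fine_ge0//; apply: integral_ge0 => x _; rewrite lee_fin.
split.
  have LYS i g : Valpha C alpha te0 g -> (Vnorm alpha te0 (transfer X (iter i.+1 sigmaV w) g) <=
      (eta (iter i.+1 sigmaV w))%:E * Vnorm alpha te0 g + D%:E * L1norm g)%E.
    by rewrite te0E; exact: lyw i.+1 g.
  apply: (le_trans (cocycle_Vnorm bounded mC mT j eta0 D0 gwS LYS Vf f0 fM fl)).
  rewrite lee_fin lerD//.
    apply: (@le_trans _ _ (LY_theta sigmaV eta xi j0 w * xi ^+ j * M)).
      by rewrite ler_wpM2r// (iter_eta_le_theta xi0 dec).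
    rewrite -mulrA ler_wpM2l//; first exact: le_trans (LY_theta_ge1 _ _ _ _ _).
    exact: le_trans Mdl ndl.
  by rewrite ler_wpM2r// ler_wpM2l ?(ltW D0)// (sum_iter_eta_le xi0 xi1 dec).
have h := @cocycle_L1_contract _ _ _ X sigmaV te0 bounded mC mT (fun w x => H (w, x)) sigma
  j w f sVK mHw (fun w x => H0 (w, x)) gwS ms (fun i => iv i.+1) Vf f0.
by apply: (le_trans h); apply: (le_trans fH); rewrite lee_fin.
Qed.

End acip_support.

(** * Counting ergodic measures *)

Lemma ae_forall_fin d (T : measurableType d) (R : realType) (mu : {measure set T -> \bar R})
    (I : finType) (Q : I -> T -> Prop) : (forall i, \forall x \ae mu, Q i x) ->
  \forall x \ae mu, forall i, Q i x.
Proof. by move=> h; apply: filter_forall. Qed.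

Section counting.
Context {R : realType} {N : nat} {Omega : ptopologicalType}.
Variables (P : probability (borel Omega) R).
Local Notation m := (@lebesgue_rV R N).
Local Notation bO := (borel Omega).

Lemma ae_prod_section (Q : bO * 'rV[R]_N -> Prop) : (\forall p \ae (P \x leb N)%E, Q p) ->
  \forall w \ae P, \forall x \ae m, Q (w, x).
Proof.
case=> A [mA A0 sub].
have mF : measurable_fun setT (fun w : bO => leb N (xsection A w)).
  exact: measurable_fun_xsection.
have : (\int[P]_w `|leb N (xsection A w)| = 0)%E.
  by rewrite -[RHS]A0; apply: eq_integral => w _; rewrite gee0_abs.
move/(ae_eq_integral_abs P measurableT mF); apply: ae_mono => w /(_ I) /= A0w.
exists (xsection A w); split; [exact: measurable_xsection|by rewrite -lebE|].
by move=> x nQ; apply/mem_set; exact: sub.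
Qed.

Lemma sum_supports_le (C : set 'rV[R]_N) r (h : 'I_r -> 'rV[R]_N -> R) : measurable C ->
  (forall i, measurable_fun setT (h i)) ->
  (\forall x \ae m, forall i, ~ C x -> h i x = 0) ->
  (\forall x \ae m, forall ij : 'I_r * 'I_r, ij.1 != ij.2 -> h ij.1 x = 0 \/ h ij.2 x = 0) ->
  (\sum_(i < r) m [set x | (0 < h i x)%R] <= m C)%E.
Proof.
move=> mC mh hC hdisj.
have mS i : measurable [set x | (0 < h i x)%R] by exact: measurable_lt_set.
have intS (A : set 'rV[R]_N) : measurable A -> (\int[m]_x (\1_A x)%:E = m A)%E.
  by move=> mA; rewrite -[in RHS](setIT A); exact: (@integral_indic _ _ _ m setT measurableT A mA).
rewrite -(intS C mC) (eq_bigr (fun i => \int[m]_x (\1_[set x | (0 < h i x)%R] x)%:E)%E); last first.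
  by move=> i _; rewrite intS.
rewrite -ge0_integral_sum//; last by move=> i; apply/measurable_EFinP; exact: measurable_indic.
apply: ae_ge0_le_integral => //.
- by move=> x _; apply: sume_ge0 => i _; rewrite lee_fin.
- by apply: emeasurable_sum => i; apply/measurable_EFinP; exact: measurable_indic.
- by apply/measurable_EFinP; exact: measurable_indic.
apply: ae_mono (ae_and hC hdisj) => x [xC xdisj] _.
rewrite sumEFin lee_fin.
have [[i hi]|none] := pselect (exists i, 0 < h i x); last first.
  rewrite big1 => [|i _]; first by rewrite indicE.
  by rewrite indicE memNset// => hi; apply: none; exists i.
have Cx : C x by apply: contrapT => /xC -/(_ i) h0; rewrite h0 ltxx in hi.
rewrite (bigD1 i)//= big1 => [|j ji].
  by rewrite addr0 !indicE mem_set// mem_set.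
rewrite indicE memNset//= => hj.
by have /= [h0|h0] := xdisj (j, i) ji; [rewrite h0 ltxx in hj|rewrite h0 ltxx in hi].
Qed.

End counting.

Section number_of_acips.
Context {R : realType} {N : nat} {Omega : ptopologicalType}.
Variables (P : probability (borel Omega) R) (X : saussol_data R N Omega)
  (sigma sigmaV : Omega -> Omega).
Local Notation m := (@lebesgue_rV R N).
Local Notation C := (sC X).
Local Notation alpha := (salpha X).
Local Notation bO := (borel Omega).
Local Notation prob := (probability (bO * 'rV[R]_N)%type R).

Definition distinct_acips r (mu : 'I_r -> prob) :=
  (forall i, ergodic_skew_acip P X sigma (mu i)) /\
  (forall i j, {in measurable, mu i =1 mu j} -> i = j).

(** A family of distinct ergodic measures of maximal size contains all of them: a further one could
    be appended to it. *)
Lemma number_of_ergodic_acips_of_bound (B : nat) :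
  (forall r (mu : 'I_r -> prob), distinct_acips mu -> (r <= B)%N) ->
  exists r (mu : 'I_r -> prob), distinct_acips mu /\ number_of_ergodic_acips P X sigma r.
Proof.
move=> bnd; pose fam r := `[< exists mu : 'I_r -> prob, distinct_acips mu >].
have fam0 : exists r, fam r.
  exists 0%N; apply/asboolP; exists (fun i : 'I_0 => match notF (ltn_ord i) with end).
  by split => -[].
have famB r : fam r -> (r <= B)%N by move=> /asboolP[mu]; exact: bnd.
have [r /asboolP[mu dmu] rmax] := ex_maxnP fam0 famB.
have [erg inj] := dmu.
exists r, mu; split => //; exists mu; split => // nu ergnu; apply: contrapT => /forallNP new.
suff : fam r.+1 by move=> /rmax; rewrite ltnn.
apply/asboolP; exists (fun i => if unlift ord_max i is Some j then mu j else nu).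
split => [i|i j]; first by case: unliftP.
case: unliftP => [i' ->|->]; case: unliftP => [j' ->|->] // h.
- by rewrite (inj i' j' h).
- by exfalso; apply: (new i') => A mA; rewrite h.
- by exfalso; apply: (new j').
Qed.

Hypothesis base : @invertible_ergodic _ (borel Omega) R P sigma sigmaV.
Hypotheses (N0 : (0 < N)%N) (cC : compact C) (alpha01 : 0 < alpha <= 1).
Hypothesis mskew : measurable_fun ([set: bO] `*` C) (skew_product X sigma).
Variables (te0 c : R).
Hypotheses (te00 : 0 < te0) (Cc : m C = c%:E) (c1 : 1 <= c).
Hypothesis bounded : forall w, bounded_op C alpha te0 (transfer X w).
Hypothesis good : \forall w \ae P, good_fiber X w.
Variables (e0 : R) (eta : Omega -> R) (D xi : R) (j0 : Omega -> nat).
Hypotheses (te0E : te0 = sS X * e0) (LY : lasota_yorke_data P X sigmaV e0 eta D xi j0).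
Local Notation Theta := (LY_Theta X sigmaV eta D xi j0).
Local Notation gamma := (fine (m (eucl_ball 0 1))).

Let mC : measurable C. Proof. exact: compact_rV_measurable. Qed.

Lemma LY_Theta_gt0 w : 0 < Theta w.
Proof.
have [_ _ _ D0 _ _ xi1 _ _ _] := LY.
rewrite /LY_Theta Cc /= !mulr_gt0// ?(lt_le_trans _ c1)//.
rewrite addr_gt0// divr_gt0 ?subr_gt0//.
exact: lt_le_trans (LY_theta_ge1 _ _ _ _ _).
Qed.

Lemma ball_volume : m (eucl_ball 0 1) = gamma%:E /\ 0 < gamma.
Proof.
have g0 : (0 < m (eucl_ball (0 : 'rV[R]_N) 1))%E by exact: eucl_ball_gt0.
have goo : (m (eucl_ball (0 : 'rV[R]_N) 1) < +oo)%E by exact: eucl_ball_lty.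
by split; [rewrite fineK// ge0_fin_numE// ltW|rewrite fine_gt0// g0 goo].
Qed.

(** Over almost every fiber each of the [r] supports has at least the volume of the ball of radius
    [Theta ^ (- alpha^-1)], and the supports are disjoint in [C] up to null sets. *)
Lemma distinct_acips_volume r (mu : 'I_r -> prob) : distinct_acips mu ->
  \forall w \ae P, r%:R * gamma / c <= Theta w `^ (N%:R / alpha).
Proof.
move=> [erg inj].
have mphase : measurable ([set: bO] `*` C) by exact: measurableX.
have /choice[H hH] : forall i, exists H : bO * 'rV[R]_N -> R,
    [/\ measurable_fun setT H, forall p, 0 <= H p &
    forall A, measurable A -> (mu i A = \int[P \x leb N]_(p in A) (H p)%:E)%E].
  by move=> i; exact: (acip_density (proj1 (erg i))).
have marg i := skew_acip_marginal (proj1 (erg i)).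
have supp i : \forall w \ae P, (m (eucl_ball 0 (Theta w `^ (- alpha^-1))) <=
     m [set x | (0 < H i (w, x))%R])%E.
  have [mH H0 muH] := hH i.
  exact: (acip_support_ge base N0 cC alpha01 mskew te00 Cc c1 bounded good mH H0 muH
    (proj1 (proj1 (erg i))) (marg i) te0E LY).
have off i : \forall w \ae P, \forall x \ae m, ~ C x -> H i (w, x) = 0.
  have [mH H0 muH] := hH i.
  have [U [_ UC HU]] := density_off_open cC good mH H0 muH (proj1 (proj1 (erg i))).
  apply: (@ae_prod_section _ _ _ P (fun p => ~ C p.2 -> H i p = 0)); apply: ae_mono HU => p hp nC; apply: hp => /UC; exact: nC.
have disj (ij : 'I_r * 'I_r) : \forall w \ae P, \forall x \ae m,
    ij.1 != ij.2 -> H ij.1 (w, x) = 0 \/ H ij.2 (w, x) = 0.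
  case: ij => i j.
  apply: (@ae_prod_section _ _ _ P (fun p => i != j -> H i p = 0 \/ H j p = 0)).
  have [mHi Hi0 muHi] := hH i; have [mHj Hj0 muHj] := hH j.
  have [eqm|] := ergodic_eq_or_singular mphase mskew mHi mHj Hi0 Hj0 muHi muHj
    (proj1 (proj1 (erg i))) (proj1 (proj1 (erg j))) (proj2 (erg i)) (proj2 (erg j)).
    by rewrite (inj i j eqm); apply: aeW => p; rewrite eqxx.
  by apply: ae_mono.
apply: (ae_mono _ (ae_and (ae_forall_fin supp) (ae_and (ae_forall_fin off) (ae_forall_fin disj)))).
move=> w [suppw [offw disjw]].
have mHw i : measurable_fun setT (fun x => H i (w, x)).
  by have [mH _ _] := hH i; apply: measurableT_comp.
have := @sum_supports_le R N C r (fun i x => H i (w, x)) mC mHw (ae_forall_fin offw) (ae_forall_fin disjw).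
have [gE g0] := ball_volume.
have T0 := LY_Theta_gt0 w; have /andP[a0 _] := alpha01.
have e_gt0 : 0 < Theta w `^ (- alpha^-1) by rewrite powR_gt0.
move=> /(le_trans (lee_sum _ (fun i _ => suppw i))).
rewrite (eq_bigr (fun=> (Theta w `^ (- alpha^-1) ^+ N * gamma)%:E)); last first.
  by move=> i _; rewrite (eucl_ball_scale _ e_gt0) gE.
rewrite sumEFin Cc lee_fin sumr_const card_ord => h.
rewrite ler_pdivrMr ?(lt_le_trans _ c1)//.
rewrite -(@ler_pM2l _ (Theta w `^ (- alpha^-1) ^+ N)) ?exprn_gt0//.
have -> : Theta w `^ (- alpha^-1) ^+ N * (Theta w `^ (N%:R / alpha) * c) = c.
  rewrite mulrA -powR_mulrn ?ltW// -powRrM -powRD; last by apply/implyP => _; rewrite gt_eqF.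
  by rewrite mulNr (mulrC alpha^-1) addNr powRr0 mul1r.
by rewrite mulrCA mulr_natl.
Qed.

Theorem number_of_acips_le : exists r : nat, number_of_ergodic_acips P X sigma r /\
  (r%:R%:E <= m C / m (eucl_ball 0 1) *
     ess_inf P (fun w => (Theta w `^ (N%:R / alpha))%:E))%E.
Proof.
have [gE g0] := ball_volume.
have c0 : 0 < c by exact: lt_le_trans c1.
(* An a priori bound on the sizes of families is needed before a maximal one can be taken. Theta is
   finite at every [w], so some integer [K] is not an almost sure lower bound for its power. *)
have [K hK] : exists K : nat, ~ \forall w \ae P, K%:R <= Theta w `^ (N%:R / alpha).
  apply: contrapT => /forallNP h; apply: (@ae_not_false _ _ _ P).
  have all_K : \forall w \ae P, forall K : nat, K%:R <= Theta w `^ (N%:R / alpha).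
    by apply: ae_foralln => K; apply: contrapT; exact: h.
  apply: ae_mono all_K => w; set t := Theta w `^ _ => /(_ (Num.truncn t).+1).
  by rewrite leNgt truncnS_gt.
have bnd r (mu : 'I_r -> prob) : distinct_acips mu -> (r <= Num.truncn (K%:R * c / gamma))%N.
  move=> /distinct_acips_volume rT.
  rewrite truncn_ge_nat ?divr_ge0 ?mulr_ge0 ?(ltW c0) ?(ltW g0)// ler_pdivlMr// leNgt.
  apply/negP => Kr; apply: hK; apply: ae_mono rT => w; apply: le_trans.
  by rewrite ler_pdivlMr// ltW.
have [r [mu [dmu num]]] := number_of_ergodic_acips_of_bound bnd.
exists r; split => //.
have : ((r%:R * gamma / c)%:E <= ess_inf P (fun w => (Theta w `^ (N%:R / alpha))%:E))%E.
  by apply/ess_infP; apply: ae_mono (distinct_acips_volume dmu) => w; rewrite lee_fin.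
have q0 : (0 <= (c / gamma)%:E)%E by rewrite lee_fin divr_ge0// ltW.
move=> /(lee_wpmul2l q0); rewrite Cc gE inver gt_eqF// -EFinM.
by congr (_ <= _)%E; congr EFin; field; rewrite !gt_eqF.
Qed.

End number_of_acips.

(** * The bound for random Saussol maps *)

Theorem theorem6p1 (R : realType) (N : nat) (N_gt1 : (1 < N)%N)
    (Omega : ptopologicalType) (P : probability (borel Omega) R)
    (sigma sigmaV : Omega -> Omega)
    (base : @invertible_ergodic _ (borel Omega) R P sigma sigmaV)
    (X : saussol_data R N Omega) (saussol : random_saussol_map P X)
    (measurable_skew :
      measurable_fun ([set: borel Omega] `*` sC X) (skew_product X sigma))
    (volume_ge1 : (1 <= lebesgue_rV N (sC X))%E) :
  \forall e0 \near 0^'+,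
    Pcontinuous_transfer X e0 ->
    log_integrable_transfer P X e0 ->
    forall (eta : Omega -> R) (D xi : R) (j0 : Omega -> nat),
      lasota_yorke_data P X sigmaV e0 eta D xi j0 ->
      exists r : nat, number_of_ergodic_acips P X sigma r /\
        (r%:R%:E <= lebesgue_rV N (sC X) / lebesgue_rV N (eucl_ball 0 1) *
           ess_inf P (fun w =>
             (LY_Theta X sigmaV eta D xi j0 w `^ (N%:R / salpha X))%:E))%E.
Proof.
have [part alpha01 S0 small] := saussol.
have [cC _ _ trivU branches] := part.
apply: filterS2 small (nbhs_right_gt 0) => e0 [_ pe2 [pe3 _] pe4 _] e00 [bounded _] _ eta D xi j0 LY.
(* (PE2), (PE3) and (PE4) supply the almost sure conditions of a good fiber; disjointness and
   openness of the branch domains hold for every [w]. *)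
have good : \forall w \ae P, good_fiber X w.
  apply: ae_mono (ae_and pe2 (ae_and pe3 pe4)) => w [h2 [h3 h4]]; split => //.
  - by move=> i Ii; exact: (proj1 (h2 i Ii)).
  - move=> i Ii; have [oU UC _ clU] := branches w i Ii; split => //.
    by apply: subset_trans clU; exact: subset_closure.
have Coo := compact_lebesgue_lty cC.
have Cc : lebesgue_rV N (sC X) = (fine (lebesgue_rV N (sC X)))%:E.
  by rewrite fineK// ge0_fin_numE.
have c1 : 1 <= fine (lebesgue_rV N (sC X)) by rewrite -lee_fin -Cc.
have te00 : 0 < sS X * e0 by rewrite mulr_gt0.
exact: (number_of_acips_le base (ltnW N_gt1) cC alpha01 measurable_skew te00 Cc c1 bounded
  good erefl LY).
Qed.
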